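(* Let $E\subset\mathbb{R}^2$ be an open set with smooth boundary that is weakly $1$-semiconvex and not $1$-semiconvex. Then $E$ consists of a minimum of four simply connected components (that is, the connected components of $E$ are simply connected and there are at least four of them).
   Context: A $1$-dimensional half-plane in $\mathbb{R}^2$ is a ray: an open ray starting at $p\in\mathbb{R}^2$ is a set $\{p+tv: t>0\}$ with $v\in\mathbb{R}^2\setminus\{0\}$, and a closed ray starting at $p$ is a set $\{p+tv: t\ge 0\}$. A set $E\subset\mathbb{R}^2$ is called $1$-semiconvex with respect to a point $x\in\mathbb{R}^2\setminus E$ if there exists a ray $L$ (open or closed) such that $x\in L$ and $L\cap E=\emptyset$. The set $E$ is called $1$-semiconvex if it is $1$-semiconvex with respect to every point $x\in\mathbb{R}^2\setminus E$. A set $E\subset\mathbb{R}^2$ is called weakly $1$-semiconvex if for every point $x\in\partial E$ there exists an open ray $L$ such that $x\in\overline{L}$ and $L\cap E=\emptyset$. When, as is always the intended use, $L$ is taken with boundary point (endpoint) $x$, one says that $L$ is a ray starting at $x$ and not intersecting $E$. ''Components'' means connected components. *)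

(* Defs.v *)
(* The plane is 'rV[R]_2 over R : realType; its norm is the sup norm, which
   induces the usual topology and differentials. *)
From mathcomp Require Import all_boot all_order all_algebra.
From mathcomp Require Import all_classical all_reals all_analysis.
Import Order.TTheory GRing.Theory Num.Theory.
Import numFieldNormedType.Exports.

Set Implicit Arguments.
Unset Strict Implicit.
Unset Printing Implicit Defensive.

Local Open Scope classical_set_scope.
Local Open Scope ring_scope.

Definition open_ray (R : realType) (p v : 'rV[R]_2) : set 'rV[R]_2 :=
  [set p + t *: v | t in [set t : R | 0 < t]].

Definition closed_ray (R : realType) (p v : 'rV[R]_2) : set 'rV[R]_2 :=
  [set p + t *: v | t in [set t : R | 0 <= t]].

Definition is_open_ray (R : realType) (L : set 'rV[R]_2) : Prop :=
  exists p v : 'rV[R]_2, v != 0 /\ L = open_ray p v.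

Definition is_closed_ray (R : realType) (L : set 'rV[R]_2) : Prop :=
  exists p v : 'rV[R]_2, v != 0 /\ L = closed_ray p v.

Definition semiconvex1_at (R : realType) (E : set 'rV[R]_2) (x : 'rV[R]_2) :
    Prop :=
  exists L : set 'rV[R]_2,
    [/\ is_open_ray L \/ is_closed_ray L, L x & L `&` E = set0].

Definition semiconvex1 (R : realType) (E : set 'rV[R]_2) : Prop :=
  forall x, ~ E x -> semiconvex1_at E x.

Definition boundary (T : topologicalType) (A : set T) : set T :=
  closure A `\` interior A.

(* If L is an open ray missing E and x lies in its closure, then the open
   subray of L starting at x also misses E, so asking that L start at x gives
   the same notion. *)
Definition weakly_semiconvex1 (R : realType) (E : set 'rV[R]_2) : Prop :=
  forall x : 'rV[R]_2, boundary E x ->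
    exists L : set 'rV[R]_2,
      [/\ is_open_ray L, closure L x & L `&` E = set0].

(* Meant for open U. *)
Definition C1_on (R : realType) (U : set 'rV[R]_2) (f : 'rV[R]_2 -> R) : Prop :=
  forall x, U x -> differentiable f x /\
    forall v : 'rV[R]_2, {for x, continuous (fun y => 'D_v f y)}.

(* Smooth means C^1: near each of its boundary points, E is the sublevel set
   {f < 0} of a C^1 local defining function with nonvanishing differential.
   Sets with boundary of class C^k for some 1 <= k <= oo all qualify. *)
Definition has_smooth_boundary (R : realType) (E : set 'rV[R]_2) : Prop :=
  forall p : 'rV[R]_2, boundary E p ->
    exists (U : set 'rV[R]_2) (f : 'rV[R]_2 -> R),
      [/\ open U, U p, C1_on U f,
          forall x, U x -> (E x <-> f x < 0)
        & forall x, U x -> exists v : 'rV[R]_2, 'd f x v != 0].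

Definition components (T : topologicalType) (A : set T) : set (set T) :=
  connected_component A @` A.

Definition path_connected (R : realType) (A : set 'rV[R]_2) : Prop :=
  forall x y : 'rV[R]_2, A x -> A y -> exists g : R -> 'rV[R]_2,
    [/\ {within `[0, 1], continuous g}, g @` `[0, 1] `<=` A,
        g 0 = x & g 1 = y].

(* H (s, t): s is the loop parameter and t the deformation parameter; the
   homotopy is relative to the base point. *)
Definition null_homotopic_in (R : realType) (A : set 'rV[R]_2)
    (g : R -> 'rV[R]_2) : Prop :=
  exists H : R * R -> 'rV[R]_2,
    [/\ {within `[0, 1] `*` `[0, 1], continuous H},
        H @` (`[0, 1] `*` `[0, 1]) `<=` A,
        forall s : R, 0 <= s <= 1 -> H (s, 0) = g s,
        forall s : R, 0 <= s <= 1 -> H (s, 1) = g 0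
      & forall t : R, 0 <= t <= 1 -> H (0, t) = g 0 /\ H (1, t) = g 0].

Definition simply_connected (R : realType) (A : set 'rV[R]_2) : Prop :=
  path_connected A /\
  forall g : R -> 'rV[R]_2, {within `[0, 1], continuous g} ->
    g @` `[0, 1] `<=` A -> g 0 = g 1 -> null_homotopic_in A g.

(* Main.v *)
(* Let x be a point outside E all of whose rays meet E. Follow a ray from x to its first contact p
   with the closure of E. By weak semiconvexity some ray from p, an exit, misses E, and it leaves the
   line of sight to its left or to its right. Turning the line of sight shows that both sides occur
   and that some p has exits on both of them. Smoothness at p prevents the angle between these two
   exits, on the side of x, from exceeding pi, so they bound a convex sector W around x, and every
   component of E lies in W or misses W. The same argument applies to unions of components that are
   nearer to x than the rest of E, and comparing the resulting sectors shows that there are at least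
   four components.

   Each component C satisfies the same hypotheses and is alone, so every point outside C starts a ray
   that misses C. Let v be a vertex of maximal norm of a closed polygon in C, with neighbours w and u.
   If the triangle v w u lies in C then v can be cut off. Otherwise let y be a point of the triangle
   outside C, first met when sweeping away from v parallel to the side w u. The ray that leaves y
   together with the segment [y, v] separates w from u, so the rest of the polygon meets this
   segment, and it then either has a vertex visible from v or crosses an edge at v; in both cases the
   polygon splits into two polygons with fewer edges. Hence all closed polygons, and so all loops, in
   C are null-homotopic. *)
Require Import Defs.
From mathcomp Require Import all_boot all_order all_algebra.
From mathcomp Require Import all_classical all_reals all_analysis.
From mathcomp Require Import ring lra zify.
Import Order.TTheory GRing.Theory Num.Theory.
Import numFieldNormedType.Exports.

Set Implicit Arguments.
Unset Strict Implicit.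
Unset Printing Implicit Defensive.

Local Open Scope classical_set_scope.
Local Open Scope card_scope.
Local Open Scope ring_scope.

(** * Vectors of the plane in polar coordinates *)

(** The obstacle in turning the line of sight is that the distance to the first contact is only
    lower semicontinuous in the direction: it can jump where the line of sight grazes a part of [E].
    At a grazing contact an exit on one side forces [E] to lie locally on the other side, so the
    distance varies continuously when turning away from the exit. All statements about turning are
    therefore one-sided, along [0^'+]: a missing exit on side [b] persists only when turning towards
    [b]. This is just enough for a supremum argument between a contact with a right exit and a later
    one with a left exit. Two sources provide such a pair: the boundary directions of the shadow of
    a part that some ray misses, and, for the whole of [E], which no ray misses, a sweep of the line
    of sight along an exit.

    In the polygon argument the norm that is maximised is Euclidean, hence strictly convex. This
    keeps the rest of the polygon off the prolongation of [[y, v]] beyond [v] and excludes that [w]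
    and [u] lie in opposite directions from [v]. *)

Section Plane.
Context {R : realType}.
Local Notation V := 'rV[R]_2.
Implicit Types (p q u v w x y z : V) (a b c r s t : R).

Definition vec (a b : R) : V := \row_i (if i == 0 then a else b).
Definition cross (p q : V) : R := p 0 0 * q 0 1 - p 0 1 * q 0 0.
Definition dot (p q : V) : R := p 0 0 * q 0 0 + p 0 1 * q 0 1.
Definition dir (a : R) : V := vec (cos a) (sin a).

Lemma vecP p q : p 0 0 = q 0 0 -> p 0 1 = q 0 1 -> p = q.
Proof.
move=> e0 e1; apply/rowP => i.
case: i => [[|[|//]] Hi].
- by rewrite (_ : Ordinal Hi = 0) //; apply/val_inj.
- by rewrite (_ : Ordinal Hi = 1) //; apply/val_inj.
Qed.

Lemma vec0 a b : vec a b 0 0 = a. Proof. by rewrite mxE. Qed.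
Lemma vec1 a b : vec a b 0 1 = b. Proof. by rewrite mxE. Qed.

Lemma coordD p q i : (p + q) 0 i = p 0 i + q 0 i. Proof. by rewrite mxE. Qed.
Lemma coordN p i : (- p) 0 i = - p 0 i. Proof. by rewrite mxE. Qed.
Lemma coordZ a p i : (a *: p) 0 i = a * p 0 i. Proof. by rewrite mxE. Qed.
Lemma coord0 i : (0 : V) 0 i = 0. Proof. by rewrite mxE. Qed.
Definition coordE := (coordD, coordN, coordZ, coord0, vec0, vec1).

Lemma cross_dir_dir a b : cross (dir a) (dir b) = sin (b - a).
Proof. by rewrite /cross !coordE sinB; ring. Qed.

Lemma dirD a b : dir (a + b) = cos b *: dir a + sin b *: dir (a + pi / 2).
Proof. by apply: vecP; rewrite !coordE ?cosD ?sinD ?cos_pihalf ?sin_pihalf; ring. Qed.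

Lemma dirDpi a : dir (a + pi) = - dir a.
Proof. by apply: vecP; rewrite !coordE ?cosDpi ?sinDpi. Qed.

Lemma dirBpi a : dir (a - pi) = - dir a.
Proof. by rewrite -[in RHS](subrK pi a) dirDpi opprK. Qed.

Lemma dirD2pi a : dir (a + pi *+ 2) = dir a.
Proof. by rewrite mulr2n addrA !dirDpi opprK. Qed.

Lemma dir_neq0 a : dir a != 0.
Proof.
apply/eqP => h; have := cos2Dsin2 a.
have <- : dir a 0 0 = cos a by rewrite !coordE.
have <- : dir a 0 1 = sin a by rewrite !coordE.
by rewrite h !coordE; lra.
Qed.

Lemma polar v : v != 0 ->
  exists r a, [/\ 0 < r, - pi < a, a <= pi & v = r *: dir a].
Proof.
move=> v0; set r := Num.sqrt (v 0 0 ^+ 2 + v 0 1 ^+ 2).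
have r2 : r ^+ 2 = v 0 0 ^+ 2 + v 0 1 ^+ 2.
  by rewrite sqr_sqrtr // addr_ge0 // sqr_ge0.
have r0 : 0 < r.
  rewrite lt_neqAle sqrtr_ge0 andbT eq_sym; apply/eqP => re.
  move/eqP: v0; apply; move: r2; rewrite re expr0n /=  => e.
  by apply: vecP; rewrite !coordE; nra.
have cl : -1 <= v 0 0 / r <= 1.
  by rewrite ler_pdivlMr // ler_pdivrMr //; apply/andP; split; nra.
have ca : cos (acos (v 0 0 / r)) = v 0 0 / r by rewrite acosK.
have sa : sin (acos (v 0 0 / r)) = `|v 0 1| / r.
  rewrite sin_acos //; apply/eqP.
  rewrite -(@eqrXn2 _ 2) ?sqrtr_ge0 ?divr_ge0 ?(ltW r0) //.
  rewrite sqr_sqrtr; last first.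
    by rewrite subr_ge0 -(expr1n _ 2) -[_ ^+ 2]real_normK ?num_real // lerXn2r ?nnegrE // ler_norml.
  rewrite !expr_div_n real_normK ?num_real // r2.
  apply/eqP; field; rewrite -r2; apply/eqP; nra.
have [v1|v1] := leP 0 (v 0 1).
- exists r, (acos (v 0 0 / r)); split => //.
  + by rewrite (lt_le_trans _ (acos_ge0 cl)) // oppr_lt0 pi_gt0.
  + exact: acos_lepi.
  + by apply: vecP; rewrite !coordE ?ca ?sa ?(ger0_norm v1) mulrCA divff ?mulr1 // gt_eqF.
- exists r, (- acos (v 0 0 / r)); split => //.
  + rewrite ltrN2 lt_neqAle acos_lepi // andbT; apply/eqP => h.
    by move: sa; rewrite h sinpi => /esym/eqP; rewrite mulf_eq0 normr_eq0 invr_eq0 (lt_eqF v1) (gt_eqF r0).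
  + by rewrite (le_trans _ (pi_ge0 _)) // oppr_le0 acos_ge0.
  + by apply: vecP; rewrite !coordE ?cosN ?sinN ?ca ?sa ?(ltr0_norm v1); field; rewrite gt_eqF.
Qed.

(** The coordinates of [v] in the frame rotated by [a] reduce this to [polar]; the cut of the angle
    moves to the direction opposite to [dir a]. *)
Lemma polar_from v a : v != 0 ->
  exists r b, [/\ 0 < r, a - pi < b, b <= a + pi & v = r *: dir b].
Proof.
move=> v0; pose w := vec (dot (dir a) v) (cross (dir a) v).
have e : v = w 0 0 *: dir a + w 0 1 *: dir (a + pi / 2).
  have h := cos2Dsin2 a.
  apply: vecP; rewrite !coordE /dot /cross !coordE ?cosDpihalf ?sinDpihalf.
  - by transitivity (v 0 0 * (cos a ^+ 2 + sin a ^+ 2)); [rewrite h mulr1 | ring].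
  - by transitivity (v 0 1 * (cos a ^+ 2 + sin a ^+ 2)); [rewrite h mulr1 | ring].
have w0 : w != 0.
  by apply/eqP => w0; move/eqP: v0; apply; rewrite e w0 !coordE !scale0r addr0.
have [r [b [r0 b1 b2 wE]]] := polar w0.
exists r, (a + b); split => //; [lra|lra|].
by rewrite {1}e wE !coordE (dirD a b) scalerDr !scalerA.
Qed.

(** With representatives in a window of length [pi *+ 2] centred at [a], the left and right of
    [dir a] are told apart by comparing numbers. *)
Lemma dir_norm a b : exists c, [/\ a - pi < c, c <= a + pi & dir b = dir c].
Proof.
have [r [c [r0 c1 c2 e]]] := polar_from a (dir_neq0 b).
exists c; split => //.
have r1 : r = 1.
  have := cos2Dsin2 b.
  have <- : dir b 0 0 = cos b by rewrite !coordE.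
  have <- : dir b 0 1 = sin b by rewrite !coordE.
  rewrite e !coordE => h.
  have : r ^+ 2 = 1.
    by rewrite -h -[LHS]mulr1 -(cos2Dsin2 c); ring.
  move/eqP; rewrite sqrf_eq1 => /orP[/eqP//|/eqP rN]; lra.
by rewrite e r1 scale1r.
Qed.

End Plane.

(** * Smooth boundaries and half-planes *)

Section Topo.
Context {R : realType}.
Local Notation V := 'rV[R]_2.
Implicit Types (p q u v w x y z : V) (a b c r s t : R) (A B E M : set V).

Lemma nbhs_normE p A : nbhs p A -> exists2 d : R, 0 < d & forall z, `|z - p| < d -> A z.
Proof.
move=> /nbhs_ballP[d /= d0 h]; exists d => // z zp; apply: h.
by rewrite -ball_normE /ball_ /= distrC.
Qed.

Lemma norm_nbhs p A d : 0 < d -> (forall z, `|z - p| < d -> A z) -> nbhs p A.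
Proof.
move=> d0 h; apply/nbhs_ballP; exists d => //= z.
by rewrite -ball_normE /ball_ /= distrC => zp; exact: h.
Qed.

Lemma open_normE A p : open A -> A p -> exists2 d : R, 0 < d & forall z, `|z - p| < d -> A z.
Proof. by move=> oA Ap; apply: nbhs_normE; exact: open_nbhs_nbhs. Qed.

Lemma closure_normE A p d : closure A p -> 0 < d -> exists2 z, A z & `|z - p| < d.
Proof.
move=> cA d0; have [z [Az /= zp]] := cA _ (norm_nbhs d0 (fun z h => h)).
by exists z.
Qed.

Lemma cross_continuous g : continuous (cross g : V -> R).
Proof.
move=> z; have c i := @coord_continuous R _ _ 0 i z.
exact: (cvgB (cvgM (cvg_cst (g 0 0)) (c 1)) (cvgM (cvg_cst (g 0 1)) (c 0))).
Qed.

Lemma crossC p q : cross p q = - cross q p. Proof. by rewrite /cross; ring. Qed.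
Lemma crossDr p q z : cross p (q + z) = cross p q + cross p z.
Proof. by rewrite /cross !coordE; ring. Qed.
Lemma crossZr p a q : cross p (a *: q) = a * cross p q.
Proof. by rewrite /cross !coordE; ring. Qed.
Lemma crossNr p q : cross p (- q) = - cross p q.
Proof. by rewrite /cross !coordE; ring. Qed.
Lemma crossDl p q z : cross (q + z) p = cross q p + cross z p.
Proof. by rewrite /cross !coordE; ring. Qed.
Lemma crossZl p a q : cross (a *: q) p = a * cross q p.
Proof. by rewrite /cross !coordE; ring. Qed.
Lemma crossNl p q : cross (- q) p = - cross q p.
Proof. by rewrite /cross !coordE; ring. Qed.
Lemma crossvv p : cross p p = 0. Proof. by rewrite /cross; ring. Qed.
Lemma dotDr p q z : dot p (q + z) = dot p q + dot p z.
Proof. by rewrite /dot !coordE; ring. Qed.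
Lemma dotZr p a q : dot p (a *: q) = a * dot p q.
Proof. by rewrite /dot !coordE; ring. Qed.
Lemma dotNr p q : dot p (- q) = - dot p q.
Proof. by rewrite /dot !coordE; ring. Qed.
Definition lin := (crossDr, crossZr, crossNr, crossDl, crossZl, crossNl, dotDr, dotZr, dotNr).

(* All that is used of smoothness. Unlike a defining function it refers to E only through
   implications between memberships, so it passes to each component of E. *)
Definition half_plane_at E p g := g != 0 /\
  forall w, dot g w < 0 -> exists2 d : R, 0 < d &
    forall z w' t, `|z - p| < d -> `|w' - w| < d -> 0 < t < d -> E z -> E (z + t *: w').

(** The normal [g] is the gradient of the local defining function. Directional derivatives stay
    negative near [(p, w)], so by the mean value theorem the function decreases along short
    steps. *)
Lemma smooth_half_plane E p : has_smooth_boundary E -> boundary E p ->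
  exists g, half_plane_at E p g.
Proof.
move=> sm bp; have [U [f [oU Up C1 Ef df0]]] := sm p bp.
pose e0 : V := vec 1 0; pose e1 : V := vec 0 1.
(* Linearity reduces joint continuity in the point and the direction to continuity of the two
   partial derivatives. *)
have DE z w : U z -> 'D_w f z = w 0 0 * 'D_e0 f z + w 0 1 * 'D_e1 f z.
  move=> Uz; have [dfz _] := C1 z Uz.
  rewrite !deriveE //.
  have {1}-> : w = w 0 0 *: e0 + w 0 1 *: e1 by apply: vecP; rewrite !coordE; ring.
  by rewrite linearD !linearZ.
pose g : V := vec ('D_e0 f p) ('D_e1 f p).
have gE w : dot g w = 'D_w f p by rewrite DE // /dot /g !coordE mulrC [X in _ + X]mulrC.
exists g; split.
  apply/eqP => g0; have [v] := df0 p Up.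
  have [dfp _] := C1 p Up.
  by rewrite -deriveE // -gE g0 /dot !coordE !mul0r addr0 eqxx.
move=> w gw.
have cF : (fun zw : V * V => zw.2 0 0 * 'D_e0 f zw.1 + zw.2 0 1 * 'D_e1 f zw.1) @ (p, w)
    --> (w 0 0 * 'D_e0 f p + w 0 1 * 'D_e1 f p).
  apply: cvgD; apply: cvgM.
  - by apply: (@cvg_comp _ _ _ snd (fun w : V => w 0 0)); [exact: cvg_snd|exact: coord_continuous].
  - apply: (@cvg_comp _ _ _ fst (fun z : V => 'D_e0 f z)); [exact: cvg_fst|].
    by have [_ /(_ e0)] := C1 p Up.
  - by apply: (@cvg_comp _ _ _ snd (fun w : V => w 0 1)); [exact: cvg_snd|exact: coord_continuous].
  - apply: (@cvg_comp _ _ _ fst (fun z : V => 'D_e1 f z)); [exact: cvg_fst|].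
    by have [_ /(_ e1)] := C1 p Up.
have F0 : w 0 0 * 'D_e0 f p + w 0 1 * 'D_e1 f p < 0 by rewrite -DE // -gE.
have [[A B] /= [nA nB] AB] := cvgr_lt _ cF _ F0.
have [d1 d10 hA] := nbhs_normE nA; have [d2 d20 hB] := nbhs_normE nB.
have [d3 d30 hU] := open_normE oU Up.
pose d0 := Num.min d1 (Num.min d2 d3).
have d0_gt0 : 0 < d0 by rewrite !lt_min d10 d20.
(* [K] bounds [|w'|], so a step of length below [d0 / 2 / K] moves a point by at most [d0 / 2]. *)
pose K := `|w| + d0 + 1.
have K1 : 1 <= K by rewrite /K lerDr addr_ge0 // ltW.
have K0 : 0 < K by apply: lt_le_trans K1.
pose d := Num.min (d0 / 2) (d0 / 2 / K).
have d_gt0 : 0 < d by rewrite lt_min !divr_gt0.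
exists d => // z w' t zp w'w /andP[t0 td] Ez.
have dd0 : d <= d0 / 2 by rewrite ge_min lexx.
have w'K : `|w'| <= K.
  rewrite -(subrK w w') (le_trans (ler_normD _ _)) // /K.
  by have := ltW w'w; lra.
have near s : 0 <= s <= t -> `|z + s *: w' - p| < d0.
  move=> /andP[s0 st]; rewrite addrAC (le_lt_trans (ler_normD _ _)) //.
  rewrite normrZ (ger0_norm s0).
  have : s * `|w'| <= d0 / 2.
    have -> : d0 / 2 = (d0 / 2 / K) * K by rewrite divfK // gt_eqF.
    apply: ler_pM => //; apply: (le_trans st); apply: (le_trans (ltW td)).
    by rewrite ge_min lexx orbT.
  by move: zp dd0; lra.
have nU s : 0 <= s <= t -> U (z + s *: w').
  by move=> /near h; apply: hU; rewrite (lt_le_trans h) // /d0 !ge_min lexx !orbT.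
have der s : 0 <= s <= t -> is_derive s 1 (fun s => f (z + s *: w')) ('D_w' f (z + s *: w')).
  move=> st; have [dfs _] := C1 _ (nU s st).
  have E1 : (fun h : R => h^-1 *: (((fun s => f (z + s *: w')) \o shift s) (h *: 1) - f (z + s *: w')))
     = (fun h : R => h^-1 *: ((f \o shift (z + s *: w')) (h *: w') - f (z + s *: w'))).
    apply/funext => h /=; congr (_ *: (f _ - _)).
    by rewrite [h *: 1]mulr1 scalerDl addrA addrAC addrC.
  have dv : derivable f (z + s *: w') w' by exact: diff_derivable.
  split; first by rewrite /derivable E1.
  by rewrite /derive E1.
have [||c ct] := @MVT_segment R (fun s => f (z + s *: w')) (fun s => 'D_w' f (z + s *: w')) 0 t (ltW t0).
- by move=> s; rewrite in_itv /= => /andP[a b]; apply: der; rewrite !ltW.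
- apply: derivable_within_continuous => s; rewrite in_itv /= => st.
  by have [] := der s st.
rewrite in_itv /= in ct.
rewrite scale0r addr0 subr0 => fE.
have zU : U z by have := nU 0; rewrite scale0r addr0; apply; rewrite lexx ltW.
apply/(Ef _ (nU t _)); first by rewrite lexx ltW.
have fz : f z < 0 by apply/Ef.
have : 'D_w' f (z + c *: w') < 0.
  rewrite DE; last exact: nU.
  apply: (AB (z + c *: w', w')); split => /=.
  - by apply: hA; rewrite (lt_le_trans (near _ ct)) // ge_min lexx.
  - apply: hB; rewrite (lt_le_trans w'w) // (le_trans dd0) //.
    have : d0 <= d2 by rewrite /d0 !ge_min lexx orbT.
    by move: d0_gt0; lra.
by move: fE; nra.
Qed.

End Topo.

Section Local.
Context {R : realType}.
Local Notation V := 'rV[R]_2.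
Implicit Types (p q u v w x y z g a b : V) (c r s t : R) (A B E M : set V).

Lemma dot_gt0 g : g != 0 -> 0 < dot g g.
Proof.
move=> g0; rewrite lt_neqAle eq_sym addr_ge0 ?sqr_ge0 // andbT.
apply/eqP => h; move/eqP: g0; apply; move: h; rewrite /dot => h.
by apply: vecP; rewrite !coordE; nra.
Qed.

Lemma cross0_collinear p q : p != 0 -> cross p q = 0 -> q = (dot p q / dot p p) *: p.
Proof.
move=> p0 h; have pp := dot_gt0 p0.
have E1 : dot p p *: q = dot p q *: p.
  move: h; rewrite /cross /dot => h; apply: vecP; rewrite !coordE.
  + apply/eqP; rewrite -subr_eq0; apply/eqP.
    by transitivity (- p 0 1 * (p 0 0 * q 0 1 - p 0 1 * q 0 0)); [ring|rewrite h mulr0].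
  + apply/eqP; rewrite -subr_eq0; apply/eqP.
    by transitivity (p 0 0 * (p 0 0 * q 0 1 - p 0 1 * q 0 0)); [ring|rewrite h mulr0].
by rewrite mulrC -scalerA -E1 scalerA mulVf ?scale1r // gt_eqF.
Qed.

(** The point [p] itself need not be in [E]: it is replaced by a point [z] of [E] within
    [t * (d / 2)], and the error [p - z] is absorbed into the direction, which may vary. *)
Lemma half_plane_in E p g w : half_plane_at E p g -> closure E p -> dot g w < 0 ->
  exists2 d : R, 0 < d & forall w' t, `|w' - w| < d -> 0 < t < d -> E (p + t *: w').
Proof.
move=> [_ H] cE gw; have [d d0 h] := H w gw.
exists (d / 2); first by rewrite divr_gt0.
move=> w' t ww /andP[t0 td].
have [|z Ez zp] := @closure_normE R E p (Num.min d (t * (d / 2))) cE.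
  by rewrite lt_min d0 mulr_gt0 // divr_gt0.
move: zp; rewrite lt_min => /andP[zp1 zp2].
have -> : p + t *: w' = z + t *: (w' + t^-1 *: (p - z)).
  by apply: vecP; rewrite !coordE; field; rewrite gt_eqF.
apply: h => //; last by rewrite t0; lra.
rewrite addrAC (le_lt_trans (ler_normD _ _)) // normrZ gtr0_norm ?invr_gt0 //.
have : t^-1 * `|p - z| < d / 2.
  by rewrite mulrC ltr_pdivrMr // distrC mulrC.
by move: ww; lra.
Qed.

(** Contraposition along [- w]: if [z + t *: w] were a limit of points of [E], stepping back from a
    close one would put [z] in [E]. *)
Lemma half_plane_out E p g w : half_plane_at E p g -> 0 < dot g w ->
  exists2 d : R, 0 < d & forall z t, `|z - p| < d -> 0 < t < d -> ~ E z -> ~ closure E (z + t *: w).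
Proof.
move=> [_ H] gw.
have [|d d0 h] := H (- w); first by rewrite dotNr oppr_lt0.
pose K := `|w| + 1.
have K0 : 0 < K by rewrite /K; have := normr_ge0 w; lra.
exists (Num.min (d / 4) (d / 4 / K)); first by rewrite lt_min !divr_gt0.
move=> z t zp /andP[t0 td] nE cE; apply: nE.
move: zp td; rewrite !lt_min => /andP[zp _] /andP[td1 td2].
have [|z1 Ez1 z1p] := @closure_normE R E _ (Num.min (d / 4) (t * (d / 2))) cE.
  by rewrite lt_min !mulr_gt0 // ?invr_gt0.
move: z1p; rewrite lt_min => /andP[z1a z1b].
have -> : z = z1 + t *: (- w + t^-1 *: (z + t *: w - z1)).
  by apply: vecP; rewrite !coordE; field; rewrite gt_eqF.
apply: h => //; last by rewrite t0; lra.
- have -> : z1 - p = (z1 - (z + t *: w)) + (z - p) + t *: w.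
    by apply: vecP; rewrite !coordE; ring.
  rewrite (le_lt_trans (ler_normD _ _)) // normrZ gtr0_norm //.
  have := ler_normD (z1 - (z + t *: w)) (z - p).
  have : t * `|w| <= d / 4.
    rewrite -[leRHS](@divfK _ K) ?gt_eqF //.
    by apply: ler_pM => //; [exact: ltW|exact: ltW|rewrite /K; lra].
  by lra.
- rewrite addrAC subrr add0r normrZ gtr0_norm ?invr_gt0 //.
  have : t^-1 * `|z + t *: w - z1| < d / 2.
    by rewrite mulrC ltr_pdivrMr // distrC mulrC.
  by lra.
Qed.

Definition seg a b : set V := [set a + t *: (b - a) | t in `[0, 1]].

Lemma line_continuous p q : continuous (fun t : R => p + t *: q).
Proof. by move=> t; apply: cvgD; [exact: cvg_cst|apply: cvgZr_tmp; exact: cvg_id]. Qed.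

Lemma seg_connected a b : connected (seg a b).
Proof.
apply: connected_continuous_connected; first exact: segment_connected.
by apply: continuous_subspaceT; exact: line_continuous.
Qed.

Lemma segL (a b : V) : seg a b a.
Proof. by exists 0; rewrite /= ?in_itv /= ?lexx ?ler01 // scale0r addr0. Qed.

Lemma segR (a b : V) : seg a b b.
Proof. by exists 1; rewrite /= ?in_itv /= ?lexx ?ler01 // scale1r addrC subrK. Qed.

Lemma seg_ball a b p d : `|a - p| < d -> `|b - p| < d -> forall z, seg a b z -> `|z - p| < d.
Proof.
move=> ap bp z [t /=]; rewrite in_itv /= => /andP[t0 t1] <-.
have -> : a + t *: (b - a) - p = (1 - t) *: (a - p) + t *: (b - p).
  by apply: vecP; rewrite !coordE; ring.
rewrite (le_lt_trans (ler_normD _ _)) // !normrZ (ger0_norm t0) ger0_norm ?subr_ge0 //.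
have [->|t0'] := eqVneq t 0; first by rewrite subr0 mul0r addr0 mul1r.
have tp : 0 < t by rewrite lt_neqAle eq_sym t0'.
have : (1 - t) * `|a - p| <= (1 - t) * d by rewrite ler_wpM2l ?subr_ge0 // ltW.
have : t * `|b - p| < t * d by rewrite ltr_pM2l.
by lra.
Qed.

(** Pushing two points near [p] by the same multiple of [- g] stays in [E] and brings both into one
    ball contained in [E], where they are joined by a segment. *)
Lemma half_plane_connected E p g : open E -> half_plane_at E p g -> closure E p ->
  exists2 d : R, 0 < d & forall z z', E z -> E z' -> `|z - p| < d -> `|z' - p| < d ->
    exists S : set V, [/\ connected S, S `<=` E, S z & S z'].
Proof.
move=> oE H cE.
have [g0 H1] := H.
have gw : dot g (- g) < 0 by rewrite dotNr oppr_lt0 dot_gt0.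
have [d1 d10 h1] := H1 _ gw.
have [d2 d20 h2] := half_plane_in H cE gw.
pose t := Num.min d1 d2 / 2.
have t0 : 0 < t by rewrite divr_gt0 // lt_min d10.
have tm : t < Num.min d1 d2 by rewrite /t ltr_pdivrMr // ltr_pMr // ?lt_min ?d10 // ltr1n.
have Ep : E (p + t *: - g).
  apply: h2; first by rewrite subrr normr0.
  by rewrite t0 (lt_le_trans tm) // ge_min lexx orbT.
have [d3 d30 h3] := open_normE oE Ep.
exists (Num.min d1 d3); first by rewrite lt_min d10.
move=> z z' Ez Ez'; rewrite !lt_min => /andP[z1 z3] /andP[z'1 z'3].
pose y := z + t *: - g; pose y' := z' + t *: - g.
have down x : E x -> `|x - p| < d1 -> seg x (x + t *: - g) `<=` E.
  move=> Ex xp u [s /=]; rewrite in_itv /= => /andP[s0 s1] <-.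
  rewrite addrAC subrr add0r scalerA.
  have [->|s0'] := eqVneq s 0; first by rewrite mul0r scale0r addr0.
  have sp : 0 < s by rewrite lt_neqAle eq_sym s0'.
  apply: h1 => //; first by rewrite subrr normr0.
  rewrite mulr_gt0 //=.
  have tl : t < d1 by rewrite (lt_le_trans tm) // ge_min lexx.
  have : s * t <= t by rewrite ler_piMl // ltW.
  by lra.
exists (seg z y `|` seg y y' `|` seg z' y'); split.
- apply: connectedU; [exists y'; split; [right; exact: segR|exact: segR] | | exact: seg_connected].
  by apply: connectedU;
    [exists y; split; [exact: segR|exact: segL] | exact: seg_connected | exact: seg_connected].
- move=> u [[|]|]; [exact: down| |exact: down].
  move=> uy; apply: h3; apply: (seg_ball _ _ uy).
  + by rewrite /y opprD addrACA subrr addr0.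
  + by rewrite /y' opprD addrACA subrr addr0.
- by left; left; exact: segL.
- by right; exact: segL.
Qed.

Definition sector p d2 d1 : set V :=
  [set z | 0 < cross d2 (z - p) /\ 0 < cross (z - p) d1].

(* The sector swept counterclockwise from d2 to d1 is convex, of angle at most pi. *)
Definition convex_angle d2 d1 :=
  0 < cross d2 d1 \/ (d2 != 0 /\ exists2 l : R, 0 < l & d1 = - l *: d2).

(** For an angle of at most pi the closed sector is given by the two weak inequalities, and equality
    in either of them places a point of it on one of the bounding rays. A set that misses these rays
    thus meets the sector in a subset both relatively open and relatively closed. *)
Lemma sector_connected A p d2 d1 : connected A -> convex_angle d2 d1 ->
  (forall t, 0 <= t -> ~ A (p + t *: d2)) -> (forall t, 0 <= t -> ~ A (p + t *: d1)) ->
  A `<=` sector p d2 d1 \/ A `&` sector p d2 d1 = set0.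
Proof.
move=> cA ang r2 r1.
have [e|/set0P ne] := eqVneq (A `&` sector p d2 d1) set0; [by right|left].
have cB d : continuous (fun z => cross d (z - p)).
  move=> z; apply: (@cvg_comp _ _ _ (fun z => z - p) (cross d)); last exact: cross_continuous.
  exact: (cvgB (@cvg_id _ _) (cvg_cst p)).
have cn1 := cB d2.
have cn2 : continuous (fun z => cross (z - p) d1).
  rewrite (_ : (fun z => _) = (fun z => - cross d1 (z - p))); last first.
    by apply/funext => z; rewrite crossC.
  by move=> z; exact: (cvgN (cB d1 z)).
have <- : A `&` sector p d2 d1 = A; last by move=> z [].
apply: cA => //.
  exists (sector p d2 d1) => //.
  have -> : sector p d2 d1 = (fun z => cross d2 (z - p)) @^-1` [set t | 0 < t]
      `&` (fun z => cross (z - p) d1) @^-1` [set t | 0 < t] by [].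
  by apply: openI; apply: open_comp;
    [move=> z _; exact: cn1|exact: open_gt|move=> z _; exact: cn2|exact: open_gt].
exists ((fun z => cross d2 (z - p)) @^-1` [set t | 0 <= t]
      `&` (fun z => cross (z - p) d1) @^-1` [set t | 0 <= t]).
  by apply: closedI; apply: closed_comp;
    [move=> z _; exact: cn1|exact: closed_ge|move=> z _; exact: cn2|exact: closed_ge].
apply/seteqP; split => z /= [Az [z2 z1]]; split => //.
  by split; exact: ltW.
case: ang => [D|[d20 [l l0 dE]]].
- have zE : z = p + (cross (z - p) d1 / cross d2 d1) *: d2 + (cross d2 (z - p) / cross d2 d1) *: d1.
    move: D; rewrite /cross => D.
    by apply: vecP; rewrite !coordE; field; apply/lt0r_neq0.
  split; rewrite lt_neqAle eq_sym ?z1 ?z2 andbT; apply/eqP => h.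
  + apply: (r2 (cross (z - p) d1 / cross d2 d1)); first by rewrite divr_ge0 // ltW.
    by rewrite zE h mul0r scale0r addr0 in Az.
  + apply: (r1 (cross d2 (z - p) / cross d2 d1)); first by rewrite divr_ge0 // ltW.
    by rewrite zE h mul0r scale0r addr0 in Az.
- have e1 : cross (z - p) d1 = l * cross d2 (z - p) by rewrite dE /cross !coordE; ring.
  rewrite /sector /= e1.
  suff : 0 < cross d2 (z - p) by move=> h; split => //; rewrite mulr_gt0.
  rewrite lt_neqAle eq_sym z2 andbT; apply/eqP => h.
  pose k := dot d2 (z - p) / dot d2 d2.
  have zE : z = p + k *: d2 by rewrite -(cross0_collinear d20 h) addrC subrK.
  have [k0|k0] := leP 0 k; first by apply: (r2 k k0); rewrite -zE.
  apply: (r1 (- k / l)); first by rewrite divr_ge0 ?oppr_ge0 // ltW.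
  rewrite dE scalerA (_ : - k / l * - l = k) -?zE //.
  by field; rewrite gt_eqF.
Qed.

End Local.

(** * First contacts and exits on the rays from a point *)

Lemma closed_inf {R : realType} (S : set R) : has_inf S -> closed S -> S (inf S).
Proof.
move=> hi cl; apply: contrapT => nS.
have : \forall r \near inf S, ~ S r by apply: open_nbhs_nbhs; split => //; exact: closed_openC.
move=> /nbhs_ballP[d /= d0 h].
have [r Sr rd] := inf_adherent d0 hi.
apply: (h r) => //; rewrite /ball /= ltr_distlC; apply/andP; split; last by [].
have := ge_inf hi.2 Sr; lra.
Qed.

Lemma cvg_open (T : Type) (U : topologicalType) (F : set_system T) (FF : Filter F)
    (f : T -> U) p (A : set U) :
  f @ F --> p -> open A -> A p -> \forall i \near F, A (f i).
Proof. by move=> fp oA Ap; apply: fp; exact: open_nbhs_nbhs. Qed.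
Arguments cvg_open {T U F FF f p A}.

Section Rays.
Context {R : realType}.
Local Notation V := 'rV[R]_2.
Implicit Types (p q u v w y z g : V) (a b c r s t : R).
Variables (E : set V) (x : V).

Definition ray_pt a s : V := x + s *: dir a.
Definition exit p a := forall t, 0 <= t -> ~ E (p + t *: dir a).
(* b = 1 for an exit to the left of the line of sight, b = -1 for one to its right. *)
Definition side_exit b a s :=
  exists2 c : R, 0 < c < 1 & exit (ray_pt a s) (a + b * pi * c).
Definition visible a s := forall t, 0 <= t <= s -> ~ E (ray_pt a t).

Hypothesis oE : open E.
Hypothesis blocked : forall a, exists2 s : R, 0 <= s & E (ray_pt a s).
Hypothesis nEx : ~ E x.
Hypothesis weak : forall p, closure E p -> ~ E p -> exists a, exit p a.
Hypothesis smooth : forall p, closure E p -> ~ E p -> exists g, half_plane_at E p g.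

Lemma ray_ptE a s : ray_pt a s = x + s *: dir a. Proof. by []. Qed.

Lemma ray_pt0 a : ray_pt a 0 = x. Proof. by rewrite /ray_pt scale0r addr0. Qed.

Lemma not_closure_x : ~ closure E x.
Proof.
move=> cx; have [a ea] := weak cx nEx.
by have [s s0 Es] := blocked a; exact: (ea s).
Qed.

Lemma dir_continuous : continuous (dir : R -> V).
Proof.
have -> : (dir : R -> V) = (fun a => cos a *: vec 1 0 + sin a *: vec 0 1).
  by apply/funext => a; apply: vecP; rewrite !coordE; ring.
move=> a; apply: cvgD; apply: cvgZr_tmp; [exact: continuous_cos|exact: continuous_sin].
Qed.

Lemma cvg_dir T (F : set_system T) (f : T -> R) a : Filter F ->
  f @ F --> a -> (fun i => dir (f i)) @ F --> (dir a : V).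
Proof. by move=> FF fa; exact: (cvg_comp _ _ fa (@dir_continuous a)). Qed.

Lemma cvg_ray_pt T (F : set_system T) (f h : T -> R) a s : Filter F ->
  f @ F --> a -> h @ F --> s -> (fun i => ray_pt (f i) (h i)) @ F --> ray_pt a s.
Proof.
move=> FF fa hs; apply: cvgD; first exact: cvg_cst.
by apply: cvgZ => //; exact: cvg_dir.
Qed.

(** The ray from [x] meets [E], and by visibility only after the point. *)
Lemma no_forward_exit a s : visible a s -> 0 <= s -> ~ exit (ray_pt a s) a.
Proof.
move=> vis s0 ex; have [t t0 Et] := blocked a.
have [ts|st] := leP t s; first by apply: (vis t) => //; rewrite t0.
apply: (ex (t - s)); first by rewrite subr_ge0 ltW.
by rewrite (_ : _ + _ = ray_pt a t) // /ray_pt; apply: vecP; rewrite !coordE; ring.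
Qed.

(** Going back, the ray passes through [x] and then contains the whole opposite ray, which meets
    [E]. *)
Lemma no_backward_exit a s : 0 <= s -> ~ exit (ray_pt a s) (a + pi).
Proof.
move=> s0 ex; have [t t0 Et] := blocked (a + pi).
apply: (ex (s + t)); first exact: addr_ge0.
rewrite /ray_pt dirDpi in Et *.
by rewrite (_ : _ + _ = x + t *: - dir a) //; apply: vecP; rewrite !coordE; ring.
Qed.

(** For each fixed turn [c] meeting [E] is an open condition. The straight forward and backward
    directions are never exits, so [c] may range over the compact interval [[0, 1]], and finitely
    many conditions suffice. *)
Lemma side_exit_open b a s : b = 1 \/ b = -1 -> 0 <= s -> visible a s ->
  ~ side_exit b a s -> \forall as' \near (a, s), ~ side_exit b as'.1 as'.2.
Proof.
move=> b1 s0 vis nex.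
have cK : compact `[0 : R, 1]%classic by exact: segment_compact.
move/compact_near_coveringP: cK => /(_ _ (nbhs (a, s))
  (fun as' c => ~ exit (ray_pt as'.1 as'.2) (as'.1 + b * pi * c))).
have H (c : R) : `[0, 1]%classic c -> exists2 t, 0 <= t & E (ray_pt a s + t *: dir (a + b * pi * c)).
  rewrite /= in_itv /= => /andP[c0 c1]; apply: contrapT => nh.
  have ex : exit (ray_pt a s) (a + b * pi * c).
    by move=> t t0 Et; apply: nh; exists t.
  have [c00|c00] := eqVneq c 0.
    by move: ex; rewrite c00 mulr0 addr0; exact: no_forward_exit.
  have [c11|c11] := eqVneq c 1.
    move: ex; rewrite c11 mulr1; case: b1 => ->; rewrite ?mul1r; first exact: no_backward_exit.
    rewrite mulN1r => ex; apply: (no_backward_exit s0 (a := a)).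
    by move=> t t0; rewrite dirDpi -dirBpi; exact: ex.
  by apply: nex; exists c => //; rewrite !lt_neqAle eq_sym c00 c0 c11 c1.
move=> h.
suff h' : \forall as' \near (a, s), `[0, 1]%classic `<=`
    (fun c => ~ exit (ray_pt as'.1 as'.2) (as'.1 + b * pi * c)).
  apply: filterS h' => -[a' s'] /= hc [c /andP[c0 c1] ex].
  by apply: (hc c) => //; rewrite /= in_itv /= !ltW.
apply: h => c /H[t t0 Et].
have : \forall cas \near (c, (a, s)), E (ray_pt cas.2.1 cas.2.2 + t *: dir (cas.2.1 + b * pi * cas.1)).
  have cv1 : (fun cas : R * (R * R) => cas.2.1) @ (c, (a, s)) --> a.
    by apply: (@cvg_comp _ _ _ snd fst); [exact: cvg_snd|exact: cvg_fst].
  have cv2 : (fun cas : R * (R * R) => cas.2.2) @ (c, (a, s)) --> s.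
    by apply: (@cvg_comp _ _ _ snd snd); [exact: cvg_snd|exact: cvg_snd].
  have cv3 : (fun cas : R * (R * R) => cas.1) @ (c, (a, s)) --> c by exact: cvg_fst.
  have cv : (fun cas : R * (R * R) => ray_pt cas.2.1 cas.2.2 + t *: dir (cas.2.1 + b * pi * cas.1))
      @ (c, (a, s)) --> ray_pt a s + t *: dir (a + b * pi * c).
    apply: cvgD; first exact: cvg_ray_pt.
    apply: cvgZl_tmp; apply: cvg_dir.
    exact: (cvgD cv1 (cvgM (cvg_cst (b * pi)) cv3)).
  exact: (cvg_open cv oE Et).
case=> [[A B] /= [nA nB] AB]; exists (A, B) => //= -[c' as'] /= [Ac Bas] ex.
by apply: (ex t t0); exact: (AB (c', as')).
Qed.


(** * Contacts with a part [M] of [E] that precedes the rest of [E] on every ray from [x] *)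

Section Part.
Variable M : set V.
Hypothesis ME : M `<=` E.
Hypothesis oM : open M.
Hypothesis cM : closure M `&` E `<=` M.
Hypothesis firstM : forall a s t, 0 <= s -> 0 <= t ->
  M (ray_pt a s) -> E (ray_pt a t) -> ~ M (ray_pt a t) -> s < t.

Definition hits (A : set V) a := exists2 s : R, 0 <= s & A (ray_pt a s).

(** Visibility is with respect to [E], not only to [M], because exits have to miss all of [E]. *)
Definition contact a s :=
  [/\ 0 < s, closure M (ray_pt a s), visible a s
    & forall t, 0 <= t < s -> ~ closure M (ray_pt a t)].

Lemma ray_continuous a : continuous (ray_pt a).
Proof. by move=> s; apply: cvg_ray_pt; [exact: cvg_cst|exact: cvg_id]. Qed.

Lemma closureME p : closure M p -> closure E p.
Proof. exact: closureS. Qed.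

(** The contact is the infimum of the parameters in [closure M]. A point of [E] before it would lie
    outside [M] and so, by [firstM], behind the given point of [M]. *)
Lemma contact_exists a s : 0 <= s -> M (ray_pt a s) -> exists2 t, contact a t & t < s.
Proof.
move=> s0 Ms.
pose S := [set t : R | 0 <= t] `&` ray_pt a @^-1` closure M.
have Ss : S s by split => //; exact: subset_closure.
have clS : closed S.
  apply: closedI; first exact: closed_ge.
  apply: closed_comp; last exact: closed_closure.
  by move=> t _; exact: ray_continuous.
have lbS : has_lbound S by exists 0 => t [].
have hiS : has_inf S by split => //; exists s.
pose t := inf S.
have [t0 ct] : S t.
  exact: closed_inf.
have tmin r : 0 <= r < t -> ~ closure M (ray_pt a r).
  move=> /andP[r0 rt] cr; have := ge_inf lbS (conj r0 cr : S r).
  by rewrite -/t leNgt rt.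
have tpos : 0 < t.
  rewrite lt_neqAle t0 andbT eq_sym; apply/eqP => te.
  by move: ct; rewrite /= te ray_pt0 => /closureME; exact: not_closure_x.
have vis : visible a t.
  move=> r /andP[r0]; rewrite le_eqVlt => /orP[/eqP ->|rt] Er.
    have Mt : M (ray_pt a t) by apply: cM.
    have : \forall r \near t, M (ray_pt a r).
      by apply: (ray_continuous (x := t)); exact: open_nbhs_nbhs.
    move=> /nbhs_ballP[d /= d0 h].
    pose r' := Num.max 0 (t - d / 2).
    have r't : r' < t by rewrite gt_max tpos; lra.
    apply: (tmin r'); first by rewrite le_max lexx r't.
    apply: subset_closure; apply: h.
    rewrite /ball /= ltr_distlC; apply/andP; split; last by lra.
    by rewrite lt_max; apply/orP; right; lra.
  have nM : ~ M (ray_pt a r).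
    by move=> Mr; apply: (tmin r); [rewrite r0|exact: subset_closure].
  have := firstM s0 r0 Ms Er nM.
  have : t <= s by exact: ge_inf.
  by lra.
exists t; first by split.
rewrite lt_neqAle ge_inf // andbT; apply/eqP => ts.
by apply: (vis t); rewrite ?lexx ?t0 // ts; exact: ME.
Qed.

Lemma contact_unique a s t : contact a s -> contact a t -> s = t.
Proof.
move=> [s0 cs _ sm] [t0 ct _ tm]; apply/eqP; rewrite eq_le !leNgt.
by apply/andP; split; apply/negP => h; [apply: (sm t); rewrite ?(ltW t0)|apply: (tm s); rewrite ?(ltW s0)].
Qed.

(** [M] is relatively open and closed in [E], and near a boundary point any two points of [E] lie in
    a connected subset of [E]. *)
Lemma part_local p : closure M p -> ~ E p ->
  exists2 d : R, 0 < d & forall z, E z -> `|z - p| < d -> M z.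
Proof.
move=> cp nEp; have [g gp] := smooth (closureME cp) nEp.
have [d d0 h] := half_plane_connected oE gp (closureME cp).
exists d => // z Ez zp.
have [z' Mz' z'p] := closure_normE cp d0.
have [S [cS SE Sz Sz']] := h z z' Ez (ME Mz') zp z'p.
have : (S `&` M) z by rewrite (_ : S `&` M = S) //; apply: cS;
  [exists z'|exists M|exists (closure M); [exact: closed_closure|
    by apply/seteqP; split => u [Su Mu]; split => //; [exact: subset_closure|apply: cM; split => //; exact: SE]]].
by case.
Qed.

(** Otherwise the way back to [x] would start strictly inwards and meet [E]. *)
Lemma visible_dot a s g : half_plane_at E (ray_pt a s) g -> closure E (ray_pt a s) ->
  0 < s -> visible a s -> dot g (dir a) <= 0.
Proof.
move=> gp cE s0 vis; rewrite leNgt; apply/negP => gd.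
have [|d d0 h] := half_plane_in gp cE (w := - dir a); first by rewrite dotNr oppr_lt0.
pose t := Num.min (d / 2) s.
have t0 : 0 < t by rewrite lt_min divr_gt0.
have td : t < d by rewrite gt_min; apply/orP; left; lra.
have ts : t <= s by rewrite ge_min lexx orbT.
apply: (vis (s - t)); first by apply/andP; split; lra.
have := h (- dir a) t; rewrite subrr normr0 t0 td => /(_ d0 isT).
by congr E; rewrite /ray_pt; apply: vecP; rewrite !coordE; ring.
Qed.

Lemma exit_dot p a g : half_plane_at E p g -> closure E p -> exit p a -> 0 <= dot g (dir a).
Proof.
move=> gp cE ex; rewrite leNgt; apply/negP => gd.
have [d d0 h] := half_plane_in gp cE gd.
apply: (ex (d / 2)); first by rewrite divr_ge0 // ltW.
by apply: h; [rewrite subrr normr0|apply/andP; split; lra].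
Qed.

(** Once its angle is normalised around [a], an exit that is neither straight ahead nor straight
    back falls on one of the two sides. *)
Lemma side_exit_exists a s : closure E (ray_pt a s) -> visible a s -> 0 <= s ->
  side_exit 1 a s \/ side_exit (-1) a s.
Proof.
move=> cE vis s0.
have [c ec] := weak cE (fun Ep => vis s (introT andP (conj s0 (lexx s))) Ep).
have [c' [c1 c2 cc]] := dir_norm a c.
have {cc}ec : exit (ray_pt a s) c' by move=> t t0; rewrite -cc; exact: ec.
have pi0 := pi_gt0 R.
have [ca|ca|ca] := ltgtP c' a.
- right; exists ((a - c') / pi).
    by rewrite divr_gt0 ?subr_gt0 //= ltr_pdivrMr // mul1r; lra.
  by rewrite (_ : _ + _ = c') // mulN1r mulNr mulrCA divff ?gt_eqF // mulr1 opprB addrC subrK.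
- left; exists ((c' - a) / pi).
    rewrite divr_gt0 ?subr_gt0 //= ltr_pdivrMr // mul1r ltrBlDl lt_neqAle c2 andbT.
    by apply/eqP => e; move: ec; rewrite e; exact: no_backward_exit.
  by rewrite (_ : _ + _ = c') // mul1r mulrCA divff ?gt_eqF // mulr1 addrC subrK.
- by exfalso; move: ec; rewrite ca; exact: no_forward_exit.
Qed.

Lemma dirDb a b t : b = 1 \/ b = -1 ->
  dir (a + b * t) = cos t *: dir a + (b * sin t) *: dir (a + pi / 2) :> V.
Proof. by case=> ->; rewrite dirD ?mul1r ?mulN1r ?cosN ?sinN. Qed.

Lemma dot_frame g a : g = dot g (dir a) *: dir a + dot g (dir (a + pi / 2)) *: dir (a + pi / 2).
Proof.
have h := cos2Dsin2 a.
apply: vecP; rewrite /dot !coordE ?cosDpihalf ?sinDpihalf.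
- by transitivity (g 0 0 * (cos a ^+ 2 + sin a ^+ 2)); [rewrite h mulr1 | ring].
- by transitivity (g 0 1 * (cos a ^+ 2 + sin a ^+ 2)); [rewrite h mulr1 | ring].
Qed.

Lemma sin_gt0_frac c : 0 < c < 1 -> 0 < sin (pi * c : R).
Proof.
have pi0 := pi_gt0 R.
by move=> /andP[c0 c1]; apply: sin_gt0_pi; rewrite mulr_gt0 //= gtr_pMr.
Qed.

(** At a grazing contact the normal is perpendicular to the line of sight, and an exit points to the
    outer side: an exit on side [b] means that [E] lies locally on side [- b]. *)
Lemma tangent_side b a s g : b = 1 \/ b = -1 -> half_plane_at E (ray_pt a s) g ->
  closure E (ray_pt a s) -> dot g (dir a) = 0 -> side_exit b a s ->
  0 < b * dot g (dir (a + pi / 2)).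
Proof.
move=> b1 gp cE g0 [c c01 ex].
have := exit_dot gp cE ex; rewrite -mulrA (dirDb _ _ b1) !lin g0 mulr0 add0r.
have sc := sin_gt0_frac c01.
have gn : dot g (dir (a + pi / 2)) != 0.
  apply/eqP => gn; have [+ _] := gp; rewrite (dot_frame g a) g0 gn.
  by rewrite !scale0r addr0 eqxx.
rewrite mulrAC pmulr_lge0 // => h; rewrite lt_neqAle h andbT eq_sym mulf_neq0 //.
by case: b1 => ->; rewrite ?oppr_eq0 oner_eq0.
Qed.

Lemma near_angle s d e : 0 < d -> s < e -> \forall t \near 0^'+,
  [/\ 0 < t, 0 < cos t, 0 < sin t, s * (sin t / cos t) < d & s / cos t < e].
Proof.
move=> d0 se.
have cc : cos t @[t --> (0 : R)] --> (1 : R) by rewrite -cos0; exact: continuous_cos.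
have cs : sin t @[t --> (0 : R)] --> (0 : R) by rewrite -{2}sin0; exact: continuous_sin.
have ci : (cos t)^-1 @[t --> (0 : R)] --> (1 : R)^-1 by apply: cvgV.
have c1 : s * (sin t / cos t) @[t --> (0 : R)] --> s * (0 / 1).
  exact: (cvgM (cvg_cst s) (cvgM cs ci)).
have c2 : s / cos t @[t --> (0 : R)] --> s / 1 by exact: (cvgM (cvg_cst s) ci).
rewrite mul0r mulr0 in c1; rewrite divr1 in c2.
have pi0 := pi_gt0 R.
near=> t; split.
- by near: t; exact: nbhs_right_gt.
- by near: t; apply: (cvgr_gt _ (cvg_at_right_filter cc)); rewrite ltr01.
- apply: sin_gt0_pi; apply/andP; split; near: t; [exact: nbhs_right_gt|exact: nbhs_right_lt].
- by near: t; apply: (cvgr_lt _ (cvg_at_right_filter c1)).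
- by near: t; apply: (cvgr_lt _ (cvg_at_right_filter c2)).
Unshelve. all: by end_near. Qed.

Lemma cvg_turn a b : (a + b * t) @[t --> 0^'+] --> a.
Proof.
have h : (a + b * t) @[t --> (0 : R)] --> a + b * 0.
  exact: (cvgD (cvg_cst a) (cvgM (cvg_cst b) (@cvg_id _ _))).
by rewrite mulr0 addr0 in h; exact: cvg_at_right_filter.
Qed.

Lemma near_turn a b (Q : set R) : nbhs a Q -> \forall t \near 0^'+, Q (a + b * t).
Proof. by move=> nQ; exact: (@cvg_turn a b _ nQ). Qed.

Lemma sign_neq0 b : b = 1 \/ b = -1 -> b != 0.
Proof. by case=> ->; rewrite ?oppr_eq0 oner_eq0. Qed.

Lemma signN b : b = 1 \/ b = -1 -> - b = 1 \/ - b = -1.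
Proof. by case=> ->; rewrite ?opprK; [right|left]. Qed.

Lemma ray_turn a b s t : b = 1 \/ b = -1 ->
  ray_pt (a + b * t) s = ray_pt a (s * cos t) + (s * sin t) *: (b *: dir (a + pi / 2)).
Proof.
move=> b1; rewrite /ray_pt (dirDb _ _ b1).
by apply: vecP; rewrite !coordE; ring.
Qed.

(** At distance [s / cos t] the turned ray differs from the old point by a pure sideways shift of
    [s * tan t]. *)
Lemma ray_turn_tan a b s t : b = 1 \/ b = -1 -> 0 < cos t ->
  ray_pt (a + b * t) (s / cos t) = ray_pt a s + (s * (sin t / cos t)) *: (b *: dir (a + pi / 2)).
Proof.
move=> b1 ct; rewrite (ray_turn _ _ _ b1) divfK ?gt_eqF //.
by congr (_ + _ *: _); rewrite mulrAC mulrA.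
Qed.

(** Upper semicontinuity of the contact distance when turning away from an exit. At a grazing
    contact [M] lies on side [b], so the sideways shift enters it; otherwise the old ray enters [M]
    just behind the contact, and [M] is open. *)
Lemma contact_upper b a s e : b = 1 \/ b = -1 -> contact a s -> side_exit (- b) a s -> s < e ->
  \forall t \near 0^'+, exists2 s', 0 <= s' < e & M (ray_pt (a + b * t) s').
Proof.
move=> b1 [s0 cs vis _] ex se.
have nEp : ~ E (ray_pt a s) by apply: vis; rewrite lexx ltW.
have cE := closureME cs.
have [g gp] := smooth cE nEp.
have [d1 d10 h1] := part_local cs nEp.
have := visible_dot gp cE s0 vis; rewrite le_eqVlt => /orP[/eqP g0|g0].
- have gn := tangent_side (signN b1) gp cE g0 ex.
  have [|d d0 h] := half_plane_in gp cE (w := b *: dir (a + pi / 2)).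
    by rewrite lin -oppr_gt0 -mulNr.
  pose K := `|b *: dir (a + pi / 2) : V| + 1.
  have K0 : 0 < K by rewrite ltr_wpDl.
  have m0 : 0 < Num.min d (d1 / K) by rewrite lt_min d0 divr_gt0.
  apply: filterS (near_angle m0 se) => t [t0 ct st tt tc].
  exists (s / cos t); first by rewrite tc divr_ge0 ?ltW.
  rewrite (ray_turn_tan _ _ b1 ct).
  have tp : 0 < s * (sin t / cos t) by rewrite mulr_gt0 ?divr_gt0.
  move: tt; rewrite lt_min => /andP[tt1 tt2].
  apply: h1; first by apply: h; rewrite ?subrr ?normr0 ?tp.
  rewrite addrAC subrr add0r normrZ gtr0_norm //.
  rewrite -[ltRHS](@divfK _ K) ?gt_eqF //.
  apply: ltr_pM => //; [exact: ltW|by rewrite /K ltrDl].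
- have [d d0 h] := half_plane_in gp cE g0.
  (* The norm is the sup norm, so [dir a] need not have norm 1; [K] is a positive bound for it. *)
  pose K := `|dir a : V| + 1.
  have K0 : 0 < K by rewrite ltr_wpDl.
  pose r := Num.min (Num.min d (d1 / K)) (e - s) / 2.
  have m0 : 0 < Num.min (Num.min d (d1 / K)) (e - s) by rewrite !lt_min d0 divr_gt0 // subr_gt0.
  have r0 : 0 < r by rewrite divr_gt0.
  have : r < Num.min (Num.min d (d1 / K)) (e - s) by rewrite ltr_pdivrMr // ltr_pMr // ltr1n.
  rewrite !lt_min => /andP[/andP[rd r1] re].
  have Mr : M (ray_pt a (s + r)).
    have -> : ray_pt a (s + r) = ray_pt a s + r *: dir a by rewrite /ray_pt scalerDl addrA.
    apply: h1; first by apply: h; rewrite ?subrr ?normr0 ?r0.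
    rewrite addrAC subrr add0r normrZ gtr0_norm //.
    rewrite -[ltRHS](@divfK _ K) ?gt_eqF //.
    by apply: ltr_pM => //; [exact: ltW|rewrite /K ltrDl].
  have cv : ray_pt (a + b * t) (s + r) @[t --> 0^'+] --> ray_pt a (s + r).
    by apply: cvg_ray_pt; [exact: cvg_turn|exact: cvg_cst].
  apply: filterS (cvg_open cv oM Mr) => t Mt.
  by exists (s + r) => //; apply/andP; split; lra.
Qed.

(** Lower semicontinuity of the contact distance, in both turning directions: the initial segment is
    compact and misses the closed set [closure M]. *)
Lemma contact_lower a s e : contact a s -> e < s ->
  \forall a' \near a, forall t, 0 <= t <= e -> ~ closure M (ray_pt a' t).
Proof.
move=> [_ _ _ sm] es.
have cK : compact `[0 : R, e]%classic by exact: segment_compact.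
move/compact_near_coveringP: cK => /(_ _ (nbhs a) (fun a' t => ~ closure M (ray_pt a' t))) h.
suff h' : \forall a' \near a, `[0, e]%classic `<=` (fun t => ~ closure M (ray_pt a' t)).
  by apply: filterS h' => a' ha t t0; apply: ha; rewrite /= in_itv.
apply: h => t /=; rewrite in_itv /= => /andP[t0 te].
have cv : ray_pt ta.2 ta.1 @[ta --> (t, a)] --> ray_pt a t.
  by apply: cvg_ray_pt; [exact: cvg_snd|exact: cvg_fst].
have nc : ~ closure M (ray_pt a t) by apply: sm; rewrite t0 (le_lt_trans te).
have := cvg_open cv (closed_openC (@closed_closure _ M)) nc.
by case=> [[A B] /= [nA nB] AB]; exists (A, B).
Qed.

(** The two semicontinuities keep the new contact close to the old one, where the absence of an exit
    on side [b] is an open condition. *)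
Lemma contact_persist b a s : b = 1 \/ b = -1 -> contact a s -> side_exit (- b) a s ->
  ~ side_exit b a s ->
  \forall t \near 0^'+, forall s', contact (a + b * t) s' -> ~ side_exit b (a + b * t) s'.
Proof.
move=> b1 ct ex nex; have [s0 cs vis _] := ct.
have [[A B] /= [nA /nbhs_ballP[d /= d0 hB]] AB] := side_exit_open b1 (ltW s0) vis nex.
have es : s - d / 2 < s by lra.
have se : s < s + d / 2 by lra.
have nl : \forall t \near 0^'+, forall r, 0 <= r <= s - d / 2 -> ~ closure M (ray_pt (a + b * t) r).
  exact: near_turn (contact_lower ct es).
have na : \forall t \near 0^'+, A (a + b * t) by exact: near_turn.
apply: filterS3 nl na (contact_upper b1 ct ex se) => t lt At [r /andP[r0 re] Mr] s' ct' ex'.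
have [s'' ct'' s''r] := contact_exists r0 Mr.
have s'E := contact_unique ct' ct''.
have [s'0 cs' _ _] := ct'.
have ls' : s - d / 2 < s'.
  by rewrite ltNge; apply/negP => h; apply: (lt s') => //; rewrite (ltW s'0).
apply: (AB (a + b * t, s')) => //; split => //=.
by apply: hB; rewrite /ball /= ltr_distlC; apply/andP; split; lra.
Qed.

(** A ray that misses [M] can only touch it by grazing. If a limit of contacts had an exit on side
    [b], then [M] would lie on side [- b] there, and rays turned towards [b] could not touch it
    nearby. *)
Lemma contact_end b a : b = 1 \/ b = -1 -> ~ hits M a ->
  \forall t \near 0^'+, forall s, contact (a + b * t) s -> ~ side_exit b (a + b * t) s.
Proof.
move=> b1 nh; have nhM s : 0 <= s -> ~ M (ray_pt a s) by move=> s0 Ms; apply: nh; exists s.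
(* Nearby rays meet [E] at distance [r], so their contacts are nearer and limit positions range over
   a compact interval. *)
have [r r0 Er] := blocked a.
have cK : compact `[0 : R, r]%classic by exact: segment_compact.
move/compact_near_coveringP: cK => /(_ _ (0^'+)
  (fun t s => contact (a + b * t) s -> ~ side_exit b (a + b * t) s)) h.
suff h' : \forall t \near 0^'+, `[0, r]%classic `<=`
    (fun s => contact (a + b * t) s -> ~ side_exit b (a + b * t) s).
  have cv : ray_pt (a + b * t) r @[t --> 0^'+] --> ray_pt a r.
    by apply: cvg_ray_pt; [exact: cvg_turn|exact: cvg_cst].
  have hE : \forall t \near 0^'+, E (ray_pt (a + b * t) r) by exact: (cvg_open cv oE Er).
  apply: filterS2 h' hE => t ht Et s ct.
  have [s0 _ vis _] := ct.
  apply: ht => //; rewrite /= in_itv /= (ltW s0) leNgt; apply/negP => rs.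
  by apply: (vis r) => //; rewrite r0 ltW.
apply: h => s /=; rewrite in_itv /= => /andP[s0 sr].
pose F2 : set_system (R * R) := @filter_prod R R (nbhs s) (0 : R)^'+.
have FP : Filter F2 by exact: filter_prod_filter.
suff : \forall st \near F2, contact (a + b * st.2) st.1 -> ~ side_exit b (a + b * st.2) st.1.
  by [].
have cvs : st.1 @[st --> F2] --> s by exact: cvg_fst.
have cva : (a + b * st.2) @[st --> F2] --> a.
  exact: (cvg_comp _ _ cvg_snd (@cvg_turn a b)).
have cvp : ray_pt (a + b * st.2) st.1 @[st --> F2] --> ray_pt a s.
  exact: cvg_ray_pt.
have [cs|ncs] := pselect (closure M (ray_pt a s)); last first.
  apply: filterS (cvg_open cvp (closed_openC (@closed_closure _ M)) ncs).
  by move=> [s' t] /= nc [_ cs' _ _].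
have nEs : ~ E (ray_pt a s) by move=> Es; apply: (nhM s) => //; apply: cM.
have [vis|nvis] := pselect (visible a s); last first.
  have [t0 /andP[t00 t0s] Et0] : exists2 t0, 0 <= t0 <= s & E (ray_pt a t0).
    apply: contrapT => nex; apply: nvis => t0 t0s Et0; apply: nex.
    by exists t0.
  have lt0s : t0 < s.
    by rewrite lt_neqAle t0s andbT; apply/eqP => e; apply: nEs; rewrite -e.
  have cvt : ray_pt (a + b * st.2) t0 @[st --> F2] --> ray_pt a t0.
    by apply: cvg_ray_pt => //; exact: cvg_cst.
  have c1 : \forall st \near F2, E (ray_pt (a + b * st.2) t0) by exact: (@cvg_open _ _ F2 FP _ _ _ cvt oE Et0).
  have c2 : \forall st \near F2, t0 < st.1.
    exact: (@cvgr_gt R _ F2 FP _ s cvs).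
  apply: (@filterS2 _ F2 FP _ _ _ _ c1 c2) => -[s' t] /= Et lt [_ _ vis' _] _.
  by apply: (vis' t0) => //; rewrite t00 ltW.
have spos : 0 < s.
  rewrite lt_neqAle s0 andbT eq_sym; apply/eqP => e.
  by move: cs; rewrite e ray_pt0 => /closureME; exact: not_closure_x.
have [ex|nex] := pselect (side_exit b a s); last first.
  have := side_exit_open b1 s0 vis nex => so.
  have cv2 : (a + b * st.2, st.1) @[st --> F2] --> (a, s).
    exact: (cvg_pair cva cvs).
  by apply: (@filterS _ F2 FP _ _ _ (cv2 _ so)) => -[s' t] /= h1 _.
have cE := closureME cs.
have [g gp] := smooth cE nEs.
have [d1 d10 h1] := part_local cs nEs.
(* Otherwise the ray in direction [a] would enter [M] just behind the limit point. *)
have g0 : dot g (dir a) = 0.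
  apply/eqP; rewrite eq_le (visible_dot gp cE spos vis) /= leNgt; apply/negP => g0.
  have [d d0 h2] := half_plane_in gp cE g0.
  pose K := `|dir a : V| + 1.
  have K0 : 0 < K by rewrite ltr_wpDl.
  pose r' := Num.min d (d1 / K) / 2.
  have m0 : 0 < Num.min d (d1 / K) by rewrite !lt_min d0 divr_gt0.
  have r'0 : 0 < r' by rewrite divr_gt0.
  have : r' < Num.min d (d1 / K) by rewrite ltr_pdivrMr // ltr_pMr // ltr1n.
  rewrite !lt_min => /andP[rd r1].
  apply: (nhM (s + r')); first by rewrite addr_ge0 // ltW.
  have -> : ray_pt a (s + r') = ray_pt a s + r' *: dir a by rewrite /ray_pt scalerDl addrA.
  apply: h1; first by apply: h2; rewrite ?subrr ?normr0 ?r'0.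
  rewrite addrAC subrr add0r normrZ gtr0_norm //.
  rewrite -[ltRHS](@divfK _ K) ?gt_eqF //.
  by apply: ltr_pM => //; [exact: ltW|rewrite /K ltrDl].
have gn := tangent_side b1 gp cE g0 ex.
(* A point of the turned ray is a point of the missed ray shifted outwards, hence outside
   [closure E]. *)
have [|d2 d20 h2] := half_plane_out gp (w := b *: dir (a + pi / 2)); first by rewrite lin.
have ct0 : cos st.2 @[st --> F2] --> (1 : R).
  have h : cos t @[t --> (0 : R)^'+] --> (1 : R).
    by apply: cvg_at_right_filter; rewrite -cos0; exact: continuous_cos.
  exact: (cvg_comp _ _ cvg_snd h).
have st0 : sin st.2 @[st --> F2] --> (0 : R).
  have h : sin t @[t --> (0 : R)^'+] --> (0 : R).
    by apply: cvg_at_right_filter; rewrite -{2}sin0; exact: continuous_sin.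
  exact: (cvg_comp _ _ cvg_snd h).
have cvz : ray_pt a (st.1 * cos st.2) @[st --> F2] --> ray_pt a s.
  apply: cvg_ray_pt; first exact: cvg_cst.
  by rewrite -[X in _ --> X]mulr1; exact: cvgM.
have cvt : st.1 * sin st.2 @[st --> F2] --> (0 : R).
  by rewrite -(mulr0 s); exact: cvgM.
have m0 : 0 < Num.min d1 d2 by rewrite lt_min d10.
have n1 := @cvgr_distC_lt _ _ _ F2 FP _ _ cvz _ m0.
have n2 := @cvgr_lt R _ F2 FP _ _ cvt _ d20.
have n3 := @cvgr_gt R _ F2 FP _ _ cvs _ spos.
have n4 : \forall st \near F2, [/\ 0 < st.2, 0 < cos st.2 & 0 < sin st.2].
  exists (setT, [set t | [/\ 0 < t, 0 < cos t & 0 < sin t]]); last by move=> [s' t] /= [].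
  split => /=; first exact: filterT.
  by apply: filterS (near_angle ltr01 (ltr01 : 0 < (1 : R))) => t [].
near=> st => /= - [_ cs' _ _] _.
have sr1 : `|ray_pt a (st.1 * cos st.2) - ray_pt a s| < Num.min d1 d2 by near: st.
have sr2 : st.1 * sin st.2 < d2 by near: st.
have sr3 : 0 < st.1 by near: st.
have [t0 ct stp] : [/\ 0 < st.2, 0 < cos st.2 & 0 < sin st.2] by near: st.
move: sr1; rewrite lt_min => /andP[sr1 sr1'].
move: cs'; rewrite (ray_turn _ _ _ b1) => /closureME; apply: h2 => //.
  by rewrite sr2 mulr_gt0.
move=> Ez; apply: (nhM (st.1 * cos st.2)); first by rewrite mulr_ge0 // ltW.
exact: h1.
Unshelve. all: by end_near. Qed.

(** Take the supremum [m] of the directions whose contact has a right exit. If each contact had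
    exits on one side only, [contact_persist] would extend a right exit beyond [m], or a left exit
    at [m] to an interval before [m]; both contradict the supremum. *)
Lemma transition a1 a2 s1 s2 : a1 < a2 ->
  (forall a, a1 <= a <= a2 -> hits M a) ->
  contact a1 s1 -> side_exit (-1) a1 s1 -> contact a2 s2 -> side_exit 1 a2 s2 ->
  exists a s, [/\ contact a s, side_exit 1 a s & side_exit (-1) a s].
Proof.
move=> a12 hM ct1 ex1 ct2 ex2; apply: contrapT => nboth.
have no a s : contact a s -> side_exit 1 a s -> side_exit (-1) a s -> False.
  by move=> *; apply: nboth; exists a, s.
have ctE a : a1 <= a <= a2 -> exists s, contact a s.
  by move=> /hM[s s0 Ms]; have [t ct _] := contact_exists s0 Ms; exists t.
have exE a s : contact a s -> side_exit 1 a s \/ side_exit (-1) a s.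
  by move=> [s0 /closureME cs vis _]; apply: side_exit_exists => //; exact: ltW.
pose S := [set a | a1 <= a <= a2 /\ exists2 s, contact a s & side_exit (-1) a s].
have S1 : S a1 by split; [rewrite lexx ltW|exists s1].
have ubS : has_ubound S by exists a2 => a [/andP[]].
have hsS : has_sup S by split => //; exists a1.
pose m := sup S.
have m1 : a1 <= m by exact: ub_le_sup.
have m2 : m <= a2 by apply: ge_sup => //; [exists a1|move=> a [/andP[]]].
have [s ct] := ctE m (introT andP (conj m1 m2)).
have [ex|nex] := pselect (side_exit (-1) m s).
- have mlt : m < a2.
    rewrite lt_neqAle m2 andbT; apply/eqP => me.
    move: ct ex; rewrite me => ct ex.
    by move: ex; rewrite (contact_unique ct ct2) => ex; exact: no ct2 ex2 ex.
  have nex : ~ side_exit 1 m s by move=> ex'; exact: no ct ex' ex.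
  have pe := contact_persist (or_introl (erefl 1)) ct ex nex.
  have am0 : 0 < a2 - m by rewrite subr_gt0.
  have := filter_ex (filterI pe (filterI (nbhs_right_gt 0) (nbhs_right_lt am0))).
  move=> [t [ht [t0 /= tm]]]; rewrite mul1r in ht.
  have mt : a1 <= m + t <= a2 by apply/andP; split; lra.
  have [s' ct'] := ctE _ mt.
  have [/(ht _ ct')//|ex'] := exE _ _ ct'.
  have : m + t <= m by apply: ub_le_sup => //; split => //; exists s'.
  by rewrite /= in t0; lra.
- have ex : side_exit (- -1) m s by rewrite opprK; case: (exE _ _ ct).
  have pe := contact_persist (or_intror (erefl (-1))) ct ex nex.
  have [d /= d0 hd] := pe.
  have [a [/andP[aa1 aa2] [s' ct' ex']] am] := sup_adherent d0 hsS.
  have aleM : a <= m by apply: ub_le_sup => //; split; [rewrite aa1|exists s'].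
  have anm : a != m.
    by apply/eqP => e; apply: nex; move: ct' ex'; rewrite e => ct'; rewrite (contact_unique ct' ct).
  have alt : a < m by rewrite lt_neqAle anm.
  apply: (hd (m - a) _ _ s').
  + by rewrite /ball /= sub0r normrN gtr0_norm ?subr_gt0 //; rewrite -/m in am; lra.
  + by rewrite subr_gt0.
  + by rewrite mulN1r opprB addrC subrK.
  + by rewrite mulN1r opprB addrC subrK.
Qed.

(** Membership of [ray_pt a' t] in a sector is a pair of inequalities affine in [t], strict at
    [t = 0] because the sector contains [x]. *)
Lemma affine_gt0 (A X t t' : R) : 0 < A -> 0 <= t' -> t' <= t -> 0 < A + t * X -> 0 < A + t' * X.
Proof. by move=> A0 t'0 t't; have [X0|X0] := leP 0 X; nra. Qed.

(* What is used of the sector W bounded by two exits at a contact in the direction a. *)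
Definition wedge_spec (W : set V) a :=
  [/\ forall A : set V, connected A -> A `<=` E -> A `<=` W \/ A `&` W = set0,
      forall a' t t', 0 <= t' <= t -> W (ray_pt a' t) -> W (ray_pt a' t'),
      forall t, 0 <= t -> W (ray_pt (a + pi) t)
    & forall t, 0 <= t -> E (ray_pt a t) -> ~ W (ray_pt a t)].

(** [W] is the sector at the contact that goes counterclockwise from the left exit [d2], through the
    direction back to [x], to the right exit [d1]. *)
Lemma wedge_exists a s : contact a s -> side_exit 1 a s -> side_exit (-1) a s ->
  exists W, wedge_spec W a /\ exists2 z, M z & ~ W z.
Proof.
move=> [s0 cs vis _] [c1 c101 ex1] [c2 c201 ex2].
set p := ray_pt a s in ex1 ex2 cs.
have nEp : ~ E p by apply: vis; rewrite lexx ltW.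
have cE := closureME cs.
have [g gp] := smooth cE nEp.
have [g0 _] := gp.
have ge0 := visible_dot gp cE s0 vis.
set e := dir a in ge0; pose n : V := dir (a + pi / 2).
pose d2 : V := dir (a + 1 * pi * c1); pose d1 : V := dir (a + -1 * pi * c2).
have s1 := sin_gt0_frac c101; have s2 := sin_gt0_frac c201.
have d2E : d2 = cos (pi * c1) *: e + sin (pi * c1) *: n.
  by rewrite /d2 -mulrA (dirDb _ _ (or_introl (erefl 1))) mul1r.
have d1E : d1 = cos (pi * c2) *: e - sin (pi * c2) *: n.
  by rewrite /d1 -mulrA (dirDb _ _ (or_intror (erefl (-1)))) mulN1r scaleNr.
have gd2 := exit_dot gp cE ex1; have gd1 := exit_dot gp cE ex2.
rewrite -/d2 d2E !lin in gd2; rewrite -/d1 d1E !lin in gd1.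
have cen : cross e n = 1 by rewrite cross_dir_dir addrAC subrr add0r sin_pihalf.
have cd2e : cross d2 e = - sin (pi * c1).
  by rewrite d2E !lin crossvv (crossC n) cen; ring.
have ced1 : cross e d1 = - sin (pi * c2).
  by rewrite d1E !lin crossvv cen; ring.
have cd21 : cross d2 d1 = - sin (pi * c1 + pi * c2).
  by rewrite d2E d1E !lin !crossvv (crossC n) cen sinD; ring.
have pi0 := pi_gt0 R.
have ang : convex_angle d2 d1.
  (* The sector has angle [2 * pi - pi * (c1 + c2)], so it is convex exactly when [1 <= c1 + c2]. *)
  have [c12|c12|c12] := ltgtP (c1 + c2) 1; last first.
  - right; split; first exact: dir_neq0.
    exists 1 => //; rewrite scaleN1r /d1 /d2 -dirBpi; congr dir.
    by rewrite (_ : c2 = 1 - c1); [ring|lra].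
  - left; rewrite cd21 -sinDpi (_ : pi * c1 + pi * c2 + pi = pi * (c1 + c2 - 1) + pi + pi); last ring.
    rewrite !sinDpi opprK; apply: sin_gt0_pi; apply/andP; split; first by rewrite mulr_gt0 // subr_gt0.
    by rewrite gtr_pMr //; move: c101 c201; lra.
  (* Here [e] is a positive combination of the exits: [sin (pi * c2) *: d2 + sin (pi * c1) *: d1] is
     [sin (pi * c1 + pi * c2) *: e]. Since [g] is nonnegative on the exits and nonpositive on [e],
     it vanishes on [e], then on [n], so [g = 0]. *)
  - exfalso.
    have s12 : 0 < sin (pi * c1 + pi * c2).
      rewrite -mulrDr; apply: sin_gt0_pi; rewrite gtr_pMr // c12 andbT mulr_gt0 //.
      by move: c101 c201; lra.
    rewrite sinD in s12.
    have gn0 : dot g e = 0.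
      apply/eqP; rewrite eq_le ge0 /= -(pmulr_rge0 _ s12).
      have := addr_ge0 (mulr_ge0 (ltW s2) gd2) (mulr_ge0 (ltW s1) gd1).
      by congr (_ <= _); ring.
    rewrite gn0 !mulr0 !add0r in gd1 gd2.
    have gnn : dot g n = 0.
      by apply/eqP; rewrite eq_le; move: gd1; rewrite oppr_ge0 pmulr_rle0 // => ->; rewrite pmulr_rge0 // in gd2.
    by move/eqP: g0; apply; rewrite (dot_frame g a) -/e -/n gn0 gnn !scale0r addr0.
pose W := sector p d2 d1.
have xp : x - p = - s *: e by rewrite /p /ray_pt opprD addrA subrr add0r scaleNr.
have rp a' t : ray_pt a' t - p = - s *: e + t *: dir a'.
  by rewrite -xp /ray_pt addrAC.
exists W; split; [split|].
- move=> A cA AE; apply: sector_connected => // t t0 At.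
  + by apply: (ex1 t t0); exact: AE.
  + by apply: (ex2 t t0); exact: AE.
- move=> a' t t' /andP[t'0 t't]; rewrite /W /sector /= !rp !lin cd2e ced1 => -[].
  have A1 : 0 < s * sin (pi * c1) by exact: mulr_gt0.
  have A2 : 0 < s * sin (pi * c2) by exact: mulr_gt0.
  rewrite !mulrNN => h1 h2; split; first exact: affine_gt0 h1.
  by apply: affine_gt0 h2; rewrite // mulNr mulrN opprK.
- move=> t t0; rewrite /W /sector /= !rp dirDpi -/e !lin cd2e ced1.
  have A1 : 0 < s * sin (pi * c1) by exact: mulr_gt0.
  have A2 : 0 < s * sin (pi * c2) by exact: mulr_gt0.
  by split; nra.
- move=> t t0 Et; rewrite /W /sector /= !rp -/e !lin cd2e => -[h _].
  have st : s < t by rewrite ltNge; apply/negP => ts; apply: (vis t) => //; rewrite t0.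
  by nra.
- pose k := `|cross d2 g| + 1.
  have k0 : 0 < k by rewrite ltr_wpDl.
  pose h := sin (pi * c1) / k.
  have h0 : 0 < h by rewrite divr_gt0.
  pose w := e - h *: g.
  have gw : dot g w < 0.
    by rewrite /w !lin; have := mulr_gt0 h0 (dot_gt0 g0); lra.
  have cw : cross d2 w < 0.
    rewrite /w !lin cd2e.
    have : h * - cross d2 g < sin (pi * c1).
      rewrite -[ltRHS](@divfK _ k) ?gt_eqF // -/h ltr_pM2l //.
      by rewrite (le_lt_trans (ler_norm _)) // normrN /k ltrDl.
    by lra.
  have [d d0 hd] := half_plane_in gp cE gw.
  have [d' d'0 hd'] := part_local cs nEp.
  pose K := `|w| + 1.
  have K0 : 0 < K by rewrite ltr_wpDl.
  pose r := Num.min d (d' / K) / 2.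
  have m0 : 0 < Num.min d (d' / K) by rewrite !lt_min d0 divr_gt0.
  have r0 : 0 < r by rewrite divr_gt0.
  have : r < Num.min d (d' / K) by rewrite ltr_pdivrMr // ltr_pMr // ltr1n.
  rewrite !lt_min => /andP[rd r1].
  exists (p + r *: w).
    apply: hd'; first by apply: hd; rewrite ?subrr ?normr0 ?r0.
    rewrite addrAC subrr add0r normrZ gtr0_norm //.
    rewrite -[ltRHS](@divfK _ K) ?gt_eqF //.
    by apply: ltr_pM => //; [exact: ltW|rewrite /K ltrDl].
  rewrite /W /sector /= addrAC subrr add0r lin => -[].
  by have := mulr_gt0 r0 (_ : 0 < - cross d2 w); rewrite oppr_gt0 => /(_ cw); lra.
Qed.

(* At the two ends of the set of directions hitting M the contacts have exits on opposite sides. *)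
Lemma wedge_of_gap a0 : ~ hits M a0 -> (exists a, hits M a) ->
  (forall a b c, a0 < a -> a < b -> b < c -> c < a0 + pi *+ 2 -> hits M a -> hits M c -> hits M b) ->
  exists a W, wedge_spec W a /\ exists2 z, M z & ~ W z.
Proof.
move=> nh0 [am' hm'] conv.
have hdir a b : dir a = dir b :> V -> hits M a -> hits M b.
  by move=> e [s s0 Ms]; exists s => //; rewrite /ray_pt -e.
have [am [am1 am2 ame]] := dir_norm (a0 + pi) am'.
have hm : hits M am by exact: (hdir _ _ ame).
have {}am1 : a0 < am by move: am1; rewrite addrK.
have {}am2 : am < a0 + pi *+ 2.
  rewrite lt_neqAle mulr2n addrA am2 andbT; apply/eqP => e; apply: nh0.
  by apply: (hdir am) hm; rewrite e -addrA -mulr2n dirD2pi.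
pose S := [set a | [/\ a0 < a, a < a0 + pi *+ 2 & hits M a]].
have Sm : S am by split.
have hsS : has_sup S by split; [exists am|exists (a0 + pi *+ 2) => a [_ /ltW]].
have hiS : has_inf S by split; [exists am|exists a0 => a [/ltW]].
(* Hitting the open set [M] is an open condition, so neither end of [S] hits [M]. *)
have supS : ~ hits M (sup S).
  move=> [s s0 Ms].
  have le2 : sup S <= a0 + pi *+ 2 by apply: ge_sup; [exists am|move=> a [_ /ltW]].
  have lt2 : sup S < a0 + pi *+ 2.
    rewrite lt_neqAle le2 andbT; apply/eqP => e; apply: nh0; apply: (hdir (sup S)).
      by rewrite e dirD2pi.
    by exists s.
  have gt0 : a0 < sup S by rewrite (lt_le_trans am1) //; apply: ub_le_sup Sm; case: hsS.
  have cv : ray_pt (sup S + 1 * t) s @[t --> 0^'+] --> ray_pt (sup S) s.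
    by apply: cvg_ray_pt; [exact: cvg_turn|exact: cvg_cst].
  have gap : 0 < a0 + pi *+ 2 - sup S by rewrite subr_gt0.
  have := filter_ex (filterI (cvg_open cv oM Ms) (filterI (nbhs_right_gt 0) (nbhs_right_lt gap))).
  move=> [t [Mt [t0 /= tm]]]; rewrite mul1r in Mt; rewrite /= in t0.
  have : sup S + t <= sup S.
    by apply: ub_le_sup; [case: hsS|split; [lra|lra|exists s]].
  by lra.
have infS : ~ hits M (inf S).
  move=> [s s0 Ms].
  have le2 : a0 <= inf S by apply: lb_le_inf; [exists am|move=> a [/ltW]].
  have lt2 : a0 < inf S.
    rewrite lt_neqAle le2 andbT; apply/eqP => e; apply: nh0; rewrite e; by exists s.
  have gt0 : inf S < a0 + pi *+ 2 by rewrite (le_lt_trans _ am2) //; apply: ge_inf Sm; case: hiS.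
  have cv : ray_pt (inf S + -1 * t) s @[t --> 0^'+] --> ray_pt (inf S) s.
    by apply: cvg_ray_pt; [exact: cvg_turn|exact: cvg_cst].
  have gap : 0 < inf S - a0 by rewrite subr_gt0.
  have := filter_ex (filterI (cvg_open cv oM Ms) (filterI (nbhs_right_gt 0) (nbhs_right_lt gap))).
  move=> [t [Mt [t0 /= tm]]]; rewrite mulN1r in Mt; rewrite /= in t0.
  have : inf S <= inf S - t.
    by apply: ge_inf; [case: hiS|split; [lra|lra|exists s]].
  by lra.
(* Turning into [S] means turning right at its supremum and left at its infimum. Contacts there lack
   a right, respectively left, exit, which is the configuration that [transition] needs. *)
have [d2 /= d20 hd2] := contact_end (or_intror (erefl (-1))) supS.
have [d1 /= d10 hd1] := contact_end (or_introl (erefl 1)) infS.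
have amsup : am < sup S.
  rewrite lt_neqAle; apply/andP; split; last by apply: ub_le_sup Sm; case: hsS.
  by apply/eqP => e; apply: supS; rewrite -e.
have infam : inf S < am.
  rewrite lt_neqAle; apply/andP; split; last by apply: ge_inf Sm; case: hiS.
  by apply/eqP => e; apply: infS; rewrite e.
have [|a2 [a2a a2b a2h] a2s] := @sup_adherent R S (Num.min d2 (sup S - am)) _ hsS.
  by rewrite lt_min d20 subr_gt0.
have [|a1 [a1a a1b a1h] a1s] := @inf_adherent R S (Num.min d1 (am - inf S)) _ hiS.
  by rewrite lt_min d10 subr_gt0.
have a2m : am < a2.
  have : Num.min d2 (sup S - am) <= sup S - am by rewrite ge_min lexx orbT.
  by lra.
have a1m : a1 < am.
  have : Num.min d1 (am - inf S) <= am - inf S by rewrite ge_min lexx orbT.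
  by lra.
have a2d : sup S - d2 < a2.
  have : Num.min d2 (sup S - am) <= d2 by rewrite ge_min lexx.
  by lra.
have a1d : a1 < inf S + d1.
  have : Num.min d1 (am - inf S) <= d1 by rewrite ge_min lexx.
  by lra.
have lt2 : a2 < sup S.
  rewrite lt_neqAle; apply/andP; split; last by apply: ub_le_sup; [case: hsS|split].
  by apply/eqP => e; apply: supS; rewrite -e.
have lt1 : inf S < a1.
  rewrite lt_neqAle; apply/andP; split; last by apply: ge_inf; [case: hiS|split].
  by apply/eqP => e; apply: infS; rewrite e.
have [s2' s20' Ms2] := a2h; have [s2 ct2 _] := contact_exists s20' Ms2.
have [s1' s10' Ms1] := a1h; have [s1 ct1 _] := contact_exists s10' Ms1.
have exE a s : contact a s -> side_exit 1 a s \/ side_exit (-1) a s.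
  by move=> [s0 /closureME cs vis _]; apply: side_exit_exists => //; exact: ltW.
have e2 : side_exit 1 a2 s2.
  have [//|ex] := exE _ _ ct2; exfalso.
  apply: (hd2 (sup S - a2) _ _ s2); rewrite ?subr_gt0 ?mulN1r ?subKr //.
  by rewrite /ball /= sub0r normrN gtr0_norm ?subr_gt0 //; lra.
have e1 : side_exit (-1) a1 s1.
  have [ex|//] := exE _ _ ct1; exfalso.
  apply: (hd1 (a1 - inf S) _ _ s1); rewrite ?subr_gt0 ?mul1r ?[inf S + _]addrC ?subrK //.
  by rewrite /ball /= sub0r normrN gtr0_norm ?subr_gt0 //; lra.
have [||a [s [ct ex1 ex2]]] := transition _ _ ct1 e1 ct2 e2.
- by lra.
- move=> b /andP[]; rewrite le_eqVlt => /orP[/eqP<- //|b1]; rewrite le_eqVlt => /orP[/eqP -> //|b2].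
  by apply: (conv a1 b a2).
by have [W hW] := wedge_exists ct ex1 ex2; exists a, W.
Qed.

End Part.

Lemma dir_add a b c : dir a = dir b :> V -> dir (a + c) = dir (b + c) :> V.
Proof.
move=> e; have e0 : cos a = cos b by have := congr1 (fun p : V => p 0 0) e; rewrite !coordE.
have e1 : sin a = sin b by have := congr1 (fun p : V => p 0 1) e; rewrite !coordE.
by rewrite /dir !cosD !sinD e0 e1.
Qed.

Let subEE : E `<=` E. Proof. by []. Qed.
Let closureEE : closure E `&` E `<=` E. Proof. by move=> ? []. Qed.
Let firstE a s t : 0 <= s -> 0 <= t -> E (ray_pt a s) -> E (ray_pt a t) -> ~ E (ray_pt a t) -> s < t.
Proof. by []. Qed.

(** * Exits on both sides when no direction misses [E] *)

Section Sweep.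
Variables (a s b c : R).
Hypotheses (b1 : b = 1 \/ b = -1) (c01 : 0 < c < 1).
Let p0 := ray_pt a s.
Let u : V := dir (a + b * pi * c).
Hypothesis ex0 : exit p0 (a + b * pi * c).
Hypothesis ct0 : contact E a s.

(* The segments from x to the points of the exit, the first of which to meet E carries a contact. *)
Let sweep k l : V := x + l *: (p0 + k *: u - x).
Let bad k := exists2 l, 0 <= l <= 1 & E (sweep k l).

Let sweep_cvg T (F : set_system T) (f h : T -> R) k l : Filter F ->
  f @ F --> k -> h @ F --> l -> (fun i => sweep (f i) (h i)) @ F --> sweep k l.
Proof.
move=> FF fk hl; apply: cvgD; first exact: cvg_cst.
apply: cvgZ => //; apply: cvgB; last exact: cvg_cst.
by apply: cvgD; [exact: cvg_cst|exact: cvgZr_tmp].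
Qed.

(** The ray from [x] parallel to the exit meets [E], and the swept segments converge to it. *)
Lemma sweep_bad : exists2 k, 0 <= k & bad k.
Proof.
have [r r0 Er] := blocked (a + b * pi * c).
have [d d0 hd] := open_normE oE Er.
have rpos : 0 < r.
  rewrite lt_neqAle r0 andbT eq_sym; apply/eqP => e.
  by apply: nEx; rewrite -(ray_pt0 (a + b * pi * c)) -e.
pose K := `|p0 - x| + 1.
have K0 : 0 < K by rewrite ltr_wpDl.
(* The first summand makes [r / k] at most 1; the second makes the distance [r / k * |p0 - x|] to
   the point of [E] less than [d]. *)
pose k := r + r * K / d.
have rKd : 0 < r * K / d by rewrite divr_gt0 // mulr_gt0.
have k0 : 0 < k by rewrite addr_gt0.
exists k; first exact: ltW.
exists (r / k); first by rewrite divr_ge0 ?(ltW k0) //= ler_pdivrMr // mul1r /k lerDl ltW.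
apply: hd.
have -> : sweep k (r / k) - ray_pt (a + b * pi * c) r = (r / k) *: (p0 - x).
  by rewrite /sweep /ray_pt -/u; apply: vecP; rewrite !coordE; field; rewrite gt_eqF.
rewrite normrZ gtr0_norm ?divr_gt0 // mulrAC ltr_pdivrMr //.
have : r * `|p0 - x| < r * K by rewrite ltr_pM2l // /K ltrDl.
have : d * k = d * r + r * K by rewrite /k mulrDr; congr (_ + _); field; rewrite gt_eqF.
by have := mulr_gt0 d0 rpos; lra.
Qed.

(** At the first bad position the segment grazes [E] on the side not yet swept, side [b]. An exit to
    side [b] from that contact would put [E] on the side already swept. *)
Lemma sweep_contact : exists a' s', contact E a' s' /\ side_exit (- b) a' s'.
Proof.
have [s0 cs vis smin] := ct0.
pose S := [set k | 0 <= k /\ bad k].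
have [kb kb0 bkb] := sweep_bad.
have hiS : has_inf S by split; [exists kb|exists 0 => k []].
pose k := inf S.
have k0 : 0 <= k by apply: lb_le_inf; [exists kb|move=> ? []].
have good k' : 0 <= k' -> k' < k -> ~ bad k'.
  move=> k'0 k'k bk; have := ge_inf hiS.2 (conj k'0 bk : S k').
  by rewrite leNgt k'k.
have goodk : ~ bad k.
  move=> [l l01 El].
  have [kz|kz] := eqVneq k 0.
    apply: (vis (l * s)).
      by move/andP: l01 => [l0 l1]; rewrite mulr_ge0 ?(ltW s0) //= ler_piMl // ltW.
    by move: El; rewrite kz /sweep /p0 /ray_pt; congr E; apply: vecP; rewrite !coordE; ring.
  have kpos : 0 < k by rewrite lt_neqAle eq_sym kz.
  have cv : sweep k' l @[k' --> k] --> sweep k l.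
    by apply: sweep_cvg; [exact: cvg_id|exact: cvg_cst].
  have /nbhs_ballP[d /= d0 hd] : \forall k' \near k, E (sweep k' l) by exact: (cvg_open cv oE El).
  pose k' := Num.max 0 (k - d / 2).
  have k'k : k' < k by rewrite gt_max kpos; lra.
  apply: (good k') => //; first by rewrite le_max lexx.
  exists l => //; apply: hd; rewrite /ball /= ltr_distlC; apply/andP; split; last by lra.
  by rewrite lt_max; apply/orP; right; lra.
pose p := p0 + k *: u.
have sc := sin_gt0_frac c01.
have cpu : cross (p - x) u = s * (b * sin (pi * c)).
  rewrite /p /p0 /ray_pt; have -> : x + s *: dir a + k *: u - x = s *: dir a + k *: u.
    by apply: vecP; rewrite !coordE; ring.
  rewrite !lin crossvv mulr0 addr0; congr (_ * _).
  rewrite /u cross_dir_dir addrAC subrr add0r.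
  by case: b1 => ->; rewrite ?mul1r // mulN1r mulN1r mulNr sinN.
have pnx : p - x != 0.
  apply/eqP => e; move: cpu; rewrite e {1}/cross !coordE !mul0r subrr => /esym/eqP.
  by rewrite !mulf_eq0 (gt_eqF s0) (gt_eqF sc) (negbTE (sign_neq0 b1)).
have [rho [a' [rho0 _ _ pE]]] := polar pnx.
have rayE t : ray_pt a' t = sweep k (t / rho).
  by rewrite /sweep -/p pE scalerA divfK ?gt_eqF.
have visp : visible a' rho.
  move=> t /andP[t0 tr] Et; apply: goodk; exists (t / rho); last by rewrite -rayE.
  by rewrite divr_ge0 ?(ltW rho0) //= ler_pdivrMr // mul1r.
have pray : ray_pt a' rho = p by rewrite rayE divff ?gt_eqF // /sweep scale1r addrC subrK.
have exp : exit p (a + b * pi * c).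
  move=> t t0; rewrite /p -/u -addrA -scalerDl; apply: ex0.
  exact: addr_ge0.
have cau : 0 < b * cross (dir a') u.
  have e : rho * (b * cross (dir a') u) = s * sin (pi * c).
    transitivity (b * cross (p - x) u); first by rewrite pE !lin mulrCA.
    by rewrite cpu; case: b1 => ->; ring.
  by rewrite -(pmulr_rgt0 _ rho0) e mulr_gt0.
have [r r0 Er] := blocked a'.
have [s' ct' _] := contact_exists subEE oE closureEE firstE r0 Er.
have [s'0 cs' vis' smin'] := ct'.
exists a', s'.
(* If the closed set were not touched before [p], the segments for slightly larger [k'] would all
   miss [E], by compactness in [l], although [k] is the infimum of the bad positions. Only the end
   [l = 1] needs the normal at [p]. *)
have s'rho : s' < rho.
  rewrite ltNge; apply/negP => rs'.
  have cK : compact `[0 : R, 1]%classic by exact: segment_compact.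
  move/compact_near_coveringP: cK => /(_ _ (k^'+)
    (fun k' l => 0 <= l <= 1 -> k <= k' -> ~ E (sweep k' l))) h.
  suff /= [d /= d0 hd] : \forall k' \near k^'+, `[0, 1]%classic `<=`
      (fun l => 0 <= l <= 1 -> k <= k' -> ~ E (sweep k' l)).
    have [k' [k'0 [l l01 El]] k'd] := inf_adherent d0 hiS.
    have kk' : k <= k' by apply: ge_inf; [exact: hiS.2|split => //; exists l].
    have kk'n : k < k'.
      by rewrite lt_neqAle kk' andbT; apply/eqP => e; apply: goodk; rewrite e; exists l.
    apply: (hd k' _ kk'n l _ l01 kk' El); last by rewrite /= in_itv.
    by rewrite /ball /= ltr0_norm ?subr_lt0 // opprB; rewrite -/k in k'd; lra.
  apply: h => l /=; rewrite in_itv /= => /andP[l0 l1].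
  pose F2 : set_system (R * R) := @filter_prod R R (nbhs l) (nbhs k).
  have FP : Filter F2 by exact: filter_prod_filter.
  suff [[A B] /= [nA nB] AB] :
      \forall lk \near F2, 0 <= lk.1 <= 1 -> k <= lk.2 -> ~ E (sweep lk.2 lk.1).
    exists (A, B) => //; split => //=; exact: cvg_at_right_filter nB.
  have cv : sweep lk.2 lk.1 @[lk --> F2] --> sweep k l.
    by apply: sweep_cvg; [exact: cvg_snd|exact: cvg_fst].
  have [cE|ncE] := pselect (closure E (sweep k l)); last first.
    have n1 : \forall lk \near F2, ~ closure E (sweep lk.2 lk.1).
      exact: (@cvg_open _ _ F2 FP _ _ _ cv (closed_openC (@closed_closure _ E)) ncE).
    by apply: (@filterS _ F2 FP _ _ _ n1) => -[l' k'] /= nc _ _ /subset_closure.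
  have l1E : l = 1.
    apply/eqP; rewrite eq_le l1 leNgt; apply/negP => ll.
    apply: (smin' (l * rho)).
      rewrite mulr_ge0 ?(ltW rho0) //= (lt_le_trans _ rs') // gtr_pMl //.
    by rewrite rayE mulfK ?gt_eqF.
  have swp : sweep k 1 = p by rewrite /sweep scale1r addrC subrK.
  rewrite l1E swp in cE cv.
  have nEp : ~ E p by rewrite -pray; apply: visp; rewrite lexx ltW.
  have [g gp] := smooth cE nEp.
  have ga : dot g (dir a') <= 0.
    by rewrite -pray in gp cE; exact: visible_dot gp cE rho0 visp.
  have gu : 0 <= dot g u by exact: exit_dot gp cE exp.
  have c1 : lk.1 @[lk --> F2] --> (1 : R) by rewrite -l1E; exact: cvg_fst.
  have c2 : lk.2 @[lk --> F2] --> k by exact: cvg_snd.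
  have c3 : lk.1 * (lk.2 - k) @[lk --> F2] --> (0 : R).
    rewrite (_ : 0 = 1 * (k - k)); last by rewrite subrr mulr0.
    exact: (cvgM c1 (cvgB c2 (cvg_cst k))).
  have swE l' k' : sweep k' l' = x + l' *: (p - x) + (l' * (k' - k)) *: u.
    by rewrite /sweep /p; apply: vecP; rewrite !coordE; ring.
  have swE' l' k' : sweep k' l' = p + (l' * (k' - k)) *: u + (1 - l') *: (x - p).
    by rewrite /sweep /p; apply: vecP; rewrite !coordE; ring.
  (* If the segment grazes at [p], then [u] points strictly outwards and nearby points are outward
     shifts of points of the good segment. Otherwise [x - p] points strictly outwards and they are
     shifts of points of the exit. *)
  move: ga; rewrite le_eqVlt => /orP[/eqP ga|ga].
  - have gu' : 0 < dot g u.
      rewrite lt_neqAle gu andbT eq_sym; apply/eqP => gu0.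
      have [g0 _] := gp; move/eqP: g0; apply.
      have ct : cross (dir a') u != 0.
        by apply/eqP => e; move: cau; rewrite e mulr0 ltxx.
      move: ga gu0 ct; rewrite /dot /cross; move: (dir a') u => e v ge gv ct.
      apply: vecP; rewrite coordE; apply: (mulIf ct); rewrite mul0r.
      + transitivity ((g 0 0 * e 0 0 + g 0 1 * e 0 1) * v 0 1 - (g 0 0 * v 0 0 + g 0 1 * v 0 1) * e 0 1); first by ring.
        by rewrite ge gv; ring.
      + transitivity ((g 0 0 * v 0 0 + g 0 1 * v 0 1) * e 0 0 - (g 0 0 * e 0 0 + g 0 1 * e 0 1) * v 0 0); first by ring.
        by rewrite ge gv; ring.
    have [d d0 hd] := half_plane_out gp gu'.
    have cz : x + lk.1 *: (p - x) @[lk --> F2] --> x + 1 *: (p - x).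
      by apply: cvgD; [exact: cvg_cst|exact: cvgZr_tmp].
    rewrite scale1r [x + _]addrC subrK in cz.
    have n1 := @cvgr_distC_lt _ _ _ F2 FP _ _ cz _ d0.
    have n2 := @cvgr_lt R _ F2 FP _ _ c3 _ d0.
    have n3 := @cvgr_gt R _ F2 FP _ _ c1 _ ltr01.
    apply: (@filterS3 _ F2 FP _ _ _ _ _ n1 n2 n3) => -[l' k'] /= h1 h2 h3 /andP[l'0 l'1] kk'.
    rewrite swE.
    have ny : ~ E (x + l' *: (p - x)).
      by move=> Ey; apply: goodk; exists l'; [rewrite l'0|].
    have := kk'; rewrite le_eqVlt => /orP[/eqP <-|kk'n]; first by rewrite subrr mulr0 scale0r addr0.
    move=> /subset_closure; apply: (hd _ _ h1) => //.
    by rewrite h2 mulr_gt0 // subr_gt0.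
  - have gw : 0 < dot g (x - p).
      by rewrite -opprB dotNr pE dotZr oppr_gt0 pmulr_rlt0.
    have [d d0 hd] := half_plane_out gp gw.
    have cz : p + (lk.1 * (lk.2 - k)) *: u @[lk --> F2] --> p + (0 : R) *: u.
      by apply: cvgD; [exact: cvg_cst|exact: cvgZr_tmp].
    rewrite scale0r addr0 in cz.
    have c4 : (1 - lk.1) @[lk --> F2] --> (1 - 1 : R) by exact: (cvgB (cvg_cst (1 : R)) c1).
    rewrite subrr in c4.
    have n1 := @cvgr_distC_lt _ _ _ F2 FP _ _ cz _ d0.
    have n2 := @cvgr_lt R _ F2 FP _ _ c4 _ d0.
    apply: (@filterS2 _ F2 FP _ _ _ _ n1 n2) => -[l' k'] /= h1 h2 /andP[l'0 l'1] kk'.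
    rewrite swE'.
    have ny : ~ E (p + (l' * (k' - k)) *: u).
      by apply: exp; rewrite mulr_ge0 // subr_ge0.
    have := l'1; rewrite le_eqVlt => /orP[/eqP l'e|l'n]; first by rewrite {2}l'e subrr scale0r addr0.
    move=> /subset_closure; apply: (hd _ _ h1) => //.
    by rewrite subr_gt0 l'n.
split => //.
(* For [k = 0] the new contact would precede the original first contact on the same ray. *)
have kpos : 0 < k.
  rewrite lt_neqAle k0 andbT eq_sym; apply/eqP => kz.
  apply: (smin (s' / rho * s)).
    rewrite mulr_ge0 ?divr_ge0 ?(ltW s'0) ?(ltW s0) ?(ltW rho0) //= gtr_pMl //.
    by rewrite ltr_pdivrMr // mul1r.
  move: cs'; rewrite rayE kz /sweep /p0 /ray_pt scale0r addr0.
  by congr closure; apply: vecP; rewrite !coordE; ring.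
have cE' := closureME subEE cs'.
have nE' : ~ E (ray_pt a' s') by apply: vis'; rewrite lexx ltW.
have [g' gp'] := smooth cE' nE'.
(* Otherwise [E] would contain points of the segment between the contact and [p]. *)
have ga0 : dot g' (dir a') = 0.
  apply/eqP; rewrite eq_le (visible_dot gp' cE' s'0 vis') /= leNgt; apply/negP => ga.
  have [d d0 hd] := half_plane_in gp' cE' ga.
  pose t := Num.min (d / 2) (rho - s').
  have t0 : 0 < t by rewrite lt_min divr_gt0 //= subr_gt0.
  have td : t < d by rewrite gt_min; apply/orP; left; lra.
  have tr : t <= rho - s' by rewrite ge_min lexx orbT.
  apply: (visp (s' + t)); first by apply/andP; split; lra.
  rewrite /ray_pt scalerDl addrA; apply: hd; first by rewrite subrr normr0.
  by rewrite t0.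
have [ex|//] : side_exit b a' s' \/ side_exit (- b) a' s'.
  have := side_exit_exists cE' vis' (ltW s'0).
  by case: b1 => ->; rewrite ?opprK => -[]; tauto.
exfalso.
have gn := tangent_side b1 gp' cE' ga0 ex.
have gu : 0 < dot g' u.
  have e : dot g' u = (b * dot g' (dir (a' + pi / 2))) * (b * cross (dir a') u).
    have nu : dot (dir (a' + pi / 2)) u = cross (dir a') u.
      by rewrite /dot /cross !coordE cosDpihalf sinDpihalf; ring.
    rewrite {1}(dot_frame g' a') ga0 scale0r add0r.
    transitivity (dot g' (dir (a' + pi / 2)) * dot (dir (a' + pi / 2)) u).
      by rewrite /dot !coordE; ring.
    by rewrite nu; case: b1 => ->; ring.
  by rewrite e mulr_gt0.
have [|d d0 hd] := half_plane_in gp' cE' (w := - u); first by rewrite dotNr oppr_lt0.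
pose l := s' / rho.
have l0 : 0 < l by rewrite divr_gt0.
have l1 : l < 1 by rewrite ltr_pdivrMr // mul1r.
pose t := Num.min k d / 2.
have m0 : 0 < Num.min k d by rewrite lt_min kpos.
have t0 : 0 < t by rewrite divr_gt0.
have : t < Num.min k d by rewrite ltr_pdivrMr // ltr_pMr // ltr1n.
rewrite lt_min => /andP[tk td].
(* Moving the contact by a multiple of [- u] leads into [E] at a position already known to be
   good. *)
apply: (good (k - t)); [by rewrite subr_ge0 ltW|by rewrite ltrBlDr ltrDl|].
exists l; first by rewrite !ltW.
have -> : sweep (k - t) l = ray_pt a' s' + (l * t) *: - u.
  by rewrite rayE -/l /sweep; apply: vecP; rewrite !coordE; ring.
apply: hd; first by rewrite subrr normr0.
by rewrite mulr_gt0 //= (lt_trans _ td) // gtr_pMl.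
Qed.

End Sweep.

Lemma wedge_all : exists a W, wedge_spec W a /\ exists2 z, E z & ~ W z.
Proof.
have both b a s : b = 1 \/ b = -1 -> contact E a s -> side_exit b a s ->
    exists a' s', contact E a' s' /\ side_exit (- b) a' s'.
  by move=> b1 ct [c c01 ex]; exact: (sweep_contact b1 c01 ex ct).
have [r r0 Er] := blocked 0.
have [s ct _] := contact_exists subEE oE closureEE firstE r0 Er.
have [[a1 [s1 [ct1 ex1]]] [a2 [s2 [ct2 ex2]]]] :
    (exists a s, contact E a s /\ side_exit (-1) a s) /\
    (exists a s, contact E a s /\ side_exit 1 a s).
  have [s0 /(closureME subEE) cs vis _] := ct.
  have [ex|ex] := side_exit_exists cs vis (ltW s0).
  - by split; [apply: both ex => //; left|exists 0, s].
  - by split; [exists 0, s|rewrite -[1]opprK; apply: both ex => //; right].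
(* The second direction is shifted by full turns so that it comes after [a1]. *)
have [a3 [a31 a32 a23]] := dir_norm (a1 + pi *+ 2) a2.
have rayE t : ray_pt a3 t = ray_pt a2 t by rewrite /ray_pt a23.
have ct3 : contact E a3 s2.
  have [h1 h2 h3 h4] := ct2; split; first exact: h1.
  - by rewrite rayE; exact: h2.
  - by move=> t th; rewrite rayE; exact: h3.
  - by move=> t th; rewrite rayE; exact: h4.
have ex3 : side_exit 1 a3 s2.
  have [c c01 ex] := ex2; exists c => // t t0.
  by rewrite rayE (dir_add _ (esym a23)); exact: ex.
have pi0 := pi_gt0 R.
have [||a [t [ct4 e1 e2]]] := transition subEE oE closureEE firstE _ _ ct1 ex1 ct3 ex3.
- by move: a31; rewrite mulr2n addrA addrK => h; lra.
- by move=> b _; exact: blocked.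
by have [W hW] := wedge_exists subEE oE closureEE ct4 e1 e2; exists a, W.
Qed.

End Rays.

(** * Separating the components by sectors *)

Section Components.
Context {R : realType}.
Local Notation V := 'rV[R]_2.
Implicit Types (p q u v w y z g : V) (a b c r s t : R) (A B C D Y : set V).

Section Basic.
Variable E : set V.

Lemma components_connected A : components E A -> connected A.
Proof. by move=> [z Ez <-]; exact: component_connected. Qed.

Lemma component_sub A : components E A -> A `<=` E.
Proof. by move=> [z Ez <-]; exact: connected_component_sub. Qed.

Lemma component_of z : E z -> exists2 A, components E A & A z.
Proof.
by move=> Ez; exists (connected_component E z); [exists z|exact: connected_component_refl].
Qed.

Lemma component_eq A B z : components E A -> components E B -> A z -> B z -> A = B.
Proof.
move=> [a Ea <-] [b Eb <-] az bz.
by rewrite (same_connected_component az) (same_connected_component bz).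
Qed.

Lemma component_max A S z : components E A -> connected S -> S `<=` E -> A z -> S z -> S `<=` A.
Proof.
move=> [a Ea <-] cS SE az Sz; rewrite (same_connected_component az).
exact: connected_component_max.
Qed.

Lemma component_nonempty A : components E A -> exists z, A z.
Proof. by move=> [z Ez <-]; exists z; exact: connected_component_refl. Qed.

Hypothesis oE : open E.

Lemma component_open A : components E A -> open A.
Proof.
move=> cA; rewrite openE => z Az.
have [d d0 hd] := open_normE oE (component_sub cA Az).
apply: (norm_nbhs d0) => z' z'z.
have sE : seg z z' `<=` E.
  by move=> y yz; apply: hd; apply: seg_ball yz => //; rewrite subrr normr0.
exact: (component_max cA (@seg_connected _ z z') sE Az (@segL _ z z') (@segR _ z z')).
Qed.

Lemma component_closure A : components E A -> closure A `&` E `<=` A.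
Proof.
move=> cA z [cz Ez]; have [B cB Bz] := component_of Ez.
have [y [Ay By]] := cz B (open_nbhs_nbhs (conj (component_open cB) Bz)).
by rewrite (component_eq cA cB Ay By).
Qed.

End Basic.

Lemma sin_le0_pi2 a : pi <= a -> a <= pi *+ 2 -> sin a <= 0.
Proof.
move=> a1 a2; rewrite -[a](subrK pi) sinDpi oppr_le0; apply: sin_ge0_pi.
by rewrite subr_ge0 a1 lerBlDr -mulr2n.
Qed.

Lemma sin_lt0_pi2 a : pi < a -> a < pi *+ 2 -> sin a < 0.
Proof.
move=> a1 a2; rewrite -[a](subrK pi) sinDpi oppr_lt0; apply: sin_gt0_pi.
by rewrite subr_gt0 a1 ltrBlDr -mulr2n.
Qed.

Lemma sin_gt0_lt_pi a : 0 < sin a -> a < pi *+ 2 -> a < pi.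
Proof.
move=> s0 a2; rewrite ltNge; apply/negP => a1.
by have := sin_le0_pi2 a1 (ltW a2); rewrite leNgt s0.
Qed.

Variables (E : set V) (x : V).
Local Notation ray_pt := (ray_pt x).
Local Notation hits := (hits x).
Hypothesis oE : open E.
Hypothesis blocked : forall a, exists2 s : R, 0 <= s & E (ray_pt a s).
Hypothesis nEx : ~ E x.
Hypothesis weak : forall p, closure E p -> ~ E p -> exists a, exit E p a.
Hypothesis smooth : forall p, closure E p -> ~ E p -> exists g, half_plane_at E p g.

Lemma hits_dir A a b : dir a = dir b :> V -> hits A a -> hits A b.
Proof. by move=> e [s s0 As]; exists s => //; rewrite ray_ptE -e. Qed.

Lemma hits_some A : A `<=` E -> (exists z, A z) -> exists a, hits A a.
Proof.
move=> AE [z Az]; have zx : z - x != 0.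
  by apply/eqP => e; apply: nEx; apply: AE; rewrite -(subrK x z) e add0r in Az.
have [r [a [r0 _ _ e]]] := polar zx.
by exists a, r; [exact: ltW|rewrite ray_ptE -e addrC subrK].
Qed.

Lemma ray_pt_gt0 a s : 0 <= s -> E (ray_pt a s) -> 0 < s.
Proof.
move=> s0 Es; rewrite lt_neqAle s0 andbT eq_sym; apply/eqP => e.
by apply: nEx; rewrite -(ray_pt0 x a) -e.
Qed.

Lemma hits_open A a : open A -> hits A a -> \forall a' \near a, hits A a'.
Proof.
move=> oA [s s0 As].
have cv : ray_pt a' s @[a' --> a] --> ray_pt a s.
  by apply: cvg_ray_pt; [exact: cvg_id|exact: cvg_cst].
have n : \forall a' \near a, A (ray_pt a' s) by exact: (cvg_open cv oA As).
by apply: filterS n => a' Aa'; exists s.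
Qed.

Lemma ray_sector a s d e : 0 < s -> sector x (dir d) (dir e) (ray_pt a s) <->
  0 < sin (a - d) /\ 0 < sin (e - a).
Proof.
move=> s0; rewrite /sector /= ray_ptE addrAC subrr add0r !lin !cross_dir_dir.
by rewrite !pmulr_rgt0.
Qed.

(** If [b] were missed, the rays from [x] in directions [a0] and [b] would separate the points of
    [A] seen in directions [a] and [c]. *)
Lemma hits_convex A a0 a b c : connected A -> A `<=` E -> ~ hits A a0 ->
  a0 < a -> a < b -> b < c -> c < a0 + pi *+ 2 -> hits A a -> hits A c -> hits A b.
Proof.
move=> cA AE n0 a0a ab bc c2 [s s0 As] [t t0 At]; apply: contrapT => nb.
have sp := ray_pt_gt0 s0 (AE _ As); have tp := ray_pt_gt0 t0 (AE _ At).
have m0 r : 0 <= r -> ~ A (x + r *: dir a0) by move=> r0 Ar; apply: n0; exists r.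
have mb r : 0 <= r -> ~ A (x + r *: dir b) by move=> r0 Ar; apply: nb; exists r.
have pi0 := pi_gt0 R.
(* Of the two sectors cut out by these rays, the one of angle at most pi is used. *)
have [bpi|bpi] := leP (b - a0) pi.
- have ang : convex_angle (dir a0 : V) (dir b).
    move: bpi; rewrite le_eqVlt => /orP[/eqP e|bpi].
      right; split; [exact: dir_neq0|exists 1 => //].
      by rewrite scaleN1r -dirDpi -e addrC subrK.
    by left; rewrite cross_dir_dir; apply: sin_gt0_pi; rewrite bpi subr_gt0 (lt_trans a0a ab).
  have inA : sector x (dir a0) (dir b) (ray_pt a s).
    by apply/ray_sector => //; split; apply: sin_gt0_pi; apply/andP; split; lra.
  have [AS|AS] := sector_connected cA ang m0 mb.
  + have /(ray_sector _ _ _ tp)[h1 h2] := AS _ At.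
    have h3 : c - a0 < pi by apply: sin_gt0_lt_pi => //; lra.
    have : 0 < sin (c - b) by apply: sin_gt0_pi; apply/andP; split; lra.
    by move: h2; rewrite -opprB sinN; lra.
  + suff : (A `&` sector x (dir a0) (dir b)) (ray_pt a s) by rewrite AS.
    by split.
- have ang : convex_angle (dir b : V) (dir a0).
    left; rewrite cross_dir_dir -opprB sinN oppr_gt0; apply: sin_lt0_pi2 => //.
    by lra.
  have inA : sector x (dir b) (dir a0) (ray_pt c t).
    apply/ray_sector => //; split; first by apply: sin_gt0_pi; apply/andP; split; lra.
    by rewrite -opprB sinN oppr_gt0; apply: sin_lt0_pi2; lra.
  have [AS|AS] := sector_connected cA ang mb m0.
  + have /(ray_sector _ _ _ sp)[h1 h2] := AS _ As.
    have h3 : pi < a - a0.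
      rewrite ltNge; apply/negP => h3.
      have : 0 <= sin (a - a0) by apply: sin_ge0_pi; apply/andP; split; lra.
      by move: h2; rewrite -opprB sinN; lra.
    have : 0 < sin (b - a) by apply: sin_gt0_pi; apply/andP; split; lra.
    by move: h1; rewrite -opprB sinN; lra.
  + suff : (A `&` sector x (dir b) (dir a0)) (ray_pt c t) by rewrite AS.
    by split.
Qed.

(** At the first direction that misses [M] the ray meets some component [Y]. Since [Y] is open, it
    is also hit slightly earlier, where [M] is still hit. *)
Lemma shadow_end M b a k : b = 1 \/ b = -1 -> open M -> hits M a -> 0 < k -> ~ hits M (a + b * k) ->
  exists t, [/\ 0 < t, t <= k, ~ hits M (a + b * t) &
    exists2 Y, components E Y & hits Y (a + b * t) /\ exists2 c, hits Y c & hits M c].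
Proof.
move=> b1 oM hM k0 nk.
pose S := [set t | 0 <= t <= k /\ ~ hits M (a + b * t)].
have Sk : S k by split => //; rewrite ltW //=.
have hiS : has_inf S by split; [exists k|exists 0 => t [/andP[]]].
have cv r : (a + b * t) @[t --> r] --> a + b * r.
  exact: (cvgD (cvg_cst a) (cvgM (cvg_cst b) (@cvg_id _ _))).
pose t := inf S.
have t0 : 0 <= t by apply: lb_le_inf; [exists k|move=> r [/andP[]]].
have tk : t <= k by apply: ge_inf => //; case: hiS.
have nt : ~ hits M (a + b * t).
  move=> /(hits_open oM) /(cv t) /nbhs_ballP[d /= d0 hd].
  have [r Sr rt] := inf_adherent d0 hiS.
  case: (Sr) => _; apply; apply: hd; rewrite /ball /= ler0_norm ?subr_le0 ?opprB.
    by rewrite -/t in rt; lra.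
  by apply: ge_inf Sr; case: hiS.
have tpos : 0 < t.
  rewrite lt_neqAle t0 andbT eq_sym; apply/eqP => e.
  by apply: nt; rewrite e mulr0 addr0.
exists t; split => //.
have [r r0 Er] := blocked (a + b * t).
have [Y cY Yr] := component_of Er.
exists Y => //; split; first by exists r.
have hY : hits Y (a + b * t) by exists r.
have /(cv t) /nbhs_ballP[d /= d0 hd] := hits_open (component_open oE cY) hY.
pose r' := Num.max 0 (t - d / 2).
have r't : r' < t by rewrite gt_max tpos; lra.
have r'0 : 0 <= r' by rewrite le_max lexx.
exists (a + b * r').
  apply: hd; rewrite /ball /= ltr_distlC; apply/andP; split; last by lra.
  by rewrite lt_max; apply/orP; right; lra.
apply: contrapT => nr'.
have : S r' by split => //; rewrite r'0; lra.
by move=> /(ge_inf hiS.2); rewrite -/t leNgt r't.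
Qed.

Lemma wedge_dichotomy W a A : wedge_spec E x W a -> components E A -> A `<=` W \/ A `&` W = set0.
Proof. by move=> [h _ _ _] cA; apply: h; [exact: components_connected cA|exact: component_sub]. Qed.

Lemma wedge_out W a A z : wedge_spec E x W a -> components E A -> A z -> ~ W z -> A `&` W = set0.
Proof. by move=> hW cA Az nW; have [h|//] := wedge_dichotomy hW cA; case: nW; exact: h. Qed.

Lemma wedge_in W a A z : wedge_spec E x W a -> components E A -> A z -> W z -> A `<=` W.
Proof.
move=> hW cA Az Wz; have [//|h] := wedge_dichotomy hW cA.
by suff : (A `&` W) z by rewrite h.
Qed.

Lemma wedge_behind W a : wedge_spec E x W a ->
  exists2 A, components E A & A `<=` W /\ hits A (a + pi).
Proof.
move=> hW; have [_ _ w3 _] := hW.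
have [r r0 Er] := blocked (a + pi); have [A cA Ar] := component_of Er.
exists A => //; split; last by exists r.
exact: (wedge_in hW cA Ar (w3 r r0)).
Qed.

Lemma wedge_miss W a A : wedge_spec E x W a -> components E A -> A `<=` W -> ~ hits A a.
Proof.
move=> [_ _ _ w4] cA AW [s s0 As]; apply: (w4 s s0); last exact: AW.
exact: (component_sub cA).
Qed.

Lemma wedge_miss_behind W a A : wedge_spec E x W a -> A `&` W = set0 -> ~ hits A (a + pi).
Proof.
move=> [_ _ w3 _] AW [s s0 As].
suff : (A `&` W) (ray_pt (a + pi) s) by rewrite AW.
by split => //; exact: w3.
Qed.

(** A ray from [x] stays in [W] up to any of its points in [W]. *)
Lemma wedge_order W a A B c s t : wedge_spec E x W a -> A `<=` W -> B `&` W = set0 ->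
  0 <= t -> A (ray_pt c s) -> B (ray_pt c t) -> s < t.
Proof.
move=> [_ w2 _ _] AW BW t0 As Bt; rewrite ltNge; apply/negP => ts.
suff : (B `&` W) (ray_pt c t) by rewrite BW.
by split => //; apply: (w2 _ s) => //; [rewrite t0|exact: AW].
Qed.

(** This is the hypothesis [firstM] for a single component. *)
Definition front A := forall a s t, 0 <= s -> 0 <= t ->
  A (ray_pt a s) -> E (ray_pt a t) -> ~ A (ray_pt a t) -> s < t.

Definition overlap A B := exists2 a, hits A a & hits B a.

(** On a common ray the sector puts [A] before [B], while [front B] puts [B] before [A]. *)
Lemma in_wedge_no_overlap W a A B : wedge_spec E x W a -> components E A -> components E B ->
  front B -> A `<=` W -> B `&` W = set0 -> ~ overlap A B.
Proof.
move=> hW cA cB fB AW BW [c [s s0 As] [t t0 Bt]].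
have st := wedge_order hW AW BW t0 As Bt.
have : t < s.
  apply: (fB c t s) => //; first exact: (component_sub cA).
  move=> Bs; suff : (B `&` W) (ray_pt c s) by rewrite BW.
  by split => //; exact: AW.
by lra.
Qed.

Lemma component_wedge B : components E B -> front B -> (exists a, ~ hits B a) ->
  exists a W, wedge_spec E x W a /\ B `&` W = set0.
Proof.
move=> cB fB [a0 n0]; have BE := component_sub cB.
have [||a [W [hW [z Bz nWz]]]] := wedge_of_gap oE blocked nEx weak smooth BE (component_open oE cB)
  (@component_closure _ oE _ cB) fB n0.
- by apply: hits_some => //; exact: component_nonempty cB.
- by move=> a b c *; exact: (@hits_convex B a0 a b c (components_connected cB)).
by exists a, W; split => //; exact: wedge_out hW cB Bz nWz.
Qed.

Lemma past a a0 : exists2 k, 0 < k <= pi *+ 2 & dir a0 = dir (a + k) :> V.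
Proof.
have [c [c1 c2 e]] := dir_norm (a + pi) a0.
exists (c - a); last by rewrite addrC subrK.
by move: c1 c2; rewrite addrK mulr2n -addrA => c1 c2; apply/andP; split; lra.
Qed.

Lemma overlap_end B : components E B -> (exists a, ~ hits B a) ->
  exists2 Y, components E Y & Y <> B /\ overlap Y B.
Proof.
move=> cB [a0 n0].
have [a ha] := hits_some (component_sub cB) (component_nonempty cB).
have [k /andP[k0 _] e] := past a a0.
have [|t [_ _ nt [Y cY [hY [c hYc hBc]]]]] := shadow_end (or_introl (erefl 1)) (component_open oE cB) ha k0.
  by rewrite mul1r => h; apply: n0; exact: hits_dir (esym e) h.
exists Y => //; split; last by exists c.
by move=> YB; apply: nt; rewrite -YB.
Qed.

(** * At most three components cannot block all rays from [x] *)

Hypothesis not4 : forall A B C D, components E A -> components E B -> components E C ->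
  components E D -> A <> B -> A <> C -> B <> C -> [\/ D = A, D = B | D = C].

(** A front component with a gap forces exactly three components: [B], a component [A] behind the
    apex direction of the sector of [B], and a component [Y] overlapping [B]. Then [A] is itself
    front with a gap, and its shadow is bordered on both sides by that of [Y]. The shadow of [Y]
    would have to cross a direction that [Y] misses. *)
Lemma front_absurd B : components E B -> front B -> (exists a, ~ hits B a) -> False.
Proof.
move=> cB fB gB.
have [aB [WB [hWB BW]]] := component_wedge cB fB gB.
have [A cA [AW hA]] := wedge_behind hWB.
have nAB : ~ overlap A B by exact: in_wedge_no_overlap hWB cA cB fB AW BW.
have AB : A <> B.
  move=> e; have [z Az] := component_nonempty cA.
  suff : (B `&` WB) z by rewrite BW.
  by split; [rewrite -e|exact: AW].
have [Y cY [YB oY]] := overlap_end cB gB.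
have YW : Y `&` WB = set0.
  have [h|//] := wedge_dichotomy hWB cY.
  by exfalso; exact: in_wedge_no_overlap hWB cY cB fB h BW oY.
have AY : A <> Y.
  by move=> e; apply: nAB; rewrite e.
have only D : components E D -> [\/ D = A, D = B | D = Y].
  by move=> cD; apply: not4 => // e; exact: YB.
have fA : front A.
  (* Both other components lie outside [WB], and [A] lies inside it. *)
  move=> a s t s0 t0 As Et nAt; have [D cD Dt] := component_of Et.
  apply: (wedge_order hWB AW _ t0 As Dt).
  by have [e|->//|->//] := only D cD; case: nAt; rewrite -e.
have gA : exists a, ~ hits A a by exists aB; exact: wedge_miss hWB cA AW.
have [aA [WA [hWA AWA]]] := component_wedge cA fA gA.
have oYA Y1 : components E Y1 -> Y1 <> A -> overlap Y1 A -> Y1 = Y.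
  move=> cY1 Y1A oY1; have [//|e|//] := only Y1 cY1.
  by case: nAB; have [c h1 h2] := oY1; exists c => //; rewrite -e.
have oY' : overlap Y A.
  have [Y1 cY1 [Y1A oY1]] := overlap_end cA gA.
  by rewrite -(oYA Y1).
have YWA : Y `&` WA = set0.
  have [h|//] := wedge_dichotomy hWA cY.
  by exfalso; exact: in_wedge_no_overlap hWA cY cA fA h AWA oY'.
have nYA := wedge_miss_behind hWA YWA.
have nAA := wedge_miss_behind hWA AWA.
have nYB := wedge_miss_behind hWB YW.
have [k /andP[k0 k2] ek] := past (aA + pi) (aB + pi).
set th := aA + pi + k in ek.
have hAth : hits A th by exact: hits_dir ek hA.
have k2' : k < pi *+ 2.
  rewrite lt_neqAle k2 andbT; apply/eqP => e; apply: nAA.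
  by apply: hits_dir hAth; rewrite /th e dirD2pi.
(* Only [Y] overlaps [A], so the component met where the shadow of [A] ends is [Y]. *)
have Yend b l : b = 1 \/ b = -1 -> 0 < l -> ~ hits A (th + b * l) ->
    exists t, [/\ 0 < t, t <= l & hits Y (th + b * t)].
  move=> b1 l0 nl.
  have [t [t0 tl nt [Y1 cY1 [hY1 [c hc1 hc2]]]]] := shadow_end b1 (component_open oE cA) hAth l0 nl.
  exists t; split => //; rewrite -(oYA Y1) //; last by exists c.
  by move=> e; apply: nt; rewrite -e.
have [|t1 [t10 t1k h1]] := Yend (-1) k (or_intror erefl) k0.
  by rewrite mulN1r /th addrK.
have [||t2 [t20 t2k h2]] := Yend 1 (pi *+ 2 - k) (or_introl erefl).
- by rewrite subr_gt0.
- rewrite mul1r => h; apply: nAA; apply: hits_dir h.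
  by rewrite (_ : th + _ = aA + pi + pi *+ 2) ?dirD2pi // /th; ring.
rewrite mulN1r in h1; rewrite mul1r in h2.
apply: nYB; apply: (hits_dir (esym ek)).
have t1n : t1 != k.
  by apply/eqP => e; apply: nYA; apply: hits_dir h1; rewrite e /th addrK.
have t2n : t2 != pi *+ 2 - k.
  apply/eqP => e; apply: nYA; apply: hits_dir h2; rewrite e /th.
  by rewrite (_ : _ + _ = aA + pi + pi *+ 2) ?dirD2pi //; ring.
have t1l : t1 < k by rewrite lt_neqAle t1n.
have t2l : t2 < pi *+ 2 - k by rewrite lt_neqAle t2n.
(* [Y] misses [aA + pi] and is hit on both sides of [th], so it would be hit at [th], the direction
   opposite to [aB], which [nYB] forbids. *)
apply: (@hits_convex Y (aA + pi) (th - t1) th (th + t2)) => //.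
- exact: components_connected cY.
- exact: component_sub cY.
- by rewrite /th; lra.
- by lra.
- by lra.
- by rewrite /th; lra.
Qed.

(** The sector of the whole of [E] leaves out a component [C0] and contains a component [B]. If [B]
    is not front, a third component [B'] precedes it on some ray. The sector of [B] united with [B']
    then either makes one of them front or puts [C0] before both, against the first sector. *)
Lemma trapped_absurd : False.
Proof.
have [a0 [W0 [hW0 [z0 Ez0 nz0]]]] := wedge_all oE blocked nEx weak smooth.
have [C0 cC0 C0z] := component_of Ez0.
have C0W := wedge_out hW0 cC0 C0z nz0.
have notC A : A `<=` W0 -> (exists z, A z) -> A <> C0.
  move=> AW [z Az] e; suff : (C0 `&` W0) z by rewrite C0W.
  by split; [rewrite -e|exact: AW].
have [B cB [BW hB]] := wedge_behind hW0.
have gap A : components E A -> A `<=` W0 -> exists a, ~ hits A a.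
  by move=> cA AW; exists a0; exact: wedge_miss hW0 cA AW.
have [fB|nfB] := pselect (front B); first exact: front_absurd cB fB (gap _ cB BW).
have [a [s [t [[s0 t0 Bs Et] [nBt ts]]]]] : exists a s t,
    [/\ 0 <= s, 0 <= t, B (ray_pt a s) & E (ray_pt a t)] /\ ~ B (ray_pt a t) /\ t <= s.
  apply: contrapT => nex; apply: nfB => a s t s0 t0 Bs Et nBt; rewrite ltNge; apply/negP => ts.
  by apply: nex; exists a, s, t.
have [B' cB' Bt] := component_of Et.
have BB' : B <> B' by move=> e; apply: nBt; rewrite e.
have W0t : W0 (ray_pt a t).
  by have [_ w2 _ _] := hW0; apply: (w2 _ s) => //; [rewrite t0|exact: BW].
have B'W := wedge_in hW0 cB' Bt W0t.
have BC : B <> C0 by apply: notC => //; exact: component_nonempty cB.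
have B'C : B' <> C0 by apply: notC => //; exact: component_nonempty cB'.
have only D : components E D -> [\/ D = B, D = B' | D = C0].
  by move=> cD; apply: not4.
pose M := B `|` B'.
have ME : M `<=` E by move=> z [] ?; [exact: (component_sub cB)|exact: (component_sub cB')].
have oM : open M by apply: openU; [exact: component_open cB|exact: component_open cB'].
have cM : closure M `&` E `<=` M.
  move=> z []; rewrite closureU => -[cz|cz] Ez; [left|right].
  - by apply: (component_closure oE cB).
  - by apply: (component_closure oE cB').
have MW z : M z -> W0 z by case=> h; [exact: BW|exact: B'W].
have firstM c r l : 0 <= r -> 0 <= l -> M (ray_pt c r) -> E (ray_pt c l) -> ~ M (ray_pt c l) -> r < l.
  move=> r0 l0 Mr El nMl; have [D cD Dl] := component_of El.
  have DC : D = C0.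
    by have [e|e|//] := only D cD; case: nMl; [left|right]; rewrite -e.
  have [Br|B'r] := Mr.
  - by apply: (wedge_order hW0 BW _ l0 Br Dl); rewrite DC.
  - by apply: (wedge_order hW0 B'W _ l0 B'r Dl); rewrite DC.
have nhM : ~ hits M a0.
  by move=> [r r0 [h|h]]; [apply: (wedge_miss hW0 cB BW)|apply: (wedge_miss hW0 cB' B'W)]; exists r.
have hitsM c : hits M c -> hits B c \/ hits B' c.
  by move=> [r r0 [h|h]]; [left|right]; exists r.
have hBM c : hits B c -> hits M c by move=> [r r0 h]; exists r => //; left.
have hB'M c : hits B' c -> hits M c by move=> [r r0 h]; exists r => //; right.
have [k /andP[k0 k2] ek] := past a0 a.
set th := a0 + k in ek.
have hBth : hits B th by apply: hits_dir ek _; exists s.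
have hB'th : hits B' th by apply: hits_dir ek _; exists t.
have k2' : k < pi *+ 2.
  rewrite lt_neqAle k2 andbT; apply/eqP => e; apply: nhM.
  by apply: hits_dir (hBM _ hBth); rewrite /th e dirD2pi.
have convB := fun b1 b2 b3 => @hits_convex B a0 b1 b2 b3 (components_connected cB) (component_sub cB)
  (wedge_miss hW0 cB BW).
have convB' := fun b1 b2 b3 => @hits_convex B' a0 b1 b2 b3 (components_connected cB') (component_sub cB')
  (wedge_miss hW0 cB' B'W).
(* The shadows of [B] and [B'] are intervals with the common direction [th], so their union is an
   interval. *)
have conv b1 b2 b3 : a0 < b1 -> b1 < b2 -> b2 < b3 -> b3 < a0 + pi *+ 2 ->
    hits M b1 -> hits M b3 -> hits M b2.
  move=> h1 h2 h3 h4 /hitsM m1 /hitsM m3.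
  have th1 : a0 < th by rewrite /th; lra.
  have th2 : th < a0 + pi *+ 2 by rewrite /th; lra.
  have [lt|gt|e] := ltgtP b2 th; last by rewrite e; exact: hBM.
  - case: m1 => m1; [apply: hBM; exact: (convB b1 b2 th)|apply: hB'M; exact: (convB' b1 b2 th)].
  - case: m3 => m3; [apply: hBM; apply: (convB th b2 b3)|apply: hB'M; apply: (convB' th b2 b3)] => //.
have [||aM [WM [hWM [z Mz nWz]]]] := wedge_of_gap oE blocked nEx weak smooth ME oM cM firstM nhM.
- by exists th; exact: hBM.
- exact: conv.
have [k' /andP[k'0 _] ek'] := past th a0.
(* Where the shadow of [M] ends, the only remaining component is [C0]. *)
have oC : exists2 c, hits C0 c & hits M c.
  have [|r [_ _ nr [Y cY [hY hYM]]]] := shadow_end (or_introl (erefl 1)) oM (hBM _ hBth) k'0.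
    by rewrite mul1r => h; apply: nhM; exact: hits_dir (esym ek') h.
  have [e|e|<-//] := only Y cY; case: nr; rewrite -e in cB cB' *.
  - by apply: hBM; rewrite -e.
  - by apply: hB'M; rewrite -e.
(* Symmetric form in [B] and [B']: [B1] is the one that contains a point outside [WM]. *)
have main B1 B2 : components E B1 -> components E B2 -> B1 `<=` W0 -> B2 `<=` W0 ->
    (forall c, hits M c -> hits B1 c \/ hits B2 c) ->
    (forall D, components E D -> [\/ D = B1, D = B2 | D = C0]) -> B1 z -> False.
  move=> cB1 cB2 B1W B2W hM only' B1z.
  have B1M := wedge_out hWM cB1 B1z nWz.
  (* If [B2] lies in [WM], it precedes [B1] by [WM] and [C0] by [W0], hence is front. Otherwise only
     [C0] can lie in [WM], which reverses the order of [W0] on a common ray. *)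
  have [B2M|B2M] := wedge_dichotomy hWM cB2.
    apply: (front_absurd cB2 _ (gap _ cB2 B2W)) => c r l r0 l0 B2r El nB2l.
    have [D cD Dl] := component_of El.
    have [e|e|e] := only' D cD.
    - by apply: (wedge_order hWM B2M _ l0 B2r Dl); rewrite e.
    - by case: nB2l; rewrite -e.
    - by apply: (wedge_order hW0 B2W _ l0 B2r Dl); rewrite e.
  have [D cD [DW _]] := wedge_behind hWM.
  have [y Dy] := component_nonempty cD.
  have no B3 : B3 `&` WM = set0 -> D <> B3.
    by move=> h e; suff : (B3 `&` WM) y by [rewrite h]; split; [rewrite -e|exact: DW].
  have DC : D = C0 by have [/no|/no|//] := only' D cD; case.
  rewrite DC in DW.
  have [c [r r0 Cr] hMc] := oC.
  have [[l l0 Bl]|[l l0 Bl]] := hM c hMc.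
  - have := wedge_order hW0 B1W C0W r0 Bl Cr.
    by have := wedge_order hWM DW B1M l0 Cr Bl; lra.
  - have := wedge_order hW0 B2W C0W r0 Bl Cr.
    by have := wedge_order hWM DW B2M l0 Cr Bl; lra.
have [Bz|B'z] := Mz; first exact: (main B B').
apply: (main B' B) => //.
- by move=> c /hitsM[]; [right|left].
- by move=> D /only[]; [constructor 2|constructor 1|constructor 3].
Qed.

End Components.

(** * From the given hypotheses to exits, and the count of components *)

Section Main1.
Context {R : realType}.
Local Notation V := 'rV[R]_2.
Implicit Types (p q u v w x y z g : V) (a b c r s t : R) (A B C D E Y : set V).

Lemma card_ge4 (T : Type) (S : set T) :
  (forall A B C D : T, S A -> S B -> S C -> S D -> A <> B -> A <> C -> B <> C ->
    [\/ D = A, D = B | D = C]) \/ [set: 'I_4] #<= S.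
Proof.
have [h|h] := pselect (forall A B C D : T, S A -> S B -> S C -> S D -> A <> B -> A <> C -> B <> C ->
    [\/ D = A, D = B | D = C]); [by left|right].
have [A [B [C [D [[SA SB SC SD] [AB AC BC] [DA DB DC]]]]]] : exists A B C D : T,
    [/\ [/\ S A, S B, S C & S D], [/\ A <> B, A <> C & B <> C] & [/\ D <> A, D <> B & D <> C]].
  apply: contrapT => nex; apply: h => A B C D SA SB SC SD AB AC BC.
  apply: contrapT => nD; apply: nex; exists A, B, C, D; split => //.
  by split => e; apply: nD; [constructor 1|constructor 2|constructor 3].
pose f (i : 'I_4) := nth A [:: A; B; C; D] i.
have inj : {in [set: 'I_4] &, injective f}.
  move=> [i Hi] [j Hj] _ _; rewrite /f /=; move: i Hi j Hj.
  by case=> [|[|[|[|//]]]] Hi; case=> [|[|[|[|//]]]] Hj /= e; try exact: val_inj;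
    congruence.
rewrite -(card_le_eql (inj_card_eq inj)).
apply: subset_card_le => _ [[i Hi] _ <-]; rewrite /f /=.
by move: i Hi; case=> [|[|[|[|//]]]].
Qed.

(** The given ray need not start at [p]. Points of the ray close to [p], translated along it, remain
    on it and approximate the parallel ray from [p], which therefore cannot meet the open set
    [E]. *)
Lemma weak_exit E p : open E -> weakly_semiconvex1 E -> closure E p -> ~ E p -> exists a, exit E p a.
Proof.
move=> oE wE cE nE.
have bp : boundary E p by split => //; rewrite (interior_id _).1.
have [L [[q [v [v0 ->]]] cL LE]] := wE p bp.
have [r [a [r0 _ _ vE]]] := polar v0.
exists a => t; rewrite le_eqVlt => /orP[/eqP <-|t0]; first by rewrite scale0r addr0.
move=> Et; have [d d0 hd] := open_normE oE Et.
have [z [s /= s0 <-] zp] := closure_normE cL d0.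
suff : (open_ray q v `&` E) (q + s *: v + t *: dir a) by rewrite LE.
split.
  exists (s + t / r); first by rewrite /= addr_gt0 // divr_gt0.
  by rewrite scalerDl addrA vE !scalerA divfK ?gt_eqF.
by apply: hd; rewrite opprD addrACA subrr addr0.
Qed.

Lemma not_semiconvex_blocked E x : ~ semiconvex1_at E x ->
  forall a, exists2 s : R, 0 <= s & E (ray_pt x a s).
Proof.
move=> nsc a; apply: contrapT => nb; apply: nsc; exists (closed_ray x (dir a)); split.
- by right; exists x, (dir a); split => //; exact: dir_neq0.
- by exists 0 => /=; rewrite ?lexx // scale0r addr0.
- apply/seteqP; split => // z [[s /= s0 <-] Ez].
  by apply: nb; exists s.
Qed.

Lemma trapped_card E x : open E ->
  (forall p, closure E p -> ~ E p -> exists a, exit E p a) ->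
  (forall p, closure E p -> ~ E p -> exists g, half_plane_at E p g) ->
  ~ E x -> ~ semiconvex1_at E x -> [set: 'I_4] #<= components E.
Proof.
move=> oE wE sE nEx /not_semiconvex_blocked blocked.
have [not4|//] := card_ge4 (components E).
by exfalso; exact: trapped_absurd oE blocked nEx wE sE not4.
Qed.

Lemma smooth_half_plane_ext E p : open E -> has_smooth_boundary E -> closure E p -> ~ E p ->
  exists g, half_plane_at E p g.
Proof.
move=> oE sE cE nE; apply: smooth_half_plane => //.
by split => //; rewrite (interior_id _).1.
Qed.

(** The whole short segment from [z] stays in [E], hence in the component of [z]. *)
Lemma component_half_plane E C p g : components E C -> half_plane_at E p g -> half_plane_at C p g.
Proof.
move=> cC [g0 h]; split => // w gw; have [d d0 hd] := h w gw.
exists d => // z w' t zp ww /andP[t0 td] Cz.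
have sE : seg z (z + t *: w') `<=` E.
  move=> y [s /=]; rewrite in_itv /= => /andP[s0 s1] <-.
  rewrite addrAC subrr add0r scalerA.
  have [->|s0'] := eqVneq s 0.
    by rewrite mul0r scale0r addr0; exact: (component_sub cC).
  have sp : 0 < s by rewrite lt_neqAle eq_sym s0' s0.
  apply: hd => //; last exact: (component_sub cC).
  rewrite mulr_gt0 //=.
  by rewrite (le_lt_trans _ td) // ler_piMl // ltW.
exact: (component_max cC (@seg_connected _ z _) sE Cz (@segL _ z _) (@segR _ z _)).
Qed.

(** Otherwise [C] alone would block all rays from [y]; its only component is [C], so the hypothesis
    on three distinct components in [trapped_absurd] holds vacuously. *)
Lemma component_escape E C y : open E -> has_smooth_boundary E -> weakly_semiconvex1 E ->
  components E C -> ~ C y -> exists a, exit C y a.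
Proof.
move=> oE sE wE cC nCy.
have oC := component_open oE cC.
have out p : closure C p -> ~ C p -> closure E p /\ ~ E p.
  move=> cp nC; split; first exact: closureS (component_sub cC) _ cp.
  by move=> Ep; apply: nC; exact: component_closure oE _ cC _ (conj cp Ep).
have wC p : closure C p -> ~ C p -> exists a, exit C p a.
  move=> cp nC; have [cE nE] := out p cp nC.
  have [a ea] := weak_exit oE wE cE nE.
  by exists a => t t0 /(component_sub cC); exact: ea.
have hC p : closure C p -> ~ C p -> exists g, half_plane_at C p g.
  move=> cp nC; have [cE nE] := out p cp nC.
  have [g hg] := smooth_half_plane_ext oE sE cE nE.
  by exists g; exact: component_half_plane hg.
apply: contrapT => nesc.
have blocked a : exists2 s : R, 0 <= s & C (ray_pt y a s).
  apply: contrapT => nb; apply: nesc; exists a => t t0 Ct; apply: nb.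
  by exists t.
have one A : components C A -> A = C.
  move=> [z Cz <-]; apply: connected_component_id => //; exact: components_connected cC.
apply: (trapped_absurd oC blocked nCy wC hC) => A B C' D cA cB _ _ AB.
by case: AB; rewrite (one A) // (one B).
Qed.

End Main1.

(** * Homotopies of paths *)

Section Homotopy.
Context {R : realType}.
Local Notation V := 'rV[R]_2.
Implicit Types (s t : R).

Definition fst_half s := Num.min 1 (2 * s).
Definition snd_half s := Num.max 0 (2 * s - 1).

Lemma half_cases s : 0 <= s <= 1 ->
  (fst_half s = 2 * s /\ snd_half s = 0 /\ 0 <= 2 * s <= 1) \/
  (fst_half s = 1 /\ snd_half s = 2 * s - 1 /\ 0 <= 2 * s - 1 <= 1).
Proof.
move=> /andP[s0 s1]; rewrite /fst_half /snd_half; have [h|h] := leP (2 * s) 1; [left|right].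
- split=> //.
  split; first by apply: max_l; lra.
  by apply/andP; split; lra.
- split=> //.
  split; first by apply: max_r; lra.
  by apply/andP; split; lra.
Qed.

Lemma half01 s : 0 <= s <= 1 -> (0 <= fst_half s <= 1) /\ (0 <= snd_half s <= 1).
Proof. by move=> /half_cases[[-> [-> h]]|[-> [-> h]]]; rewrite ?lexx ?ler01. Qed.

Lemma snd_half_continuous : continuous snd_half.
Proof.
have c : continuous (fun s : R => 2 * s - 1).
  by move=> s; exact: (cvgB (cvgM (cvg_cst (2 : R)) (@cvg_id _ _)) (cvg_cst (1 : R))).
move=> s; apply: (@continuous_max R R (fun=> 0) (fun s => 2 * s - 1) s); last exact: c.
exact: cvg_cst.
Qed.

Lemma fst_half_continuous : continuous fst_half.
Proof.
have -> : fst_half = (fun s => 2 * s - snd_half s).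
  apply/funext => s; rewrite /fst_half /snd_half.
  by have [h|h] := leP (2 * s) 1; have [h'|h'] := leP 0 (2 * s - 1); lra.
by move=> s; exact: (cvgB (cvgM (cvg_cst (2 : R)) (@cvg_id _ _)) (@snd_half_continuous s)).
Qed.

Lemma fst_half0 : fst_half 0 = 0.
Proof. by rewrite /fst_half mulr0; apply: min_r. Qed.
Lemma fst_half1 : fst_half 1 = 1.
Proof. by rewrite /fst_half mulr1; apply: min_l; rewrite ler1n. Qed.
Lemma snd_half0 : snd_half 0 = 0.
Proof. by rewrite /snd_half mulr0; apply: max_l; lra. Qed.
Lemma snd_half1 : snd_half 1 = 1.
Proof. by rewrite /snd_half mulr1; rewrite max_r; lra. Qed.

(* This form is continuous on all of R without any gluing lemma. *)
Definition pcat (U : zmodType) (f g : R -> U) s : U := f (fst_half s) + (g (snd_half s) - g 0).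

Lemma pcat_cases (U : zmodType) (f g : R -> U) s : f 1 = g 0 -> 0 <= s <= 1 ->
  (pcat f g s = f (2 * s) /\ 0 <= 2 * s <= 1) \/
  (pcat f g s = g (2 * s - 1) /\ 0 <= 2 * s - 1 <= 1).
Proof.
move=> fg /half_cases[[e1 [e2 h]]|[e1 [e2 h]]]; [left|right]; split => //; rewrite /pcat e1 e2.
- by rewrite subrr addr0.
- by rewrite fg addrC subrK.
Qed.

Lemma pcat0 (U : zmodType) (f g : R -> U) : pcat f g 0 = f 0.
Proof. by rewrite /pcat fst_half0 snd_half0 subrr addr0. Qed.

Lemma pcat1 (U : zmodType) (f g : R -> U) : f 1 = g 0 -> pcat f g 1 = g 1.
Proof. by move=> fg; rewrite /pcat fst_half1 snd_half1 fg addrC subrK. Qed.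

Lemma pcat_continuous (U : normedModType R) (f g : R -> U) :
  continuous f -> continuous g -> continuous (pcat f g).
Proof.
move=> cf cg s; apply: cvgD; last apply: cvgB; last exact: cvg_cst.
- exact: (cvg_comp _ _ (@fst_half_continuous s) (cf _)).
- exact: (cvg_comp _ _ (@snd_half_continuous s) (cg _)).
Qed.

Variable C : set V.
Implicit Types (f g h : R -> V).

Definition cpath f := continuous f /\ forall s, 0 <= s <= 1 -> C (f s).

(** [H] is continuous on the whole plane and constrained only on the unit square, so that
    concatenations need no subspace topologies. The ends of the paths are fixed. *)
Definition homotopic f g := exists H : R * R -> V,
  [/\ continuous H, forall s t, 0 <= s <= 1 -> 0 <= t <= 1 -> C (H (s, t)),
      forall s, 0 <= s <= 1 -> H (s, 0) = f s, forall s, 0 <= s <= 1 -> H (s, 1) = g s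
    & forall t, 0 <= t <= 1 -> H (0, t) = f 0 /\ H (1, t) = f 1].

Lemma pcat_cpath f g : cpath f -> cpath g -> f 1 = g 0 -> cpath (pcat f g).
Proof.
move=> [cf Cf] [cg Cg] fg; split; first exact: pcat_continuous.
by move=> s s01; have [[-> h]|[-> h]] := pcat_cases fg s01; [exact: Cf|exact: Cg].
Qed.

Let m01 : 0 <= (0 : R) <= 1. Proof. by rewrite lexx ler01. Qed.
Let m11 : 0 <= (1 : R) <= 1. Proof. by rewrite lexx ler01. Qed.

Lemma hom_ends f g : homotopic f g -> f 0 = g 0 /\ f 1 = g 1.
Proof.
move=> [H [_ _ _ H1 He]]; have [e0 e1] := He 1 m11.
by rewrite -e0 -e1 !H1.
Qed.

Lemma cvg_pair_comp (T : topologicalType) (H : R * R -> V) (f g : T -> R) :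
  continuous H -> continuous f -> continuous g -> continuous (fun x => H (f x, g x)).
Proof.
move=> cH cf cg x; have h : (f y, g y) @[y --> x] --> (f x, g x) by exact: (cvg_pair (cf x) (cg x)).
exact: (cvg_comp _ _ h (cH _)).
Qed.

Lemma fst_continuous : continuous (fun st : R * R => st.1).
Proof. by move=> st; exact: cvg_fst. Qed.

Lemma snd_continuous : continuous (fun st : R * R => st.2).
Proof. by move=> st; exact: cvg_snd. Qed.

Lemma comp_continuous (T U W : topologicalType) (f : T -> U) (g : U -> W) :
  continuous f -> continuous g -> continuous (fun x => g (f x)).
Proof. by move=> cf cg x; exact: (cvg_comp _ _ (cf x) (cg _)). Qed.

(** Functions that agree on [[0, 1]] may differ elsewhere, so this is more than reflexivity. *)
Lemma hom_ext f g : cpath f -> (forall s, 0 <= s <= 1 -> f s = g s) -> homotopic f g.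
Proof.
move=> [cf Cf] fg; exists (fun st => f st.1); split => //=.
- exact: comp_continuous fst_continuous cf.
- by move=> s t s01 _; exact: Cf.
Qed.

Lemma hom_refl f : cpath f -> homotopic f f.
Proof. by move=> pf; exact: hom_ext. Qed.

Lemma hom_sym f g : homotopic f g -> homotopic g f.
Proof.
move=> hfg; have [e0 e1] := hom_ends hfg; move: hfg => [H [cH CH H0 H1 He]].
have sub t : 0 <= t <= 1 -> 0 <= 1 - t <= 1 by move=> /andP[? ?]; apply/andP; split; lra.
exists (fun st => H (st.1, 1 - st.2)); split => /=.
- apply: cvg_pair_comp => //; first exact: fst_continuous.
  by move=> st; exact: (cvgB (cvg_cst (1 : R)) (@snd_continuous st)).
- by move=> s t s01 /sub t01; exact: CH.
- by move=> s s01; rewrite subr0 H1.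
- by move=> s s01; rewrite subrr H0.
- by move=> t /sub t01; rewrite -e0 -e1; exact: He.
Qed.

Lemma hom_trans g f h : homotopic f g -> homotopic g h -> homotopic f h.
Proof.
move=> hfg; have [e0 e1] := hom_ends hfg; move: hfg => [H [cH CH H0 H1 He]].
move=> [K [cK CK K0 K1 Ke]].
pose G (st : R * R) := H (st.1, fst_half st.2) + (K (st.1, snd_half st.2) - K (st.1, 0)).
have Gc s t : 0 <= s <= 1 -> 0 <= t <= 1 ->
    (G (s, t) = H (s, 2 * t) /\ 0 <= 2 * t <= 1) \/
    (G (s, t) = K (s, 2 * t - 1) /\ 0 <= 2 * t - 1 <= 1).
  move=> s01 /half_cases[[h1 [h2 ht]]|[h1 [h2 ht]]]; [left|right]; split => //; rewrite /G /= h1 h2.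
  - by rewrite subrr addr0.
  - by rewrite H1 // K0 // addrC subrK.
exists G; split.
- move=> st; apply: cvgD; last apply: cvgB.
  + apply: (cvg_pair_comp cH fst_continuous (comp_continuous snd_continuous fst_half_continuous)).
  + apply: (cvg_pair_comp cK fst_continuous (comp_continuous snd_continuous snd_half_continuous)).
  + apply: (cvg_pair_comp cK fst_continuous (fun _ => cvg_cst (0 : R))).
- by move=> s t s01 t01; have [[-> h']|[-> h']] := Gc s t s01 t01; [exact: CH|exact: CK].
- by move=> s s01; rewrite /G /= fst_half0 snd_half0 subrr addr0 H0.
- by move=> s s01; rewrite /G /= fst_half1 snd_half1 H1 // K0 // K1 // addrC subrK.
- move=> t t01; split.
  + have [[-> h']|[-> h']] := Gc 0 t m01 t01; first by case: (He _ h').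
    by rewrite e0; case: (Ke _ h').
  + have [[-> h']|[-> h']] := Gc 1 t m11 t01; first by case: (He _ h').
    by rewrite e1; case: (Ke _ h').
Qed.

Lemma hom_cat f f' g g' : f 1 = g 0 -> homotopic f f' -> homotopic g g' -> homotopic (pcat f g) (pcat f' g').
Proof.
move=> fg hf hg; have [f0 f1] := hom_ends hf; have [g0 g1] := hom_ends hg.
move: hf hg => [H [cH CH H0 H1 He]] [K [cK CK K0 K1 Ke]].
pose G (st : R * R) := H (fst_half st.1, st.2) + (K (snd_half st.1, st.2) - K (0, st.2)).
have Gc s t : 0 <= s <= 1 -> 0 <= t <= 1 ->
    (G (s, t) = H (2 * s, t) /\ 0 <= 2 * s <= 1) \/
    (G (s, t) = K (2 * s - 1, t) /\ 0 <= 2 * s - 1 <= 1).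
  move=> /half_cases[[h1 [h2 ht]]|[h1 [h2 ht]]] t01; [left|right]; split => //; rewrite /G /= h1 h2.
  - by rewrite subrr addr0.
  - by have [_ ->] := He t t01; have [-> _] := Ke t t01; rewrite fg addrC subrK.
exists G; split.
- move=> st; apply: cvgD; last apply: cvgB.
  + apply: (cvg_pair_comp cH (comp_continuous fst_continuous fst_half_continuous) snd_continuous).
  + apply: (cvg_pair_comp cK (comp_continuous fst_continuous snd_half_continuous) snd_continuous).
  + apply: (cvg_pair_comp cK (fun _ => cvg_cst (0 : R)) snd_continuous).
- by move=> s t s01 t01; have [[-> h']|[-> h']] := Gc s t s01 t01; [exact: CH|exact: CK].
- by move=> s /half01[h1 h2]; rewrite /G /pcat /= H0 // !K0.
- by move=> s /half01[h1 h2]; rewrite /G /pcat /= H1 // !K1.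
- move=> t t01; rewrite /G /= fst_half0 snd_half0 fst_half1 snd_half1 pcat0 pcat1 //.
  have [-> ->] := He t t01; have [-> ->] := Ke t t01.
  by rewrite subrr addr0 fg addrC subrK.
Qed.

(** The straight-line homotopy in [D], mapped by [F]. With [F] a path it gives reparametrisations;
    with [F] the identity it gives homotopies inside convex sets. *)
Lemma hom_factor (U : normedModType R) (F : U -> V) (c c' : R -> U) (D : set U) :
  continuous F -> continuous c -> continuous c' ->
  (forall a b t, D a -> D b -> 0 <= t <= 1 -> D (a + t *: (b - a))) ->
  (forall a, D a -> C (F a)) ->
  (forall s, 0 <= s <= 1 -> D (c s)) -> (forall s, 0 <= s <= 1 -> D (c' s)) ->
  c 0 = c' 0 -> c 1 = c' 1 -> homotopic (fun s => F (c s)) (fun s => F (c' s)).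
Proof.
move=> cF cc cc' cD DC Dc Dc' e0 e1.
exists (fun st => F (c st.1 + st.2 *: (c' st.1 - c st.1))); split => /=.
- apply: comp_continuous => // st.
  have h1 := comp_continuous fst_continuous cc; have h2 := comp_continuous fst_continuous cc'.
  exact: (cvgD (h1 st) (cvgZ (@snd_continuous st) (cvgB (h2 st) (h1 st)))).
- by move=> s t s01 t01; apply: DC; apply: cD => //; [exact: Dc|exact: Dc'].
- by move=> s _; rewrite scale0r addr0.
- by move=> s _; rewrite scale1r addrC subrK.
- by move=> t _; rewrite -e0 -e1 !subrr scaler0 !addr0.
Qed.

Lemma itv_convex (a b t : R) : 0 <= a <= 1 -> 0 <= b <= 1 -> 0 <= t <= 1 -> 0 <= a + t *: (b - a) <= 1.
Proof.
move=> /andP[a0 a1] /andP[b0 b1] /andP[t0 t1].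
rewrite (_ : a + t *: (b - a) = (1 - t) * a + t * b); last by rewrite /GRing.scale /=; ring.
by apply/andP; split; nra.
Qed.

Lemma hom_reparam f (c c' : R -> R) : cpath f -> continuous c -> continuous c' ->
  (forall s, 0 <= s <= 1 -> 0 <= c s <= 1) -> (forall s, 0 <= s <= 1 -> 0 <= c' s <= 1) ->
  c 0 = c' 0 -> c 1 = c' 1 -> homotopic (fun s => f (c s)) (fun s => f (c' s)).
Proof.
move=> [cf Cf] cc cc' h h' e0 e1.
apply: (@hom_factor R^o f c c' [set t | 0 <= t <= 1]) => //.
by move=> a b t; exact: itv_convex.
Qed.

Lemma hom_assoc f g h : cpath f -> cpath g -> cpath h -> f 1 = g 0 -> g 1 = h 0 ->
  homotopic (pcat (pcat f g) h) (pcat f (pcat g h)).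
Proof.
move=> pf pg ph fg gh.
(* The change of parameter between the two bracketings has slopes 1/2, 1 and 2 on [[0, 1/2]],
   [[1/2, 3/4]] and [[3/4, 1]]. It is convex, hence the maximum of its three affine pieces. *)
pose r (s : R) : R := Num.max (s / 2) (Num.max (s - 1 / 4) (2 * s - 1)).
have cl (k l : R) : continuous (fun s => k * s - l).
  by move=> s; exact: (cvgB (cvgM (cvg_cst k) (@cvg_id _ _)) (cvg_cst l)).
have cr : continuous r.
  have e1 : continuous (fun s : R => s / 2).
    rewrite (_ : (fun s : R => s / 2) = (fun s => 2^-1 * s - 0)) //.
    by apply/funext => s; rewrite subr0 mulrC.
  have e2 : continuous (fun s : R => s - 1 / 4).
    rewrite (_ : (fun s : R => s - 1 / 4) = (fun s => 1 * s - 1 / 4)) //.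
    by apply/funext => s; rewrite (mul1r s).
  have e3 : continuous (fun s : R => Num.max (s - 1 / 4) (2 * s - 1)).
    by move=> s; apply: (@continuous_max R R (fun s => s - 1 / 4) (fun s => 2 * s - 1) s); [exact: e2|exact: cl].
  by move=> s; apply: (@continuous_max R R (fun s => s / 2) _ s); [exact: e1|exact: e3].
have fg_h : pcat f g 1 = h 0 by rewrite pcat1.
have f_gh : f 1 = pcat g h 0 by rewrite pcat0.
have pfgh : cpath (pcat (pcat f g) h).
  by apply: pcat_cpath => //; exact: pcat_cpath.
have pfgh' : cpath (pcat f (pcat g h)).
  by apply: pcat_cpath => //; exact: pcat_cpath.
have rE (s : R) : (s <= 1 / 2 -> r s = s / 2) /\ (1 / 2 <= s <= 3 / 4 -> r s = s - 1 / 4) /\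
    (3 / 4 <= s -> r s = 2 * s - 1).
  rewrite /r; split; [|split].
  - by move=> h1; rewrite max_l // ge_max; apply/andP; split; lra.
  - by move=> /andP[h1 h2]; rewrite (@max_l _ _ (s - 1 / 4)) ?max_r //; lra.
  - by move=> h1; rewrite (@max_r _ _ (s - 1 / 4)) ?max_r //; lra.
have r01 s : 0 <= s <= 1 -> 0 <= r s <= 1.
  move=> /andP[s0 s1]; have [r1 [r2 r3]] := rE s.
  have [h1|h1] := leP s (1 / 2); first by rewrite r1 //; apply/andP; split; lra.
  have [h2|h2] := leP s (3 / 4); first by rewrite r2; apply/andP; split; lra.
  by rewrite r3; [apply/andP; split; lra|lra].
have catL (U : zmodType) (k l : R -> U) s : k 1 = l 0 -> 0 <= s <= 1 / 2 -> pcat k l s = k (2 * s).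
  move=> kl /andP[s0 s1]; rewrite /pcat /fst_half /snd_half min_r ?max_l ?subrr ?addr0 //; lra.
have catR (U : zmodType) (k l : R -> U) s : k 1 = l 0 -> 1 / 2 <= s <= 1 -> pcat k l s = l (2 * s - 1).
  move=> kl /andP[s0 s1]; rewrite /pcat /fst_half /snd_half min_l ?max_r ?kl; [by rewrite addrC subrK|lra|lra].
have eqr s : 0 <= s <= 1 -> pcat f (pcat g h) s = pcat (pcat f g) h (r s).
  move=> /andP[s0 s1]; have [r1 [r2 r3]] := rE s.
  have [h1|h1] := leP s (1 / 2).
    rewrite r1 // catL //; last by rewrite s0.
    rewrite catL //; last by apply/andP; split; lra.
    rewrite catL //; last by apply/andP; split; lra.
    by congr f; field.
  have [h2|h2] := leP s (3 / 4).
    rewrite r2 ?h2 ?ltW // catR //; last by rewrite s1 ltW.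
    rewrite catL //; last by apply/andP; split; lra.
    rewrite catL //; last by apply/andP; split; lra.
    rewrite catR //; last by apply/andP; split; lra.
    by congr g; field.
  rewrite r3 ?ltW // catR //; last by rewrite s1 ltW.
  rewrite catR //; last by apply/andP; split; lra.
  rewrite catR //; last by apply/andP; split; lra.
apply: (@hom_trans (fun s => pcat (pcat f g) h (r s))).
- apply: (hom_reparam pfgh (c := id)) => //.
  + by move=> s; exact: cvg_id.
  + by have [r1 _] := rE 0; rewrite r1 ?mul0r //; lra.
  + by have [_ [_ r3]] := rE 1; rewrite r3 /=; lra.
- apply: hom_sym; apply: hom_ext => //.
Qed.

(** A waiting time at the start is a reparametrisation by [snd_half]. *)
Lemma hom_cat_cst f a : cpath f -> f 0 = a -> homotopic (pcat (fun=> a) f) f.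
Proof.
move=> pf f0.
have e s : pcat (fun=> a) f s = f (snd_half s) by rewrite /pcat f0 addrC subrK.
have h01 s : 0 <= s <= 1 -> 0 <= snd_half s <= 1.
  by move=> /half_cases[[_ [-> _]]|[_ [-> h]]].
apply: (@hom_trans (fun s => f (snd_half s))).
- apply: hom_ext => //; apply: pcat_cpath => //; split; first by move=> s; exact: cvg_cst.
  by move=> s _; rewrite -f0; apply: pf.2.
- apply: (hom_reparam pf (c' := id)) => //.
  + exact: snd_half_continuous.
  + by move=> s; exact: cvg_id.
  + exact: snd_half0.
  + exact: snd_half1.
Qed.

End Homotopy.

(** * Polygonal paths *)

Section Polygons.
Context {R : realType}.
Local Notation V := 'rV[R]_2.
Implicit Types (a b c p u v w x y z : V) (s t : R) (l m : seq V) (C D : set V).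

Definition sg a b (s : R) : V := a + s *: (b - a).

(** Each edge takes half of the remaining time. The speed is irrelevant up to homotopy, and this
    choice makes [pth] a plain iteration of [pcat]. *)
Fixpoint pth a l : R -> V :=
  if l is b :: l' then pcat (sg a b) (pth b l') else fun=> a.

Fixpoint good C a l : Prop :=
  if l is b :: l' then seg a b `<=` C /\ good C b l' else C a.

Definition convex C := forall a b (t : R), C a -> C b -> 0 <= t <= 1 -> C (a + t *: (b - a)).

Lemma sg0 a b : sg a b 0 = a. Proof. by rewrite /sg scale0r addr0. Qed.
Lemma sg1 a b : sg a b 1 = b. Proof. by rewrite /sg scale1r addrC subrK. Qed.

Lemma pth0 a l : pth a l 0 = a.
Proof. by case: l => [//|b l] /=; rewrite pcat0 sg0. Qed.

Lemma pth1 a l : pth a l 1 = last a l.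
Proof. by elim: l a => [//|b l IH] a /=; rewrite pcat1 ?IH // sg1 pth0. Qed.

Lemma sg_cpath C a b : seg a b `<=` C -> cpath C (sg a b).
Proof.
move=> h; split; first exact: line_continuous.
by move=> s s01; apply: h; exists s => //=; rewrite in_itv.
Qed.

Lemma pth_cpath C a l : good C a l -> cpath C (pth a l).
Proof.
elim: l a => [|b l IH] a /=.
  by move=> Ca; split=> // s; exact: cvg_cst.
move=> [hs hl]; apply: pcat_cpath; [exact: sg_cpath|exact: IH|by rewrite sg1 pth0].
Qed.

Lemma good_head C a l : good C a l -> C a.
Proof. by case: l => [//|b l] /= [h _]; apply: h; exact: segL. Qed.

Lemma good_cat C a l m : good C a (l ++ m) <-> good C a l /\ good C (last a l) m.
Proof.
elim: l a => [|b l IH] a /=; first by split=> [h|[]//]; split=> //; exact: good_head h.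
by rewrite IH; tauto.
Qed.

Lemma good_sub C D a l : C `<=` D -> good C a l -> good D a l.
Proof.
move=> CD; elim: l a => [|b l IH] a /=; first exact: CD.
by move=> [h1 h2]; split; [exact: subset_trans CD|exact: IH].
Qed.

Lemma convex_seg C a b : convex C -> C a -> C b -> seg a b `<=` C.
Proof. by move=> cC Ca Cb z [t /=]; rewrite in_itv /= => t01 <-; exact: cC. Qed.

Lemma seg_convex a b : convex (seg a b).
Proof.
move=> p q t [s /=]; rewrite in_itv /= => s01 <- [r /=]; rewrite in_itv /= => r01 <- t01.
exists (s + t *: (r - s)); first by rewrite /= in_itv /=; exact: itv_convex.
by rewrite /GRing.scale /=; apply: vecP; rewrite !coordE; ring.
Qed.

Section InC.
Variable C : set V.

Definition peq a l m := homotopic C (pth a l) (pth a m).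

Lemma peq_convex D a l m : convex D -> D `<=` C -> good D a l -> good D a m ->
  last a l = last a m -> peq a l m.
Proof.
move=> cD DC gl gm e.
have [c1 h1] := pth_cpath gl; have [c2 h2] := pth_cpath gm.
apply: (@hom_factor R C V id (pth a l) (pth a m) D) => //.
- by move=> z; exact: cvg_id.
- by rewrite !pth0.
- by rewrite !pth1.
Qed.

Lemma pth_cat a l m : good C a (l ++ m) ->
  homotopic C (pth a (l ++ m)) (pcat (pth a l) (pth (last a l) m)).
Proof.
elim: l a => [|b l IH] a /=.
  move=> g; apply: hom_sym; apply: hom_cat_cst; [exact: pth_cpath|exact: pth0].
move=> [h1 h2]; have [gl gm] := (good_cat C b l m).1 h2.
have ps := sg_cpath h1; have pl := pth_cpath gl; have pm := pth_cpath gm.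
have e1 : sg a b 1 = pth b l 0 by rewrite sg1 pth0.
have e2 : pth b l 1 = pth (last b l) m 0 by rewrite pth1 pth0.
apply: (@hom_trans _ _ (pcat (sg a b) (pcat (pth b l) (pth (last b l) m)))).
  by apply: hom_cat; [rewrite sg1 pth0|exact: hom_refl|exact: IH].
by apply: hom_sym; apply: hom_assoc.
Qed.

Lemma peq_refl a l : good C a l -> peq a l l.
Proof. by move=> g; apply: hom_refl; exact: pth_cpath. Qed.

Lemma peq_sym a l m : peq a l m -> peq a m l.
Proof. exact: hom_sym. Qed.

Lemma peq_trans m a l l' : peq a l m -> peq a m l' -> peq a l l'.
Proof. exact: hom_trans. Qed.

Lemma peq_catl a l m m' : good C a l -> good C (last a l) m -> good C (last a l) m' ->
  peq (last a l) m m' -> peq a (l ++ m) (l ++ m').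
Proof.
move=> gl gm gm' h.
apply: (@hom_trans _ _ (pcat (pth a l) (pth (last a l) m))).
  by apply: pth_cat; apply/good_cat.
apply: (@hom_trans _ _ (pcat (pth a l) (pth (last a l) m'))).
  by apply: hom_cat => //; [rewrite pth1 pth0|exact: peq_refl].
by apply: hom_sym; apply: pth_cat; apply/good_cat.
Qed.

Lemma peq_catr a l l' m : good C a l -> good C a l' -> last a l = last a l' ->
  good C (last a l) m -> peq a l l' -> peq a (l ++ m) (l' ++ m).
Proof.
move=> gl gl' e gm h.
apply: (@hom_trans _ _ (pcat (pth a l) (pth (last a l) m))).
  by apply: pth_cat; apply/good_cat.
apply: (@hom_trans _ _ (pcat (pth a l') (pth (last a l) m))).
  by apply: hom_cat => //; [rewrite pth1 pth0|exact: peq_refl].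
by apply: hom_sym; rewrite e; apply: pth_cat; apply/good_cat; rewrite -e.
Qed.

Lemma peq_replace D a l1 m m' l2 : convex D -> D `<=` C ->
  good C a l1 -> good D (last a l1) m -> good D (last a l1) m' ->
  last (last a l1) m = last (last a l1) m' -> good C (last (last a l1) m) l2 ->
  peq a (l1 ++ m ++ l2) (l1 ++ m' ++ l2).
Proof.
move=> cD DC g1 gm gm' e g2.
have gmC := good_sub DC gm; have gmC' := good_sub DC gm'.
apply: peq_catl => //.
- by apply/good_cat.
- by apply/good_cat; rewrite -e.
- by apply: peq_catr => //; exact: peq_convex gm gm' e.
Qed.

Definition nullp a l := peq a l [::].

Lemma peq_del a l1 m l2 : good C a l1 -> good C (last a l1) m -> last (last a l1) m = last a l1 ->
  good C (last a l1) l2 -> nullp (last a l1) m -> peq a (l1 ++ m ++ l2) (l1 ++ l2).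
Proof.
move=> g1 gm e g2 nm; set b := last a l1 in gm e g2 nm *.
apply: peq_catl => //; first by apply/good_cat; rewrite e.
apply: (@hom_trans _ _ (pcat (pth b m) (pth b l2))).
  by have := @pth_cat b m l2; rewrite e; apply; apply/good_cat; rewrite e.
apply: (@hom_trans _ _ (pcat (fun=> b) (pth b l2))).
  by apply: hom_cat => //; [rewrite pth1 pth0|exact: peq_refl].
by apply: hom_cat_cst; [exact: pth_cpath|exact: pth0].
Qed.

Lemma null_back a b : seg a b `<=` C -> nullp a [:: b; a].
Proof.
move=> h; have cs := @seg_convex a b.
apply: (peq_convex cs h) => //=.
- split; first by [].
  split; last exact: segL.
  by apply: convex_seg cs _ _; [exact: segR|exact: segL].
- exact: segL.
Qed.

Lemma segC a b : seg a b `<=` seg b a.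
Proof. apply: convex_seg; [exact: seg_convex|exact: segR|exact: segL]. Qed.

(** Appending the spur [a b a] turns the loop into the loop at [b] conjugated by the edge from [a]
    to [b]; deleting the inner loop leaves a spur. *)
Lemma null_rotate1 a b l : good C a (b :: l) -> last b l = a ->
  nullp b (l ++ [:: b]) -> nullp a (b :: l).
Proof.
move=> [h gl] e nb.
have Ca : C a by apply: h; exact: segL.
have hb : seg b a `<=` C by apply: subset_trans h; exact: segC.
have gb : good C b [:: a] by split.
apply: (@peq_trans ((b :: l) ++ [:: b; a] ++ [::])).
  apply: peq_sym; rewrite -[X in peq a _ X](cats0 (b :: l)).
  apply: peq_del => //=; rewrite e //; exact: null_back.
apply: (@peq_trans ([:: b] ++ (l ++ [:: b]) ++ [:: a])).
  rewrite /= -catA /=; apply: peq_refl => /=; split => //.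
  by apply/good_cat; split => //; rewrite e.
apply: (@peq_trans ([:: b] ++ [:: a])); last exact: null_back.
apply: peq_del => //=; last by rewrite last_cat.
- by split => //; exact: hb _ (segL b a).
- by apply/good_cat; split => //; rewrite e; split => //; exact: hb _ (segL b a).
Qed.

Lemma null_rotate a l1 v l2 : good C a (l1 ++ v :: l2) -> last a (l1 ++ v :: l2) = a ->
  nullp v (l2 ++ l1 ++ [:: v]) -> nullp a (l1 ++ v :: l2).
Proof.
elim: l1 a l2 => [|b l1 IH] a l2 /=.
  by move=> g e h; exact: null_rotate1.
move=> g e h; apply: null_rotate1 => //.
have hb : seg a b `<=` C by case: g.
rewrite -catA /=; apply: IH.
- apply/good_cat; have [_ /good_cat[g1 g2]] := g; split => //.
  rewrite -cat_cons; apply/good_cat; split => //.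
  move: e; rewrite last_cat /= => ->; split => //.
  exact: hb _ (segR a b).
- by rewrite last_cat /= last_cat.
- by rewrite -catA.
Qed.

Definition tri v w u : set V := [set z | exists r s : R,
  [/\ 0 <= r, 0 <= s, r + s <= 1 & z = v + r *: (w - v) + s *: (u - v)]].

Lemma tri_convex v w u : convex (tri v w u).
Proof.
move=> a b t [r [s [r0 s0 rs ->]]] [r' [s' [r0' s0' rs' ->]]] /andP[t0 t1].
exists ((1 - t) * r + t * r'), ((1 - t) * s + t * s'); split.
- by nra.
- by nra.
- by nra.
- by apply: vecP; rewrite !coordE; ring.
Qed.

Lemma triv v w u : tri v w u v.
Proof. by exists 0, 0; split; rewrite ?addr0 ?ler01 // !scale0r !addr0. Qed.
Lemma triw v w u : tri v w u w.
Proof. by exists 1, 0; split; rewrite ?addr0 ?ler01 // scale0r addr0 scale1r addrC subrK. Qed.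
Lemma triu v w u : tri v w u u.
Proof. by exists 0, 1; split; rewrite ?add0r ?ler01 // scale0r addr0 scale1r addrC subrK. Qed.

(** * Splitting a closed polygon into closed polygons with fewer edges *)

Section Cuts.
Variables (v : V) (n : nat).
Hypothesis IH : forall a l, (size l < n)%N -> good C a l -> last a l = a -> nullp a l.

(** The closing edge is rerouted through [w]. The loop at [w] then has one edge less, and without it
    the spur [v w v] remains. *)
Lemma cut_triangle w q : good C v (w :: q ++ [:: v]) -> (size q).+2 = n ->
  tri v w (last w q) `<=` C -> nullp v (w :: q ++ [:: v]).
Proof.
move=> [hw /good_cat[gq gu]] sz T; set u := last w q in T gu.
have cT := @tri_convex v w u.
have Cw := good_head gq.
have Dv := triv v w u; have Dw := triw v w u; have Du := triu v w u.
have guw : seg u w `<=` C by apply: subset_trans T; exact: convex_seg.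
have gwv : seg w v `<=` C by apply: subset_trans T; exact: convex_seg.
have Cv : C v by exact: T.
apply: (@peq_trans ((w :: q) ++ [:: w; v] ++ [::])).
  rewrite (_ : w :: q ++ [:: v] = (w :: q) ++ [:: v] ++ [::]) //.
  apply: (peq_replace cT T) => //=.
  - by split => //; exact: convex_seg.
  - by split; [exact: convex_seg|split => //; exact: convex_seg].
apply: (@peq_trans ([:: w] ++ (q ++ [:: w]) ++ [:: v])).
  rewrite /= -catA /=; apply: peq_refl => /=; split => //.
  by apply/good_cat; split => //=.
apply: (@peq_trans ([:: w] ++ [:: v])); last exact: null_back.
apply: peq_del => //=.
- by apply/good_cat; split.
- by rewrite last_cat.
- by apply: IH; [rewrite size_cat addn1 -sz|apply/good_cat; split|rewrite last_cat].
Qed.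

(** A spur from [z] to [v] and back splits the loop at [v] in two; [q1] and [q2] are nonempty so
    that both pieces are shorter. *)
Lemma cut_vertex q1 z q2 : good C v (q1 ++ z :: q2 ++ [:: v]) ->
  (size q1 + (size q2).+2)%N = n -> (0 < size q1)%N -> (0 < size q2)%N ->
  seg v z `<=` C -> nullp v (q1 ++ z :: q2 ++ [:: v]).
Proof.
move=> /good_cat[g1 [hz g2]] sz s1 s2 hvz.
have Cv : C v by exact: hvz _ (segL v z).
have Cz : C z by exact: hvz _ (segR v z).
have hzv : seg z v `<=` C by apply: subset_trans hvz; exact: segC.
apply: (@peq_trans ((q1 ++ [:: z]) ++ [:: v; z] ++ (q2 ++ [:: v]))).
  rewrite (_ : q1 ++ z :: q2 ++ [:: v] = (q1 ++ [:: z]) ++ (q2 ++ [:: v])); last by rewrite -catA.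
  have lz : last v (q1 ++ [:: z]) = z by rewrite last_cat.
  apply: peq_sym; apply: peq_del; rewrite ?lz //=.
  - by apply/good_cat.
  - exact: null_back.
apply: (@peq_trans ([::] ++ (q1 ++ [:: z; v]) ++ (z :: q2 ++ [:: v]))).
  rewrite /= -!catA /=; apply: peq_refl => /=; apply/good_cat; split => //.
apply: (@peq_trans ([::] ++ (z :: q2 ++ [:: v]))).
  apply: peq_del => //=.
  - by apply/good_cat.
  - by rewrite last_cat.
  - apply: IH; last by rewrite last_cat.
    + by rewrite size_cat /= -sz; lia.
    + by apply/good_cat.
apply: IH => /=; last by rewrite last_cat.
- by rewrite size_cat /= -sz; lia.
- by split.
Qed.

Lemma seg_sub a b p q : seg a b p -> seg a b q -> seg p q `<=` seg a b.
Proof. by apply: convex_seg; exact: seg_convex. Qed.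

(** Inserting [c] in both crossing edges makes the polygon pass through [c] twice. The loop between
    the two passages has [size q1 + 3] edges, the remainder has [size q2 + 3]. *)
Lemma cut_cross1 w q1 a b q2 c : good C v (w :: q1 ++ a :: b :: q2 ++ [:: v]) ->
  (size q1 + (size q2).+4)%N = n -> seg v w c -> seg a b c ->
  nullp v (w :: q1 ++ a :: b :: q2 ++ [:: v]).
Proof.
move=> [hw /good_cat[g1 [ha [hab g2]]]] sz cw cab.
have Cc : C c by exact: hw.
have Cv : C v by exact: hw _ (segL v w).
have hvc : seg v c `<=` C by apply: subset_trans hw; apply: seg_sub => //; exact: segL.
have hcw : seg c w `<=` C by apply: subset_trans hw; apply: seg_sub => //; exact: segR.
have hac : seg a c `<=` C by apply: subset_trans hab; apply: seg_sub => //; exact: segL.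
have hcb : seg c b `<=` C by apply: subset_trans hab; apply: seg_sub => //; exact: segR.
have gq1a : good C w (q1 ++ [:: a]).
  by apply/good_cat; split => //=; split => //; exact: hab _ (segL a b).
apply: (@peq_trans (c :: w :: q1 ++ a :: c :: b :: q2 ++ [:: v])).
  apply: (@peq_trans ([::] ++ [:: c; w] ++ (q1 ++ a :: b :: q2 ++ [:: v]))).
    apply: (@peq_replace (seg v w) v [::] [:: w] [:: c; w]) => //=.
    - exact: seg_convex.
    - by split => //; exact: segR.
    - split; first by apply: seg_sub => //; exact: segL.
      by split; [apply: seg_sub => //; exact: segR|exact: segR].
    - by apply/good_cat.
  rewrite (_ : [::] ++ _ = ([:: c; w] ++ q1 ++ [:: a]) ++ [:: b] ++ (q2 ++ [:: v])); last by rewrite /= -!catA.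
  rewrite (_ : c :: w :: q1 ++ a :: c :: b :: q2 ++ [:: v] =
    ([:: c; w] ++ q1 ++ [:: a]) ++ [:: c; b] ++ (q2 ++ [:: v])); last by rewrite /= -!catA.
  have la : last v ([:: c; w] ++ q1 ++ [:: a]) = a by rewrite !last_cat.
  apply: (@peq_replace (seg a b)); rewrite ?la //=.
  - exact: seg_convex.
  - by split => //; exact: segR.
  - split; first by apply: seg_sub => //; exact: segL.
    by split; [apply: seg_sub => //; exact: segR|exact: segR].
apply: (@peq_trans ([:: c] ++ (w :: q1 ++ [:: a; c]) ++ (b :: q2 ++ [:: v]))).
  rewrite /= -!catA /=; apply: peq_refl => /=; split => //; split => //.
  by apply/good_cat; split => //=.
have gin : good C c (w :: q1 ++ [:: a; c]).
  by split => //; apply/good_cat; split => //=.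
apply: (@peq_trans ([:: c] ++ (b :: q2 ++ [:: v]))).
  apply: peq_del => //=.
  - by rewrite last_cat.
  - apply: IH => //; last by rewrite /= last_cat.
    by rewrite /= size_cat /= -sz; lia.
apply: IH => //=; last by rewrite last_cat.
by rewrite size_cat /= -sz; lia.
Qed.

Lemma cut_cross2 q1 a b q2 u c : good C v (q1 ++ a :: b :: q2 ++ [:: u; v]) ->
  (size q1 + (size q2).+4)%N = n -> seg v u c -> seg a b c ->
  nullp v (q1 ++ a :: b :: q2 ++ [:: u; v]).
Proof.
move=> /good_cat[g1 [ha [hab /good_cat[g2 [hu [huv Cv]]]]]] sz cu cab.
have hvu : seg v u `<=` C by apply: subset_trans huv; exact: segC.
have Cc : C c by exact: hvu.
have huc : seg u c `<=` C by apply: subset_trans hvu; apply: seg_sub => //; exact: segR.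
have hcv : seg c v `<=` C by apply: subset_trans hvu; apply: seg_sub => //; exact: segL.
have hac : seg a c `<=` C by apply: subset_trans hab; apply: seg_sub => //; exact: segL.
have hcb : seg c b `<=` C by apply: subset_trans hab; apply: seg_sub => //; exact: segR.
have gq1a : good C v (q1 ++ [:: a]).
  by apply/good_cat; split => //=; split => //; exact: hab _ (segL a b).
have gcv : good C c [:: v] by split.
apply: (@peq_trans (q1 ++ a :: c :: b :: q2 ++ [:: u; c; v])).
  apply: (@peq_trans ((q1 ++ [:: a]) ++ [:: c; b] ++ (q2 ++ [:: u; v]))).
    rewrite (_ : q1 ++ _ = (q1 ++ [:: a]) ++ [:: b] ++ (q2 ++ [:: u; v])); last by rewrite -catA.
    have la : last v (q1 ++ [:: a]) = a by rewrite last_cat.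
    apply: (@peq_replace (seg a b)); rewrite ?la //=.
    - exact: seg_convex.
    - by split => //; exact: segR.
    - split; first by apply: seg_sub => //; exact: segL.
      by split; [apply: seg_sub => //; exact: segR|exact: segR].
    - by apply/good_cat; split => //=.
  rewrite (_ : (q1 ++ [:: a]) ++ _ =
    (q1 ++ [:: a, c, b & q2] ++ [:: u]) ++ [:: v] ++ [::]); last by rewrite /= -!catA /= -!catA.
  rewrite (_ : q1 ++ a :: c :: b :: q2 ++ [:: u; c; v] =
    (q1 ++ [:: a, c, b & q2] ++ [:: u]) ++ [:: c; v] ++ [::]); last by rewrite /= -!catA /= -!catA.
  have la : last v (q1 ++ [:: a, c, b & q2] ++ [:: u]) = u by rewrite !last_cat.
  apply: (@peq_replace (seg u v)); rewrite ?la //=.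
  - exact: seg_convex.
  - apply/good_cat; split => //=; split => //; split => //; split => //; apply/good_cat; split => //=; split => //.
    exact: hvu _ (segR v u).
  - by split => //; exact: segR.
  - have cu' : seg u v c by exact: segC.
    split; first by apply: seg_sub => //; exact: segL.
    by split; [apply: seg_sub => //; exact: segR|exact: segR].
apply: (@peq_trans ((q1 ++ [:: a; c]) ++ (b :: q2 ++ [:: u; c]) ++ [:: v])).
  rewrite (_ : (q1 ++ [:: a; c]) ++ (b :: q2 ++ [:: u; c]) ++ [:: v] =
    q1 ++ a :: c :: b :: q2 ++ [:: u; c; v]); last by rewrite -!catA /= -?catA.
  apply: peq_refl; apply/good_cat; split => //=; split => //; split => //; split => //.
  by apply/good_cat; split => //=.
have lc : last v (q1 ++ [:: a; c]) = c by rewrite last_cat.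
have gin : good C c (b :: q2 ++ [:: u; c]).
  by split => //; apply/good_cat; split => //=.
apply: (@peq_trans ((q1 ++ [:: a; c]) ++ [:: v])).
  apply: peq_del; rewrite ?lc //=.
  - by apply/good_cat; split => //=.
  - by rewrite last_cat.
  - apply: IH => //; last by rewrite /= last_cat.
    by rewrite /= size_cat /= -sz; lia.
apply: IH; last by rewrite last_cat.
- by rewrite !size_cat /= -sz; lia.
- by rewrite -catA; apply/good_cat; split => //=.
Qed.

End Cuts.
End InC.
End Polygons.

(** * Cutting a closed polygon *)

Section Step.
Context {R : realType}.
Local Notation V := 'rV[R]_2.
Implicit Types (a b c p u v w x y z : V) (s t : R) (l m : seq V) (C D : set V).

Lemma pth_edge a l s : 0 <= s <= 1 -> l != [::] ->
  exists l1 p r l2, a :: l = l1 ++ p :: r :: l2 /\ seg p r (pth a l s).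
Proof.
elim: l a s => [//|b l IH] a s s01 _.
have e : sg a b 1 = pth b l 0 by rewrite sg1 pth0.
have [[h h01]|[h h01]] := pcat_cases e s01; rewrite /= h.
- by exists [::], a, b, l; split => //; exists (2 * s) => //=; rewrite in_itv.
- case: l IH h e => [|b' l] IH h e.
    by exists [::], a, b, [::]; split => //; exact: segR.
  have [l1 [p [r [l2 [-> hz]]]]] := IH b _ h01 isT.
  by exists (a :: l1), p, r, l2.
Qed.

(** The first condition says that [p] lies on the side of the line through [y] and [v] to which [d]
    points, the second that [v] and [p] are not strictly on one side of the line along [d]. The
    parameter [s] is the zero of the affine function [cross (z - y) d] on the segment from [v] to
    [p]. *)
Lemma ray_meets_seg y v p d : let n := v - y in
  0 < cross n d * cross n (p - y) -> cross n d * cross (p - y) d <= 0 ->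
  exists2 t, 0 <= t & seg v p (y + t *: d).
Proof.
move=> n; set k := cross n d; set m := cross (p - y) d; set e := cross n (p - y) => ke km.
have k0 : k != 0 by apply/eqP => h; rewrite h mul0r ltxx in ke.
have k2 : 0 < k ^+ 2 by rewrite exprn_even_gt0.
have km0 : k - m != 0.
  by apply/eqP => h; have : k * (k - m) = 0 by [rewrite h mulr0]; nra.
pose s := k / (k - m); pose t := s * e / k.
have s01 : 0 <= s <= 1.
  have d2 : 0 < k ^+ 2 - k * m by nra.
  have -> : s = k ^+ 2 / (k ^+ 2 - k * m) by rewrite /s; field; rewrite km0 gt_eqF.
  apply/andP; split; first by rewrite divr_ge0 ?ltW.
  by rewrite ler_pdivrMr // mul1r; nra.
have t0 : 0 <= t.
  have -> : t = s * (k * e) / k ^+ 2 by rewrite /t; field.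
  by rewrite divr_ge0 ?(ltW k2) // mulr_ge0 ?(ltW ke) //; case/andP: s01.
exists t => //; exists s; first by rewrite /= in_itv.
rewrite /t /s; move: k0 km0; rewrite /k /m /e /n /cross !coordE => k0 km0.
by apply: vecP; rewrite !coordE; field; rewrite k0 km0.
Qed.

(** The rays along [d] and [v - y] bound a convex sector at [y]. One of [p], [r] lies in it, because
    its segment to [v] does not cross the ray along [d]; the other does not, being on the wrong side
    of the line through [y] and [v]. *)
Lemma separation y v p r d A : connected A -> A p -> A r ->
  (forall t, 0 <= t -> ~ A (y + t *: d)) -> (forall t, 0 <= t -> ~ A (y + t *: (v - y))) ->
  (forall t, 0 <= t -> ~ seg v p (y + t *: d)) -> (forall t, 0 <= t -> ~ seg v r (y + t *: d)) ->
  d <> 0 -> 0 < cross (v - y) (p - y) -> cross (v - y) (r - y) < 0 -> False.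
Proof.
move=> cA Ap Ar Ad An sp sr d0; set n := v - y in An * => cp cr.
have n0 : n <> 0 by move=> h; move: cp; rewrite h /cross !coordE !mul0r subrr ltxx.
have [k0|k0|k0] := ltgtP (cross n d) 0.
- have ang : convex_angle d n by left; rewrite crossC oppr_gt0.
  have rS : sector y d n r.
    split; last by rewrite crossC oppr_gt0.
    rewrite ltNge; apply/negP => h.
    have [||t t0 ht] := @ray_meets_seg y v r d; last exact: sr t t0 ht.
      by rewrite -/n; nra.
    by rewrite -/n (crossC (r - y)); nra.
  have [h|h] := sector_connected cA ang Ad An.
    by have [_] := h p Ap; rewrite crossC; lra.
  by suff : (A `&` sector y d n) r by rewrite h.
- have ang : convex_angle n d by left.
  have pS : sector y n d p.
    split; first by [].
    rewrite ltNge; apply/negP => h.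
    have [||t t0 ht] := @ray_meets_seg y v p d; last exact: sp t t0 ht.
      by rewrite -/n; nra.
    by rewrite -/n; nra.
  have [h|h] := sector_connected cA ang An Ad.
    by have [h1 _] := h r Ar; move: h1 cr; lra.
  by suff : (A `&` sector y n d) p by rewrite h.
- pose k := dot n d / dot n n.
  have dE : d = k *: n by apply: cross0_collinear => //; exact/eqP.
  have kn0 : k != 0 by apply/eqP => h; apply: d0; rewrite dE h scale0r.
  (* If [d] were a positive multiple of [v - y], the ray along [d] would contain [v]. *)
  have kneg : k < 0.
    rewrite lt_neqAle kn0 leNgt; apply/negP => kp.
    apply: (sp k^-1); first by rewrite invr_ge0 ltW.
    by rewrite dE scalerA mulVf // scale1r /n addrC subrK; exact: segL.
  have ang : convex_angle n d.
    by right; split; [exact/eqP|exists (- k); rewrite ?oppr_gt0 // opprK].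
  have pS : sector y n d p.
    by split => //; rewrite dE crossZr (crossC (p - y)); nra.
  have [h|h] := sector_connected cA ang An Ad.
    by have [h1 _] := h r Ar; move: h1 cr; lra.
  by suff : (A `&` sector y n d) p by rewrite h.
Qed.

Lemma cross_frame d e z : cross d e != 0 ->
  z = (cross z e / cross d e) *: d + (cross d z / cross d e) *: e.
Proof.
by rewrite /cross => h; apply: vecP; rewrite !coordE; field.
Qed.

Lemma cross_combl (A B : R) d e : cross (A *: d + B *: e) e = A * cross d e.
Proof. by rewrite /cross !coordE; ring. Qed.

Lemma cross_combr (A B : R) d e : cross d (A *: d + B *: e) = B * cross d e.
Proof. by rewrite /cross !coordE; ring. Qed.

(** In coordinates along the two edges at [v], a segment from inside the quadrant to a point outside
    it, with no larger coordinate sum, leaves through an axis, where the other coordinate is below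
    1. The strict bound later keeps the crossing off the far ends [w] and [u]. *)
Lemma exit_cone (ac bc ae be : R) : 0 < ac -> 0 < bc -> ac + bc < 1 -> ae + be <= ac + bc ->
  ae < 0 \/ be < 0 -> exists2 k, 0 <= k <= 1 &
    (ac + k * (ae - ac) = 0 /\ 0 <= bc + k * (be - bc) < 1) \/
    (bc + k * (be - bc) = 0 /\ 0 <= ac + k * (ae - ac) < 1).
Proof.
move=> ac0 bc0 acbc aebe neg.
have viaA : ae < 0 -> 0 <= bc + ac / (ac - ae) * (be - bc) -> exists2 k, 0 <= k <= 1 &
    (ac + k * (ae - ac) = 0 /\ 0 <= bc + k * (be - bc) < 1) \/
    (bc + k * (be - bc) = 0 /\ 0 <= ac + k * (ae - ac) < 1).
  move=> a0 h; have d0 : 0 < ac - ae by lra.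
  exists (ac / (ac - ae)).
    by rewrite divr_ge0 ?(ltW ac0) ?(ltW d0) //= ler_pdivrMr // mul1r; lra.
  left; split; first by field; rewrite gt_eqF.
  rewrite h /=.
  have e : ac + ac / (ac - ae) * (ae - ac) = 0 by field; rewrite gt_eqF.
  have k0 : 0 <= ac / (ac - ae) by rewrite divr_ge0 ?(ltW ac0) ?(ltW d0).
  by move: e k0 h; set k := ac / (ac - ae) => e k0 h; nra.
have viaB : be < 0 -> 0 <= ac + bc / (bc - be) * (ae - ac) -> exists2 k, 0 <= k <= 1 &
    (ac + k * (ae - ac) = 0 /\ 0 <= bc + k * (be - bc) < 1) \/
    (bc + k * (be - bc) = 0 /\ 0 <= ac + k * (ae - ac) < 1).
  move=> a0 h; have d0 : 0 < bc - be by lra.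
  exists (bc / (bc - be)).
    by rewrite divr_ge0 ?(ltW bc0) ?(ltW d0) //= ler_pdivrMr // mul1r; lra.
  right; split; first by field; rewrite gt_eqF.
  rewrite h /=.
  have e : bc + bc / (bc - be) * (be - bc) = 0 by field; rewrite gt_eqF.
  have k0 : 0 <= bc / (bc - be) by rewrite divr_ge0 ?(ltW bc0) ?(ltW d0).
  by move: e k0 h; set k := bc / (bc - be) => e k0 h; nra.
have [a0|a0] := ltP ae 0; have [b0|b0] := ltP be 0.
- have da : 0 < ac - ae by lra. have db : 0 < bc - be by lra.
  have [h|h] := leP 0 (bc * (- ae) + ac * be).
  + apply: viaA => //.
    have -> : bc + ac / (ac - ae) * (be - bc) = (bc * (- ae) + ac * be) / (ac - ae) by field; rewrite gt_eqF.
    by rewrite divr_ge0 // ltW.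
  + apply: viaB => //.
    have -> : ac + bc / (bc - be) * (ae - ac) = (ac * (- be) + bc * ae) / (bc - be) by field; rewrite gt_eqF.
    by rewrite divr_ge0 ?(ltW db) //; lra.
- apply: viaA => //; have da : 0 < ac - ae by lra.
  have -> : bc + ac / (ac - ae) * (be - bc) = (bc * (- ae) + ac * be) / (ac - ae) by field; rewrite gt_eqF.
  by rewrite divr_ge0 ?(ltW da) //; nra.
- apply: viaB => //; have db : 0 < bc - be by lra.
  have -> : ac + bc / (bc - be) * (ae - ac) = (ac * (- be) + bc * ae) / (bc - be) by field; rewrite gt_eqF.
  by rewrite divr_ge0 ?(ltW db) //; nra.
- by exfalso; case: neg; lra.
Qed.

Lemma norm_seg v p r z : dot p p <= dot v v -> dot r r <= dot v v -> seg p r z -> dot z z <= dot v v.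
Proof.
move=> hp hr [s /=]; rewrite in_itv /= => /andP[s0 s1] <-.
have -> : dot (p + s *: (r - p)) (p + s *: (r - p)) =
    (1 - s) * dot p p + s * dot r r - s * (1 - s) * dot (r - p) (r - p).
  by rewrite /dot !coordE; ring.
have : 0 <= s * (1 - s) * dot (r - p) (r - p).
  by rewrite !mulr_ge0 ?subr_ge0 // addr_ge0 // sqr_ge0.
by nra.
Qed.

(** Strict convexity of the Euclidean norm: a point of maximal norm is not interior to a segment of
    the disc. *)
Lemma norm_extreme v p r : dot p p <= dot v v -> dot r r <= dot v v -> seg p r v -> v = p \/ v = r.
Proof.
move=> hp hr [s /=]; rewrite in_itv /= => /andP[s0 s1] e.
have [se|s0'] := eqVneq s 0; first by left; rewrite -e se scale0r addr0.
have [se|s1'] := eqVneq s 1; first by right; rewrite -e se scale1r addrC subrK.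
have sp : 0 < s * (1 - s) by rewrite mulr_gt0 // ?subr_gt0 lt_neqAle ?s0 ?s1 ?andbT // eq_sym.
have [h|h] := eqVneq (r - p) 0; first by left; rewrite -e h scaler0 addr0.
have E1 : dot v v = (1 - s) * dot p p + s * dot r r - s * (1 - s) * dot (r - p) (r - p).
  by rewrite -e /dot !coordE; ring.
have h0 := mulr_gt0 sp (dot_gt0 h).
have h1 : (1 - s) * dot p p <= (1 - s) * dot v v by rewrite ler_wpM2l ?subr_ge0.
have h2 : s * dot r r <= s * dot v v by rewrite ler_wpM2l.
by exfalso; lra.
Qed.

Variables (C : set V) (v w : V) (q : seq V).
Hypothesis oC : open C.
Hypothesis escape : forall y, ~ C y -> exists a : R, exit C y a.
Let u := last w q.
Hypothesis hw : seg v w `<=` C.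
Hypothesis hu : seg v u `<=` C.
Hypothesis gq : good C w q.
Hypothesis q0 : q != [::].
Hypothesis vmax : forall z, z \in w :: q -> dot z z <= dot v v.

Let dw := w - v.
Let du := u - v.
Let uq : u \in w :: q. Proof. exact: mem_last. Qed.
Let wq : w \in w :: q. Proof. exact: mem_head. Qed.

(** Since [v] has maximal norm, it is not strictly between [w] and [u] ([m0]), so the flat triangle
    reduces to the longer of the two edges at [v]. *)
Lemma flat_triangle (A B : R) : cross dw du = 0 -> 0 <= A -> 0 <= B -> A + B <= 1 ->
  C (v + A *: dw + B *: du).
Proof.
move=> D0 A0 B0 AB.
have [dw0|dw0] := eqVneq dw 0.
  rewrite dw0 scaler0 addr0; apply: hu; exists B => //=; rewrite in_itv /=.
  by rewrite B0 /=; lra.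
pose m := dot dw du / dot dw dw.
have ww := dot_gt0 dw0.
have duE : du = m *: dw by exact: cross0_collinear.
clearbody m.
have wE : w = v + dw by rewrite /dw addrC subrK.
have uE : u = v + m *: dw by rewrite -duE /du addrC subrK.
have nw := vmax wq; have nu := vmax uq.
have m0 : 0 <= m.
  rewrite leNgt; apply/negP => mneg.
  have h1 : 2 * dot v dw + dot dw dw <= 0.
    by move: nw; rewrite {1 2}wE
      (_ : dot (v + dw) (v + dw) = dot v v + 2 * dot v dw + dot dw dw); [lra|rewrite /dot !coordE; ring].
  have h2 : m * (2 * dot v dw) + m ^+ 2 * dot dw dw <= 0.
    move: nu; rewrite {1 2}uE
      (_ : dot (v + m *: dw) (v + m *: dw) = dot v v + (m * (2 * dot v dw) + m ^+ 2 * dot dw dw)); [lra|rewrite /dot !coordE; ring].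
  have h3 : 0 < m ^+ 2 * dot dw dw by apply: mulr_gt0 => //; rewrite exprn_even_gt0 //= lt_eqF.
  by nra.
have -> : v + A *: dw + B *: du = v + (A + B * m) *: dw by rewrite duE -addrA scalerA -scalerDl.
have Bm : 0 <= B * m by exact: mulr_ge0.
have [h|h] := leP (A + B * m) 1.
  by apply: hw; exists (A + B * m) => //=; rewrite in_itv /= h addr_ge0.
have m1 : 1 < m by nra.
apply: hu; exists (A / m + B).
  rewrite /= in_itv /= addr_ge0 ?divr_ge0 //=.
  have : A / m <= A by rewrite ler_pdivrMr ?ler_peMr // ?(ltW m1) // (lt_trans ltr01).
  by lra.
by rewrite (duE : u - v = m *: dw) scalerA mulrDl divfK // gt_eqF // (lt_trans ltr01).
Qed.

(** [t] is the infimum of the levels [A + B] at which the segment parallel to the side from [w] to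
    [u] leaves [C]; it is attained because that segment is compact and [C] is open. The obstruction
    is off both edges at [v], which lie in [C]. *)
Lemma first_obstruction : ~ (tri v w u `<=` C) -> exists t A B,
  [/\ [/\ 0 < A, 0 < B & A + B = t], t <= 1, ~ C (v + A *: dw + B *: du)
   & forall A' B', 0 <= A' -> 0 <= B' -> A' + B' < t -> C (v + A' *: dw + B' *: du)].
Proof.
move=> nT.
have Cv : C v by exact: hw _ (segL v w).
pose D t s := v + t *: ((1 - s) *: dw + s *: du).
have DE t s : D t s = v + (t * (1 - s)) *: dw + (t * s) *: du.
  by rewrite /D scalerDr !scalerA addrA.
have toD A B : A + B != 0 -> v + A *: dw + B *: du = D (A + B) (B / (A + B)).
  by move=> AB; rewrite DE; congr (_ + _ *: _ + _ *: _); field.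
pose S := [set t : R | 0 <= t <= 1 /\ exists2 s, 0 <= s <= 1 & ~ C (D t s)].
have [z [A [B [A0 B0 AB zE]]] nCz] : exists2 z, tri v w u z & ~ C z.
  by apply: contrapT => h; apply: nT => z Tz; apply: contrapT => nz; apply: h; exists z.
have AB0 : A + B != 0.
  apply/eqP => h; have [A00 B00] : A = 0 /\ B = 0 by split; lra.
  by apply: nCz; rewrite zE A00 B00 !scale0r !addr0.
have ABp : 0 < A + B by rewrite lt_neqAle eq_sym AB0 addr_ge0.
have SAB : S (A + B).
  split; first by rewrite addr_ge0.
  exists (B / (A + B)); last by rewrite -toD // -zE.
  by rewrite divr_ge0 ?(ltW ABp) //= ler_pdivrMr // mul1r lerDr.
have hiS : has_inf S by split; [exists (A + B)|exists 0 => t [/andP[]]].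
pose t := inf S.
have t0 : 0 <= t by apply: lb_le_inf; [exists (A + B)|move=> r [/andP[]]].
have t1 : t <= 1 by apply: le_trans AB; apply: ge_inf => //; case: hiS.
have [_ [s /andP[s0 s1] nCy]] : S t.
  apply: contrapT => nS.
  have cK : compact `[0 : R, 1]%classic by exact: segment_compact.
  move/compact_near_coveringP: cK => /(_ _ (nbhs t) (fun t' s => C (D t' s))) h.
  suff /nbhs_ballP[d /= d0 hd] : \forall t' \near t, `[0, 1]%classic `<=` (fun s => C (D t' s)).
    have [t' St' t'd] := inf_adherent d0 hiS.
    have [_ [s s01 nC]] := St'.
    have tt' : t <= t' by apply: ge_inf St'; case: hiS.
    apply: nC; apply: (hd t'); last by rewrite /= in_itv.
    by rewrite /ball /= ltr_distlC; apply/andP; split; rewrite -/t in t'd; lra.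
  apply: h => s /=; rewrite in_itv /= => s01.
  have Cs : C (D t s).
    by apply: contrapT => nC; apply: nS; split; [rewrite t0|exists s].
  have cv : D ts.2 ts.1 @[ts --> (s, t)] --> D t s.
    have c1 : (fun ts : R * R => ts.1) @ (s, t) --> s by exact: cvg_fst.
    have c2 : (fun ts : R * R => ts.2) @ (s, t) --> t by exact: cvg_snd.
    have c3 : (fun ts : R * R => (1 - ts.1) *: dw + ts.1 *: du) @ (s, t) --> (1 - s) *: dw + s *: du.
      apply: cvgD; apply: cvgZr_tmp => //.
      exact: (cvgB (cvg_cst (1 : R)) c1).
    exact: (cvgD (cvg_cst v) (cvgZ c2 c3)).
  have [[P Q] /= [nP nQ] PQ] : \forall ts \near (s, t), C (D ts.2 ts.1).
    by apply: cv; exact: open_nbhs_nbhs.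
  by exists (P, Q).
have tpos : 0 < t.
  rewrite lt_neqAle t0 andbT eq_sym; apply/eqP => e.
  by apply: nCy; rewrite e /D scale0r addr0.
have s0' : s != 0.
  apply/eqP => e; apply: nCy; rewrite DE e subr0 mulr1 mulr0 scale0r addr0.
  by apply: hw; exists t => //=; rewrite in_itv /= t0.
have s1' : s != 1.
  apply/eqP => e; apply: nCy; rewrite DE e subrr mulr1 mulr0 scale0r addr0.
  by apply: hu; exists t => //=; rewrite in_itv /= t0.
exists t, (t * (1 - s)), (t * s); split => //.
- split; [| |by ring].
  + by rewrite mulr_gt0 // subr_gt0 lt_neqAle s1'.
  + by rewrite mulr_gt0 // lt_neqAle eq_sym s0'.
- by rewrite -DE.
- move=> A' B' A'0 B'0 A'B'.
  have [h|h] := eqVneq (A' + B') 0.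
    by have [-> ->] : A' = 0 /\ B' = 0 by [split; lra]; rewrite !scale0r !addr0.
  have hp : 0 < A' + B' by rewrite lt_neqAle eq_sym h addr_ge0.
  rewrite toD //; apply: contrapT => nC.
  have : t <= A' + B'.
    apply: ge_inf; first by case: hiS.
    split; first by rewrite addr_ge0 //=; lra.
    exists (B' / (A' + B')) => //.
    by rewrite divr_ge0 ?(ltW hp) //= ler_pdivrMr // mul1r lerDr.
  by lra.
Qed.

Lemma polygon_step :
  [\/ tri v w u `<=` C,
      exists q1 z q2, [/\ w :: q = q1 ++ z :: q2, (0 < size q1)%N, (0 < size q2)%N & seg v z `<=` C],
      exists q1 a b q2 c, [/\ q = q1 ++ a :: b :: q2, seg v w c & seg a b c]
    | exists q1 a b q2 c, [/\ w :: q = q1 ++ a :: b :: q2 ++ [:: u], seg v u c & seg a b c]].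
Proof.
have [T|nT] := pselect (tri v w u `<=` C); first by constructor 1.
have [t [A0 [B0 [[A00 B00 ABt] t1 nCy Tplus]]]] := first_obstruction nT.
set y := v + A0 *: dw + B0 *: du in nCy.
set De := cross dw du.
have De0 : De != 0.
  apply/eqP => D0; apply: nCy; apply: flat_triangle => //; [exact: ltW|exact: ltW|by rewrite ABt].
(* Affine coordinates with origin [v] and axes along the edges to [w] and [u]. *)
pose al z := cross (z - v) du / De; pose be z := cross dw (z - v) / De.
have zE z : z = v + al z *: dw + be z *: du.
  by rewrite /al /be -addrA -cross_frame // addrC subrK.
have alw : al w = 1 by rewrite /al divff.
have bew : be w = 0 by rewrite /be crossvv mul0r.
have alu : al u = 0 by rewrite /al crossvv mul0r.
have beu : be u = 1 by rewrite /be divff.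
have alv z : al (v + (z - v)) = al z by congr al; rewrite addrC subrK.
have alin p r k : al (p + k *: (r - p)) = al p + k * (al r - al p).
  by rewrite /al !lin; field.
have blin p r k : be (p + k *: (r - p)) = be p + k * (be r - be p).
  by rewrite /be !lin; field.
have alC A B : al (v + A *: dw + B *: du) = A.
  rewrite /al (_ : v + A *: dw + B *: du - v = A *: dw + B *: du).
    by rewrite cross_combl mulfK.
  by apply: vecP; rewrite !coordE; ring.
have beC A B : be (v + A *: dw + B *: du) = B.
  rewrite /be (_ : v + A *: dw + B *: du - v = A *: dw + B *: du).
    by rewrite cross_combr mulfK.
  by apply: vecP; rewrite !coordE; ring.
(* Below level [t] the triangle lies in [C], so a vertex there is visible from [v]. It is neither
   [w] nor [u], whose level is 1, so both sides of the splitting are nonempty. *)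
have vsplit z q1 q2 : w :: q = q1 ++ z :: q2 -> 0 <= al z -> 0 <= be z -> al z + be z < t ->
    exists q1 z q2, [/\ w :: q = q1 ++ z :: q2, (0 < size q1)%N, (0 < size q2)%N & seg v z `<=` C].
  move=> e az bz abz; exists q1, z, q2; split => //.
  - case: q1 e => [|//] /= [e _]; rewrite -e alw in az abz; rewrite -e in bz.
    by move: abz bz t1; lra.
  - case: q2 e => [|//] e.
    have uz : u = z by rewrite /u -(last_cons v w q) e last_cat.
    by rewrite -uz alu beu in abz; lra.
  - move=> z1 [k /=]; rewrite in_itv /= => /andP[k0 k1] <-.
    have -> : v + k *: (z - v) = v + (k * al z) *: dw + (k * be z) *: du.
      by rewrite {1}(zE z); apply: vecP; rewrite !coordE; ring.
    apply: Tplus; [exact: mulr_ge0|exact: mulr_ge0|].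
    by rewrite -mulrDr (le_lt_trans _ abz) // ler_piMl // addr_ge0.
have [a ea] := escape nCy.
(* Otherwise the exit of y and the segment [y, v] separate w from u. *)
have [k /andP[k0 k1] [s s01 cE]] : exists2 k, 0 <= k < 1 &
    exists2 s, 0 <= s <= 1 & pth w q s = v + k *: (y - v).
  apply: contrapT => nc.
  have [cq Cq] := pth_cpath gq.
  pose A := [set pth w q s | s in `[0, 1]].
  have cA : connected A.
    apply: connected_continuous_connected; first exact: segment_connected.
    exact: continuous_subspaceT.
  have AC z : A z -> C z by move=> [s /=]; rewrite in_itv /= => s01 <-; exact: Cq.
  have Aw : A w by exists 0; rewrite ?pth0 //= in_itv /= lexx ler01.
  have Au : A u by exists 1; rewrite ?pth1 //= in_itv /= lexx ler01.
  have Amax z : A z -> dot z z <= dot v v.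
    move=> [s /=]; rewrite in_itv /= => s01 <-.
    have [l1 [p [r [l2 [e hz]]]]] := pth_edge w s01 q0.
    by apply: norm_seg hz; apply: vmax; rewrite e mem_cat !inE eqxx ?orbT.
  have ymax : dot y y <= dot v v.
    have -> : y = v + A0 *: dw + B0 *: du by [].
    pose z := w + (B0 / t) *: (u - w).
    have tp : 0 < t by lra.
    have hz : dot z z <= dot v v.
      apply: (norm_seg (vmax wq) (vmax uq)); exists (B0 / t) => //=.
      by rewrite in_itv /= divr_ge0 ?(ltW B00) ?(ltW tp) //= ler_pdivrMr // mul1r; lra.
    apply: (norm_seg (lexx (dot v v)) hz); exists t; first by rewrite /= in_itv /= ltW.
    by rewrite /z /y /dw /du -ABt; apply: vecP; rewrite !coordE; field; rewrite ABt gt_eqF.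
  have Ad d : 0 <= d -> ~ A (y + d *: dir a) by move=> d0 /AC; exact: ea.
  have vy : v - y != 0.
    apply/eqP => e; apply: nCy; rewrite -[y](subrK v) -opprB e oppr0 add0r.
    exact: hw _ (segL v w).
  (* The assumption [nc] excludes points from [y] to [v]; beyond [v] a point of the path would make
     [v] interior to a segment of the disc. *)
  have An d : 0 <= d -> ~ A (y + d *: (v - y)).
    move=> d0 Ay; have [d1|d1] := leP d 1.
      have [dz|dz] := eqVneq d 0.
        by apply: nCy; apply: AC; rewrite dz scale0r addr0 in Ay.
      apply: nc; exists (1 - d).
        by rewrite subr_ge0 d1 /= ltrBlDr ltrDl lt_neqAle eq_sym dz.
      have [s /=] := Ay; rewrite in_itv /= => s01 e; exists s => //.
      by rewrite e; apply: vecP; rewrite !coordE; ring.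
    have [] := @norm_extreme v y (y + d *: (v - y)) ymax (Amax _ Ay).
    - exists d^-1; first by rewrite /= in_itv /= invr_ge0 d0 /= invf_le1 ?(ltW d1) // (lt_trans ltr01).
      by rewrite [y + d *: _]addrC addrK scalerA mulVf ?gt_eqF ?(lt_trans ltr01) // scale1r addrC subrK.
    - by move=> e; move/eqP: vy; apply; rewrite e subrr.
    - move=> e; have : (d - 1) *: (v - y) = 0.
        by rewrite scalerBl scale1r; apply/eqP; rewrite subr_eq0 -(inj_eq (addrI y)) -e [y + _]addrC subrK.
      by move/eqP; rewrite scaler_eq0 subr_eq0 gt_eqF //= (negbTE vy).
  have sw d : 0 <= d -> ~ seg v w (y + d *: dir a) by move=> d0 /hw; exact: ea.
  have su d : 0 <= d -> ~ seg v u (y + d *: dir a) by move=> d0 /hu; exact: ea.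
  have cw : cross (v - y) (w - y) = B0 * De.
    have -> : w = v + dw by rewrite /dw addrC subrK.
    by rewrite /y /De /cross !coordE; ring.
  have cu : cross (v - y) (u - y) = - (A0 * De).
    have -> : u = v + du by rewrite /du addrC subrK.
    by rewrite /y /De /cross !coordE; ring.
  have [Dp|Dn] := ltP 0 De.
  - apply: (separation cA Aw Au Ad An sw su (elimN eqP (dir_neq0 a))); rewrite ?cw ?cu; first exact: mulr_gt0.
    by rewrite oppr_lt0 mulr_gt0.
  - have {}Dn : De < 0 by rewrite lt_neqAle De0.
    apply: (separation cA Au Aw Ad An su sw (elimN eqP (dir_neq0 a))); rewrite ?cw ?cu.
      by rewrite oppr_gt0 pmulr_rlt0.
    by rewrite pmulr_rlt0.
have [l1 [p [r [l2 [e hz]]]]] := pth_edge w s01 q0.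
rewrite cE in hz; set c := v + k *: (y - v) in hz.
have pq : p \in w :: q by rewrite e mem_cat !inE eqxx ?orbT.
have rq : r \in w :: q by rewrite e mem_cat !inE eqxx ?orbT.
have psplit : 0 <= al p -> 0 <= be p -> al p + be p < t -> _ := vsplit p l1 (r :: l2) e.
have rsplit : 0 <= al r -> 0 <= be r -> al r + be r < t -> _ :=
  vsplit r (l1 ++ [:: p]) l2 (etrans e (catA l1 [:: p] (r :: l2))).
have tp : 0 < t by lra.
have av : al v = 0 by rewrite /al subrr /cross !coordE !mul0r subrr mul0r.
have bv : be v = 0 by rewrite /be subrr /cross !coordE !mulr0 subrr mul0r.
(* If the path passes through [v] itself, then by extremality [v] is a vertex of the path, and it is
   visible from itself. *)
have [kz|kz] := eqVneq k 0.
  constructor 2; move: hz; rewrite /c kz scale0r addr0 => hz.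
  have [e'|e'] := norm_extreme (vmax pq) (vmax rq) hz.
  - by apply: psplit; rewrite -e' ?av ?bv ?addr0.
  - by apply: rsplit; rewrite -e' ?av ?bv ?addr0.
have kp : 0 < k by rewrite lt_neqAle eq_sym kz.
have cE' : c = v + (k * A0) *: dw + (k * B0) *: du.
  by rewrite /c /y; apply: vecP; rewrite !coordE; ring.
have alc : al c = k * A0 by rewrite cE' alC.
have bec : be c = k * B0 by rewrite cE' beC.
have alc0 : 0 < al c by rewrite alc mulr_gt0.
have bec0 : 0 < be c by rewrite bec mulr_gt0.
have abc : al c + be c < t by rewrite alc bec -mulrDr ABt gtr_pMl.
have abc1 : al c + be c < 1 by lra.
(* On the edge through [c] the level is affine, so one end has a level not above that of [c]. *)
have [z0 [zpr z0le z0split]] : exists z0, [/\ seg p r z0, al z0 + be z0 <= al c + be c &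
    (0 <= al z0 -> 0 <= be z0 -> al z0 + be z0 < t ->
    exists q1 z q2, [/\ w :: q = q1 ++ z :: q2, (0 < size q1)%N, (0 < size q2)%N & seg v z `<=` C])].
  have [j /=] := hz; rewrite in_itv /= => /andP[j0 j1] jc.
  have [h|h] := leP (al p + be p) (al c + be c).
    by exists p; split => //; exact: segL.
  exists r; split => //; first exact: segR.
  have : al c + be c = (al p + be p) + j * ((al r + be r) - (al p + be p)).
    by rewrite -jc alin blin; ring.
  move: h; set f := al p + be p; set g := al r + be r; set h := al c + be c => fh hE.
  rewrite leNgt; apply/negP => hg; have [gf|gf] := leP f g.
    by have := mulr_ge0 j0 (etrans (subr_ge0 f g) gf); lra.
  have j1' : 0 <= 1 - j by lra.
  have gf' : 0 <= f - g by lra.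
  by have := mulr_ge0 j1' gf'; rewrite mulrBl mul1r !mulrBr; lra.
(* That end lies in the small triangle, giving a visible vertex, or outside the quadrant, giving a
   crossing with an edge at [v]. *)
have [pos|neg] := pselect (0 <= al z0 /\ 0 <= be z0).
  by constructor 2; case: pos => h1 h2; apply: z0split => //; exact: le_lt_trans abc.
have neg' : al z0 < 0 \/ be z0 < 0.
  by have [h1|h1] := leP 0 (al z0); [right; rewrite ltNge; apply/negP => h2; apply: neg|left].
have [j j01 crossing] := exit_cone alc0 bec0 abc1 z0le neg'.
pose c' := c + j *: (z0 - c).
have c'pr : seg p r c' by apply: seg_convex.
have alc' : al c' = al c + j * (al z0 - al c) by exact: alin.
have bec' : be c' = be c + j * (be z0 - be c) by exact: blin.
rewrite -alc' -bec' in crossing.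
have [i1 /=] := hz; rewrite in_itv /= => _ i1E.
have [i2 /=] := c'pr; rewrite in_itv /= => _ i2E.
case: crossing => [[a'0 /andP[b'0 b'1]]|[b'0 /andP[a'0 a'1]]].
- constructor 4.
  have cu : seg v u c'.
    exists (be c'); first by rewrite /= in_itv /= b'0 ltW.
    by rewrite [RHS]zE a'0 scale0r addr0.
  (* The edge is not the last one: from an interior point of the quadrant an edge ending at [u]
     reaches the axis of [u] only at [u], where the coordinate is 1. The other case excludes the
     first edge in the same way. *)
  have l2n : l2 <> [::].
    move=> l2e; have ur : u = r by rewrite /u -(last_cons v w q) e l2e last_cat.
    have h1 : al c = al p * (1 - i1) by rewrite -i1E alin -ur alu; ring.
    have h2 : al p * (1 - i2) = 0 by rewrite -a'0 -i2E alin -ur alu; ring.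
    have i21 : i2 = 1.
      move/eqP: h2; rewrite mulf_eq0 => /orP[/eqP h|].
        by move: alc0; rewrite h1 h mul0r ltxx.
      by rewrite subr_eq0 => /eqP.
    move: b'1; rewrite -i2E i21 scale1r [p + _]addrC subrK -ur beu.
    by rewrite ltxx.
  case/lastP: l2 l2n e rsplit psplit => [//|l2 u'] _ e _ _.
  have uu : u = u' by rewrite /u -(last_cons v w q) e last_cat /= last_rcons.
  by exists l1, p, r, l2, c'; split => //; rewrite e uu cats1.
- constructor 3.
  have cw : seg v w c'.
    exists (al c'); first by rewrite /= in_itv /= a'0 ltW.
    by rewrite [RHS]zE b'0 scale0r addr0.
  case: l1 e rsplit psplit => [|w' l1] /= [e1 e2] _ _.
    have h1 : be c = be r * i1 by rewrite -i1E blin -e1 bew; ring.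
    have h2 : be r * i2 = 0 by rewrite -b'0 -i2E blin -e1 bew; ring.
    have i20 : i2 = 0.
      move/eqP: h2; rewrite mulf_eq0 => /orP[/eqP h|/eqP//].
      by move: bec0; rewrite h1 h mul0r ltxx.
    by move: a'1; rewrite -i2E i20 scale0r addr0 -e1 alw ltxx.
  by exists l1, p, r, l2, c'.
Qed.

End Step.

(** * Null-homotopy of polygons, polygonal approximation of paths, and simple connectedness *)

Section Assembly.
Context {R : realType}.
Local Notation V := 'rV[R]_2.
Implicit Types (C : set V) (a b v w z : V) (l : seq V) (g : R -> V).

Lemma max_norm_vertex a l : exists2 v, v \in a :: l & forall z, z \in a :: l -> dot z z <= dot v v.
Proof.
elim: l a => [|b l IH] a.
  by exists a; rewrite ?inE // => z; rewrite inE => /eqP ->.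
have [v vl h] := IH b; have [av|va] := leP (dot a a) (dot v v).
- exists v; first by rewrite inE vl orbT.
  by move=> z; rewrite inE => /orP[/eqP ->//|]; exact: h.
- exists a; first by rewrite mem_head.
  move=> z; rewrite inE => /orP[/eqP ->//|zl].
  by rewrite (le_trans (h _ zl)) // ltW.
Qed.

Lemma polygon_null C a l : open C -> (forall y, ~ C y -> exists a : R, exit C y a) ->
  good C a l -> last a l = a -> nullp C a l.
Proof.
move=> oC esc; have [n] := ubnP (size l); elim: n a l => // n IH a l; rewrite ltnS => sn ga la.
have IHl b m : (size m < size l)%N -> good C b m -> last b m = b -> nullp C b m.
  by move=> sm; apply: IH; exact: leq_trans sn.
(* Closed polygons with at most two edges are constant or spurs; the cuts apply from three edges
   on. *)
case: l sn ga la IHl => [|b [|c [|d l]]] sn ga la IHl.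
- exact: peq_refl.
- move: ga la => /= [h Cb] ba; rewrite ba in h *.
  have aa := segL a a.
  by apply: (@peq_convex _ C (seg a a) a [:: a] [::] (@seg_convex _ a a) h) => /=; first split.
- by move: ga la => /= [h _] ca; rewrite ca; exact: null_back.
have [v vl vmax] := max_norm_vertex b (c :: d :: l).
have [l1 [l2 lE]] : exists l1 l2, [:: b, c, d & l] = l1 ++ v :: l2.
  by case/splitPr: vl => l1 l2; exists l1, l2.
have sl : (2 < size (l1 ++ v :: l2))%N by rewrite -lE.
rewrite lE in ga la IHl vmax sn *; apply: null_rotate => //.
have gv : good C v (l2 ++ l1 ++ [:: v]).
  move: ga => /good_cat[g1 [hv g2]]; move: la; rewrite last_cat /= => la.
  by apply/good_cat; split => //; rewrite la; apply/good_cat; split => //=; split => //; exact: hv _ (segR _ _).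
have sz : size (l1 ++ v :: l2) = (size (l2 ++ l1)).+1 by rewrite !size_cat /=; lia.
have s2 : (1 < size (l2 ++ l1))%N by rewrite -ltnS -sz.
have lmax z : z \in l2 ++ l1 -> dot z z <= dot v v.
  by move=> zl; apply: vmax; move: zl; rewrite !mem_cat inE => /orP[->|->]; rewrite ?orbT.
rewrite catA in gv *; case: (l2 ++ l1) gv sz s2 lmax => [//|w q] gv sz s2 lmax.
have [hw /good_cat[gq [hu _]]] := gv; have q0 : q != [::] by case: (q) s2.
have hu' : seg v (last w q) `<=` C by apply: subset_trans hu; exact: segC.
rewrite sz in IHl.
case: (polygon_step oC esc hw hu' gq q0 lmax) => [T|[q1 [z [q2 [e s1 s2' h]]]]
  |[q1 [p [r [q2 [c' [e h1 h2]]]]]]|[q1 [p [r [q2 [c' [e h1 h2]]]]]]].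
- exact: (cut_triangle IHl).
- rewrite e -catA in gv *; apply: (cut_vertex IHl gv _ s1 s2' h).
  by have := congr1 size e; rewrite size_cat /=; lia.
- rewrite e cat_cons -catA in gv *; apply: (cut_cross1 IHl gv _ h1 h2).
  by have := congr1 size e; rewrite size_cat /=; lia.
- rewrite e -catA !cat_cons -catA /= in gv *; apply: (cut_cross2 IHl gv _ h1 h2).
  by have := congr1 size e; rewrite size_cat /= size_cat /=; lia.
Qed.

(** Supremum argument: near the supremum of the set where [P] holds, [P] passes from a point before
    it to a point beyond it, unless 1 is reached. *)
Lemma unit_interval_chain (P : R -> Prop) : P 0 ->
  (forall s, 0 <= s <= 1 -> exists2 d : R, 0 < d & forall s' s'', 0 <= s' <= 1 -> 0 <= s'' <= 1 ->
    `|s' - s| < d -> `|s'' - s| < d -> P s' -> P s'') -> P 1.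
Proof.
move=> P0 loc; pose S := [set s : R | 0 <= s <= 1 /\ P s].
have S0 : S 0 by split; rewrite // lexx ler01.
have hS : has_sup S by split; [exists 0|exists 1 => s [/andP[]]].
have b0 : 0 <= sup S by apply: ub_le_sup => //; case: hS.
have b1 : sup S <= 1 by apply: ge_sup; [exists 0|move=> s [/andP[]]].
have [d d0 h] := loc (sup S) (introT andP (conj b0 b1)).
have [s [s01 Ps] sd] := sup_adherent d0 hS.
have sle : s <= sup S by apply: ub_le_sup; [case: hS|].
pose r := Num.min 1 (sup S + d / 2).
have r1 : r <= 1 by rewrite ge_min lexx.
have rle : r <= sup S + d / 2 by rewrite ge_min lexx orbT.
have rge : sup S <= r by rewrite le_min b1 /=; lra.
have r01 : 0 <= r <= 1 by rewrite r1 andbT; lra.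
have Pr : P r.
  by apply: (h s r) => //; rewrite ltr_norml; apply/andP; split; lra.
have : r <= sup S by apply: ub_le_sup; [case: hS|].
rewrite /r; have [h1|h1] := leP 1 (sup S + d / 2).
  by move=> _; move: Pr; rewrite /r min_l.
by lra.
Qed.

Lemma ball_convex a (d : R) : convex [set z | `|z - a| < d].
Proof.
move=> p q t pa qa t01; apply: (seg_ball pa qa).
by exists t => //=; rewrite in_itv.
Qed.

(** The property propagated along [[0, 1]] is that the part of the path up to [s] is homotopic to a
    polygon; within a ball of [C] the next piece of the path is replaced by a segment. *)
Lemma path_polygon C g : open C -> cpath C g ->
  exists l, [/\ good C (g 0) l, last (g 0) l = g 1 & homotopic C g (pth (g 0) l)].
Proof.
move=> oC pg; have [cg Cg] := pg.
pose P s := exists l, [/\ good C (g 0) l, last (g 0) l = g s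
  & homotopic C (fun t => g (0 + t * (s - 0))) (pth (g 0) l)].
have cl (b c : R) : continuous (fun t : R => b + t * (c - b)).
  by move=> t; exact: (cvgD (cvg_cst b) (cvgM (@cvg_id _ _) (cvg_cst (c - b)))).
have il (b c t : R) : 0 <= b <= 1 -> 0 <= c <= 1 -> 0 <= t <= 1 -> 0 <= b + t * (c - b) <= 1.
  exact: itv_convex.
have i0 : 0 <= (0 : R) <= 1 by rewrite lexx ler01.
suff [l [h1 h2 h3]] : P 1.
  exists l; split => //; move: h3.
  by rewrite (_ : (fun t => g (0 + t * (1 - 0))) = g) //; apply/funext => t; rewrite add0r subr0 mulr1.
apply: unit_interval_chain.
  exists [::]; split => //=; first exact: Cg.
  apply: hom_ext; first split.
  - exact: comp_continuous (cl 0 0) cg.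
  - by move=> s s01; apply: Cg; exact: il.
  - by move=> s _; rewrite subrr mulr0 addr0.
move=> s s01; have [d d0 hd] := open_normE oC (Cg s s01).
pose D := [set z : V | `|z - g s| < d].
have cD : convex D := @ball_convex (g s) d.
have DC : D `<=` C by move=> z; exact: hd.
have nD : nbhs s (g @^-1` D) by apply: (cg s); exact: norm_nbhs d0 _.
move/nbhs_ballP: nD => [e /= e0 he].
exists e => // s' s'' s'01 s''01 s'e s''e [l [gl el hl]].
have near t : `|t - s| < e -> D (g t) by move=> te; apply: he; rewrite /ball /= distrC.
have gD : good D (g s') [:: g s''].
  by split; [apply: convex_seg => //; exact: near|exact: near].
have gC := good_sub DC gD.
exists (l ++ [:: g s'']); split; first by apply/good_cat; rewrite el.
  by rewrite last_cat.
(* The route from 0 to [s''] is taken through [s']. This is legitimate even when [s''] is smaller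
   than [s'], as only the end points of a reparametrisation matter. *)
pose f1 t := 0 + t * (s' - 0) : R; pose f2 t := s' + t * (s'' - s') : R.
have f12 : f1 1 = f2 0 by rewrite /f1 /f2; ring.
have c12 : continuous (pcat f1 f2 : R -> R^o) by apply: (@pcat_continuous R R^o); exact: cl.
have pg1 : cpath C (fun t => g (f1 t)).
  by split; [exact: comp_continuous (cl _ _) cg|move=> t t01; apply: Cg; exact: il].
have pg2 : cpath C (fun t => g (f2 t)).
  by split; [exact: comp_continuous (cl _ _) cg|move=> t t01; apply: Cg; exact: il].
apply: (@hom_trans _ _ (fun t => g (pcat f1 f2 t))).
  apply: (hom_reparam pg) => //.
  - by move=> t t01; exact: il.
  - by move=> t t01; have [[-> h]|[-> h]] := pcat_cases f12 t01; exact: il.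
  - by rewrite pcat0 /f1; ring.
  - by rewrite pcat1 // /f2; ring.
apply: (@hom_trans _ _ (pcat (fun t => g (f1 t)) (fun t => g (f2 t)))).
  apply: hom_ext; first split.
  - exact: comp_continuous c12 cg.
  - by move=> t t01; apply: Cg; have [[-> h]|[-> h]] := pcat_cases f12 t01; exact: il.
  - move=> t t01; rewrite /pcat; have [[-> [-> _]]|[-> [-> _]]] := half_cases t01.
      by rewrite !subrr !addr0.
    by rewrite f12 [X in g X = _]addrC subrK [RHS]addrC subrK.
apply: (@hom_trans _ _ (pcat (pth (g 0) l) (pth (g s') [:: g s'']))).
  apply: hom_cat => //; first by rewrite f12.
  have [cp Dp] := pth_cpath gD; have p0 := pth0 (g s') [:: g s'']; have p1 := pth1 (g s') [:: g s''].
  set p := pth (g s') [:: g s''] in cp Dp p0 p1 *; clearbody p.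
  apply: (@hom_factor R C V id _ _ D) => //.
  - by move=> z; exact: cvg_id.
  - exact: comp_continuous (cl _ _) cg.
  - move=> t t01; apply: near.
    have -> : f2 t = s' + t *: (s'' - s') by [].
    have -> : s' + t *: (s'' - s') - s = (1 - t) * (s' - s) + t * (s'' - s) by rewrite /GRing.scale /=; ring.
    set m := Num.max `|s' - s| `|s'' - s|; have me : m < e by rewrite gt_max s'e.
    apply: le_lt_trans me; apply: le_trans (ler_normD _ _) _; rewrite !normrM.
    have m1 : `|s' - s| <= m by rewrite le_max lexx.
    have m2 : `|s'' - s| <= m by rewrite le_max lexx orbT.
    have /andP[t0 t1] := t01; rewrite (ger0_norm t0) ger0_norm ?subr_ge0 //.
    by nra.
  - by rewrite p0 /f2 mul0r addr0.
  - by rewrite p1 /f2 mul1r addrC subrK.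
by apply: hom_sym; rewrite -el; apply: pth_cat; apply/good_cat; rewrite el.
Qed.

(** The set of points reached from [a] by polygons is nonempty and both open and closed in [C]. *)
Lemma open_connected_polygon C a b : open C -> connected C -> C a -> C b ->
  exists2 l, good C a l & last a l = b.
Proof.
move=> oC cC Ca Cb; pose S := [set z | exists2 l, good C a l & last a l = z].
have SC : S `<=` C by move=> z [l gl <-]; rewrite -pth1; apply: (pth_cpath gl).2; rewrite ler01 lexx.
have ext z (d : R) y y' : (forall x, `|x - z| < d -> C x) -> `|y - z| < d -> `|y' - z| < d -> S y -> S y'.
  move=> hd yd yd' [l gl el]; exists (l ++ [:: y']); last by rewrite last_cat.
  apply/good_cat; split => //; rewrite el; split; last exact: hd.
  by apply: subset_trans (hd : [set x | _] `<=` C); apply: convex_seg => //; exact: ball_convex.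
suff SE : S = C by have : S b by rewrite SE.
apply: cC; first by exists a, [::].
- exists S; last by apply/seteqP; split => [z Sz|z []//]; split => //; exact: SC.
  rewrite openE => z Sz; have [d d0 hd] := open_normE oC (SC z Sz).
  by apply: (norm_nbhs d0) => y yd; apply: (ext z d z) => //; rewrite subrr normr0.
- exists (closure S); first exact: closed_closure.
  apply/seteqP; split => [z Sz|z [Cz cz]]; first by split; [exact: SC|exact: subset_closure].
  have [d d0 hd] := open_normE oC Cz.
  have [y Sy yd] := closure_normE cz d0.
  by apply: (ext z d y) => //; rewrite subrr normr0.
Qed.

(** Clamping the parameter to [[0, 1]] turns a path continuous on the interval into one continuous
    on the whole line, as [cpath] requires. *)
Lemma clamp_continuous g : {within `[0, 1], continuous g} ->
  continuous (fun s : R => g (Num.max 0 (Num.min 1 s))).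
Proof.
move=> /subspace_continuousP cg s.
have k01 t : `[0, 1]%classic (Num.max 0 (Num.min 1 t) : R).
  by rewrite /= in_itv /= le_max lexx /= ge_max ler01 ge_min lexx.
have ck : Num.max 0 (Num.min 1 t) @[t --> s] --> (Num.max 0 (Num.min 1 s) : R).
  apply: (@continuous_max R R (fun=> 0) (fun t => Num.min 1 t) s); first exact: cvg_cst.
  by apply: (@continuous_min R R (fun=> 1) id s); [exact: cvg_cst|exact: cvg_id].
move=> A /(cg _ (k01 s)) /ck h.
exact: (@filterS R (nbhs s) _ _ _ (fun t (k_in : _ -> A (g (Num.max 0 (Num.min 1 t)))) => k_in (k01 t)) h).
Qed.

Lemma escape_simply_connected C : open C -> connected C ->
  (forall y, ~ C y -> exists a : R, exit C y a) -> simply_connected C.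
Proof.
move=> oC cC esc; split.
  move=> a b Ca Cb; have [l gl el] := open_connected_polygon oC cC Ca Cb.
  have [cp Cp] := pth_cpath gl.
  exists (pth a l); split; rewrite ?pth0 ?pth1 //; first exact: continuous_subspaceT.
  by move=> _ [s /= + <-]; rewrite in_itv /=; exact: Cp.
move=> g cg gC g01.
pose k (s : R) : R := Num.max 0 (Num.min 1 s).
have kE s : 0 <= s <= 1 -> k s = s by move=> /andP[s0 s1]; rewrite /k min_r // max_r.
have i0 : 0 <= (0 : R) <= 1 by rewrite lexx ler01.
have i1 : 0 <= (1 : R) <= 1 by rewrite lexx ler01.
have pgk : cpath C (fun s => g (k s)).
  split; first exact: clamp_continuous.
  by move=> s s01; rewrite kE //; apply: gC; exists s => //=; rewrite in_itv.
have [l] := path_polygon oC pgk; rewrite /= !kE // -g01 => -[gl el hl].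
have [H [cH CH H0 H1 He]] := hom_trans hl (polygon_null oC esc gl el).
exists H; split.
- exact: continuous_subspaceT.
- by move=> _ [[s t] [/= + +] <-]; rewrite !in_itv /=; exact: CH.
- by move=> s s01; rewrite H0 // kE.
- by move=> s s01; rewrite H1.
- by move=> t t01; have := He t t01; rewrite !kE // -g01.
Qed.

End Assembly.

Theorem theorem5 (R : realType) (E : set 'rV[R]_2)
    (E_open : open E) (E_smooth : has_smooth_boundary E)
    (E_weak : weakly_semiconvex1 E) (E_not : ~ semiconvex1 E) :
  (forall C : set 'rV[R]_2, components E C -> simply_connected C) /\
  [set: 'I_4] #<= components E.
Proof.
split=> [C cC|].
  apply: escape_simply_connected; [exact: component_open E_open _ cC|exact: components_connected cC|].
  by move=> y; exact: component_escape E_open E_smooth E_weak cC.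
have /existsNP[x /not_implyP[nEx nsc]] := E_not.
apply: (trapped_card E_open _ _ nEx nsc) => p.
- exact: weak_exit.
- exact: smooth_half_plane_ext.
Qed.
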